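(* Let $f$ be the matrix Nevanlinna function of a positive $d\times d$ matrix measure $\mu$ on $\mathbb{R}$ such that $\mu(\mathbb{R})=1_0$ is the identity matrix. Suppose that there exists a sequence of matrix orthonormal polynomials $p_n(z)=\kappa_nz^n+\cdots$, $n\ge0$, with respect to $\langle p|q\rangle=\int p^\dagger\,d\mu\,q$, normalized by $p_0=1_0$ and so that $$zp_n(z)=p_{n+1}(z)a_n+p_n(z)b_n+p_{n-1}(z)a_{n-1},\qquad n\ge0\quad(a_{-1}=0),$$ with matrix coefficients $b_n=b_n^\dagger$, $a_n>0$, and that the related block Jacobi matrix (with diagonal blocks $b_n$ and off-diagonal blocks $a_n$) is self-adjoint as an operator on $\ell^2$ with maximal domain. Then the Nevanlinna function of the matrix measure $d\mu_n:=p_n^\dagger\,d\mu\,p_n$ is given by the following sum of Nevanlinna functions: $$g_n+f_n,\qquad g_n(z)=p_n(z^{-1})^{-1}p_{n-1}(z^{-1})\,\kappa_n^{-1}\kappa_{n-1},\qquad f_n=n\text{-th iterate of } f \text{ for the Schur algorithm.}$$ Equivalently, $$\left(\int\frac{t\,d\mu_n(t)}{1-zt}\right)\left(\int\frac{d\mu_n(t)}{1-zt}\right)^{-1}=g_n(z)+f_n(z),\qquad z\in\mathbb{C}\setminus\mathbb{R},$$ where $f_n$ is the Nevanlinna function with Schur parameters $b_n,a_n,b_{n+1},a_{n+1},b_{n+2},a_{n+2},\dots$ and $g_n$ is the Nevanlinna function with Schur parameters $0,a_{n-1},b_{n-1},a_{n-2},b_{n-2},\dots,a_0,b_0$. Here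 $b_0,a_0,b_1,a_1,b_2,a_2,\dots$ are the Jacobi coefficients above, i.e. the Schur parameters of $f$ with respect to the Schur algorithm.
   Context: A matrix Nevanlinna function is an analytic $d\times d$ matrix valued function $f$ on $\mathbb{C}\setminus\mathbb{R}$ with $f(z)^\dagger=f(\overline z)$ and $\operatorname{Im}f(z)/\operatorname{Im}z\ge0$, where $\operatorname{Im}A=(A-A^\dagger)/(2i)$; it is degenerate if $\ker\operatorname{Im}f(z)$ (which is independent of $z\in\mathbb{C}\setminus\mathbb{R}$) is non-trivial. For a positive matrix measure $\mu$ on $\mathbb{R}$ with $\mu(\mathbb{R})=1_0$, the Nevanlinna function of $\mu$ is the function $f$ determined by $\int\frac{d\mu(t)}{1-zt}=(1_0-zf(z))^{-1}$, $z\in\mathbb{C}\setminus\mathbb{R}$; this establishes a one-to-one correspondence between such measures and a class of Nevanlinna functions. In $\int p^\dagger d\mu\,q$, $p(t)^\dagger$ is the adjoint of the matrix $p(t)$, $t\in\mathbb{R}$; orthonormality means $\langle p_n|p_m\rangle=\delta_{n,m}1_0$, and $\kappa_n$ is the (invertible) leading coefficient of $p_n$. Convention: $p_{-1}=0$ (so $g_0=0$). The block Jacobi matrix acts on $\{v\in\ell^2:\mathcal{J}v\in\ell^2\}$ (maximal domain) by matrix multiplication; its block rows are $(b_0,a_0,0,\dots)$, $(a_0,b_1,a_1,0,\dots)$, $(0,a_1,b_2,a_2,\dots)$, etc. Schur algorithm: starting at a Nevanlinna function $f_0=f$ for which the normal limits and normal derivatives of all orders at $0$ exist (limits along $z=iy$,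 $y\to0$ real), set $$f_{n+1}(z)=z^{-1}a_n^{-1}(f_n(z)-b_n-a_n^2z)(f_n(z)-b_n)^{-1}a_n,$$ with $b_n=f_n(0):=\lim_{y\to0}f_n(iy)$, $a_n^2=f_n'(0):=\lim_{y\to0}\frac{f_n(iy)-f_n(0)}{iy}$, $a_n>0$; the algorithm stops when a degenerate iterate arises. The $f_n$ are the iterates of $f$, and $b_0,a_0,b_1,a_1,\dots$ are the Schur parameters of $f$; a terminating sequence $\dots,a,b$ means that the last iterate is the constant $b$. *)

(* Defs.v *)
(* Complex numbers are R[i] with R : realType.  Matrices of size d >= 1 are
   written 'M[R[i]]_d.+1, which makes them a ring. *)
From HB Require Import structures.
From mathcomp Require Import all_boot all_order all_algebra.
From mathcomp Require Import complex.
From mathcomp Require Import all_classical all_reals all_analysis.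

Set Implicit Arguments.
Unset Strict Implicit.
Unset Printing Implicit Defensive.

Import Order.TTheory GRing.Theory Num.Theory.
Import numFieldNormedType.Exports.

Local Open Scope classical_set_scope.
Local Open Scope ring_scope.
Local Open Scope sesquilinear_scope.

(* R[i] as a normed space over itself: the topology is that of the modulus. *)
HB.instance Definition _ (R : realType) := NormedModule.copy R[i] (R[i]^o).

(* s_(n-1), with the convention s_(-1) = 0. *)
Definition preceding (V : nmodType) (s : nat -> V) (n : nat) : V :=
  if n is m.+1 then s m else 0.

Section PositiveMatrices.
Variables (R : realType) (n : nat).
Implicit Types (A : 'M[R[i]]_n) (v : 'cV[R[i]]_n).

Definition qform A v : R[i] := (v ^t* *m A *m v) 0 0.

(* The order of R[i] is partial: 0 <= z means that z is real and z >= 0. *)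
Definition psdmx A : Prop := forall v, 0 <= qform A v.

Definition pdmx A : Prop := forall v, v != 0 -> 0 < qform A v.

Definition mxIm A : 'M[R[i]]_n := (2 * 'i)^-1 *: (A - A ^t*).

End PositiveMatrices.

Section MatrixMeasures.
Variables (R : realType) (d : nat).
Local Notation C := R[i].
Local Notation M := 'M[R[i]]_d.+1.
Implicit Types (mu : set R -> M) (D A : set R) (h : R -> C) (P Q : R -> M).

(* Only the values of mu on Borel sets are relevant. *)
Definition matrix_measure mu : Prop :=
  [/\ mu set0 = 0,
      forall A, measurable A -> psdmx (mu A) &
      forall F : (set R)^nat, (forall n, measurable (F n)) -> trivIset setT F ->
        (fun n => \sum_(0 <= k < n) mu (F k)) @ \oo --> mu (\bigcup_n F n)].

Definition qmeasure mu (v : 'cV[C]_d.+1) : set R -> \bar R :=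
  fun A => (complex.Re (qform (mu A) v))%:E.

Definition cintegral (m : set R -> \bar R) D h : C :=
  (fine (\int[m]_(t in D) (complex.Re (h t))%:E) +i*
   fine (\int[m]_(t in D) (complex.Im (h t))%:E))%C.

(* The integral of h with respect to the complex measure mu_(k,l).  By
   polarization, mu_(k,l) is the linear combination
     1/4 * sum_(m < 4) i^m * v_m^dagger mu v_m,   v_m = e_l + i^m e_k,
   of positive measures. *)
Definition entry_integral mu D h (k l : 'I_d.+1) : C :=
  4^-1 * \sum_(m < 4) 'i ^+ m *
    cintegral (qmeasure mu (delta_mx l 0 + 'i ^+ m *: delta_mx k 0)) D h.

Definition scalar_integral mu D h : M :=
  \matrix_(k, l) entry_integral mu D h k l.

(* int_D P^dagger dmu Q, entry by entry *)
Definition matrix_integral mu D P Q : M :=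
  \matrix_(i, j) \sum_k \sum_l
    entry_integral mu D (fun t => (P t ^t*) i k * Q t l j) k l.

(* Finiteness of all moments, i.e. convergence of the integrals in the inner
   product of any two matrix polynomials. *)
Definition has_moments mu : Prop := forall (k : nat) (v : 'cV[C]_d.+1),
  (qmeasure mu v).-integrable setT (fun t : R => (t ^+ k)%:E).

(* The coefficients stand to the left of the powers of z, which are central. *)
Definition mxeval (p : {poly M}) (z : C) : M := p.[z%:M].

Definition inner mu (p q : {poly M}) : M :=
  matrix_integral mu setT (fun t => mxeval p t%:C%C) (fun t => mxeval q t%:C%C).

Definition orthonormal_polynomials mu (p : nat -> {poly M}) : Prop :=
  [/\ has_moments mu,
      forall n, size (p n) = n.+1,
      forall n, lead_coef (p n) \is a GRing.unit &
      forall n m, inner mu (p n) (p m) = (n == m)%:R].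

Definition poly_measure mu (p : {poly M}) : set R -> M := fun A =>
  matrix_integral mu A (fun t => mxeval p t%:C%C) (fun t => mxeval p t%:C%C).

End MatrixMeasures.

Section NevanlinnaFunctions.
Variables (R : realType) (d : nat).
Local Notation C := R[i].
Local Notation M := 'M[R[i]]_d.+1.
Implicit Types (f g h : C -> M) (a b : M).

(* Nevanlinna functions live on the non-real numbers: a function f : C -> M is
   only ever considered through its values there. *)
Definition nevanlinna f : Prop :=
  [/\ forall z : C, z \isn't Num.real -> derivable f z 1,
      forall z : C, z \isn't Num.real -> (f z) ^t* = f z^* &
      forall z : C, z \isn't Num.real -> psdmx (('Im z)^-1 *: mxIm (f z))].

(* The kernel does not depend on z when f is a Nevanlinna function. *)
Definition degenerate f : Prop :=
  exists2 z : C, z \isn't Num.real &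
  exists2 v : 'cV[C]_d.+1, v != 0 & mxIm (f z) *m v = 0.

Definition nevanlinna_function_of (mu : set R -> M) f : Prop :=
  nevanlinna f /\
  forall z : C, z \isn't Num.real ->
    1 - z *: f z \is a GRing.unit /\
    scalar_integral mu setT (fun t => (1 - z * t%:C%C)^-1) = (1 - z *: f z)^-1.

Definition imag (y : R) : C := (0 +i* y)%C.

(* (f(iy) - b) / (iy) *)
Definition normal_slope f b (y : R) : M := (imag y)^-1 *: (f (imag y) - b).

Definition normal_value f : M := lim (f (imag y) @[y --> 0^']).

Definition normal_derivative f : M :=
  lim (normal_slope f (normal_value f) y @[y --> 0^']).

(* Normal limits and normal derivatives of all orders exist at 0. *)
Definition normally_smooth f : Prop := forall k : nat,
  let fk := derive1n k f in
  cvg (fk (imag y) @[y --> 0^']) /\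
  cvg (normal_slope fk (normal_value fk) y @[y --> 0^']).

(* The positive definite square root of the normal derivative; it is unique. *)
Definition schur_a f : M :=
  xget 0 [set a : M | pdmx a /\ a ^+ 2 = normal_derivative f].

Definition schur_step f : C -> M := fun z =>
  let b := normal_value f in
  let a := schur_a f in
  z^-1 *: (a^-1 * (f z - b - z *: a ^+ 2) * (f z - b)^-1 * a).

Definition schur_iterate (n : nat) f : C -> M := iter n schur_step f.

(* One step of the algorithm applies to f and produces the parameters b, a. *)
Definition schur_stage f b a : Prop :=
  [/\ nevanlinna f, ~ degenerate f,
      f (imag y) @[y --> 0^'] --> b,
      normal_slope f b y @[y --> 0^'] --> a ^+ 2 &
      pdmx a].

Definition schur_parameters (b a : nat -> M) f : Prop :=
  [/\ nevanlinna f, normally_smooth f &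
      forall n, schur_stage (schur_iterate n f) (b n) (a n)].

(* The sequence is b_0, a_0, ..., b_(N-1), a_(N-1), b_N: the N-th iterate is the
   constant b_N, which is degenerate, so the algorithm stops there. *)
Definition terminating_schur_parameters (N : nat) (b a : nat -> M) f : Prop :=
  [/\ nevanlinna f, normally_smooth f,
      forall n, (n < N)%N -> schur_stage (schur_iterate n f) (b n) (a n),
      nevanlinna (schur_iterate N f) &
      forall z : C, z \isn't Num.real -> schur_iterate N f z = b N].

(* "f is the function with property S", functions being compared on the
   non-real numbers only *)
Definition is_the_function (S : (C -> M) -> Prop) f : Prop :=
  S f /\ forall h, S h -> forall z : C, z \isn't Num.real -> h z = f z.

End NevanlinnaFunctions.

Section BlockJacobi.
Variables (R : realType) (d : nat).
Local Notation C := R[i].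
Local Notation M := 'M[R[i]]_d.+1.
Local Notation cseq := (nat -> 'cV[R[i]]_d.+1).
Implicit Types (u v w : cseq) (a b : nat -> M).

Definition l2 : set cseq :=
  [set v | cvgn (series (fun k => (v k ^t* *m v k) 0 0))].

Definition l2dot u v : C := limn (series (fun k => (u k ^t* *m v k) 0 0)).

Definition jacobi b a v : cseq := fun k =>
  preceding a k *m preceding v k + b k *m v k + a k *m v k.+1.

Definition jacobi_domain b a : set cseq :=
  [set v | l2 v /\ l2 (jacobi b a v)].

(* The graph of the adjoint of an operator T with domain D in l2. *)
Definition adjoint_graph (D : set cseq) (T : cseq -> cseq) : set (cseq * cseq) :=
  [set uw | [/\ l2 uw.1, l2 uw.2 &
               forall v, D v -> l2dot uw.1 (T v) = l2dot uw.2 v]].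

(* Equality of the graphs makes the adjoint single-valued, hence it includes
   the density of D. *)
Definition self_adjoint (D : set cseq) (T : cseq -> cseq) : Prop :=
  adjoint_graph D T = [set uw | D uw.1 /\ uw.2 = T uw.1].

End BlockJacobi.

(* Main.v *)
Require Import Defs.
From HB Require Import structures.
From mathcomp Require Import all_boot all_order all_algebra.
From mathcomp Require Import complex.
From mathcomp Require Import all_classical all_reals all_analysis.
From mathcomp Require Import measurable_realfun.
From mathcomp Require Import ring lra.
Import Order.TTheory GRing.Theory Num.Theory.
Import numFieldNormedType.Exports.
Local Open Scope classical_set_scope.
Local Open Scope ring_scope.
Local Open Scope sesquilinear_scope.
Set Implicit Arguments.
Unset Strict Implicit.
Unset Printing Implicit Defensive.

(** The proof rests on two solutions of the three-term recurrence at the point 1/z: the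
    values p_n(1/z), and the functions of the second kind s_n(z), the integrals of
    dmu p_n / (1 - zt), which satisfy it for n > 0. Dividing the recurrence by s_n shows that
    the functions weyl n = b_n + s_n^-1 s_(n+1) a_n obey
      weyl (n+1) = 1/z - a_n (weyl n - b_n)^-1 a_n,
    which is the Schur step, and weyl 0 = f because s_0 is the integral of dmu / (1 - zt). So
    weyl n is the n-th iterate f_n. Dividing by p_n(1/z) shows that the g_n obey
      g_(n+1) = a_n (1/z - b_n - g_n)^-1 a_n,    g_0 = 0,
    a finite continued fraction whose Schur algorithm recovers a_(n-1), b_(n-1), ..., b_0.

    The two meet in the Green matrix G_(m,n), the integral of p_m^dagger dmu p_n / (1 - zt).
    For m <= n it equals p_m(1/conj z)^dagger s_n, and taking adjoints gives the entries with
    m >= n. The entry (n, n) of the recurrence then reads (G_(n,n) - 1) / z =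
    G_(n,n) (f_n + g_n), and G_(n,n) is the integral of 1 / (1 - zt) against mu_n: this is the
    formula to prove (green_diag_inverse).

    Invertibility and positivity come from the identity green_imag: z G - (z G)^dagger is
    z - conj z times a Gram matrix. For G_(n,n) it shows that s_n and p_n(1/z) are invertible;
    for the polynomial p_(n+1) a_n - p_n (f_n(z) - b_n), whose coefficients depend on z, the
    Gram matrix is Im f_n(z) / Im z, so that f_n is a non-degenerate Nevanlinna function. At
    z = 0 the resolvent 1 / (1 - zt) has expansions of all orders, controlled by the moments of
    mu, and s_n / z^n has an invertible limit; hence f_n is smooth up to 0, and b_n and a_n^2
    are its normal limit and derivative there.

    Integrals with respect to mu, a matrix of complex measures, are handled through
    positivity of its quadratic forms and through Riemann sums of functions that are Lipschitz
    on bounded sets and grow polynomially. These sums also identify integrals against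
    mu_n = p_n^dagger dmu p_n with integrals against mu (scalar_integral_density).

    That g_n is determined by its finitely many parameters follows by running the algorithm
    backwards from the constant last iterate. For f_n self-adjointness enters: the values at z
    of a function with given parameters, and of its iterates, linearize to a solution of the
    recurrence, which is square summable by Green's identity. Two such functions would give a
    difference of solutions that is an eigenvector for a non-real number, up to one component
    that the scalar product ignores, and a symmetric Jacobi matrix has none
    (schur_values_unique). *)

(** * Adjoints and positive matrices *)

Section Adjoint.
Variable R : realType.
Local Notation C := R[i].

Lemma adjmxM m n q (A : 'M[C]_(m, n)) (B : 'M[C]_(n, q)) :
  (A *m B) ^t* = B ^t* *m A ^t*.
Proof. by rewrite trmx_mul map_mxM. Qed.

Lemma adjmxD m n (A B : 'M[C]_(m, n)) : (A + B) ^t* = A ^t* + B ^t*.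
Proof. by rewrite linearD /= map_mxD. Qed.

Lemma adjmxN m n (A : 'M[C]_(m, n)) : (- A) ^t* = - A ^t*.
Proof. by rewrite linearN /= map_mxN. Qed.

Lemma adjmxB m n (A B : 'M[C]_(m, n)) : (A - B) ^t* = A ^t* - B ^t*.
Proof. by rewrite adjmxD adjmxN. Qed.

Lemma adjmxZ m n (c : C) (A : 'M[C]_(m, n)) : (c *: A) ^t* = c^* *: A ^t*.
Proof. by rewrite linearZ /= map_mxZ. Qed.

Lemma adjmx0 m n : (0 : 'M[C]_(m, n)) ^t* = 0.
Proof. by rewrite trmx0 map_mx0. Qed.

Lemma adjmx_scalar n (c : C) : (c%:M : 'M[C]_n) ^t* = (c^*)%:M.
Proof. by rewrite tr_scalar_mx map_scalar_mx. Qed.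

Lemma adjmx1 n : (1%:M : 'M[C]_n) ^t* = 1%:M.
Proof. by rewrite adjmx_scalar rmorph1. Qed.

Lemma adjmx_unit n (A : 'M[C]_n) : (A ^t* \in unitmx) = (A \in unitmx).
Proof. by rewrite map_unitmx unitmx_tr. Qed.

Lemma adjmxV n (A : 'M[C]_n) : (invmx A) ^t* = invmx (A ^t*).
Proof. by rewrite trmx_inv map_invmx. Qed.

Lemma adjrM n (A B : 'M[C]_n.+1) : (A * B) ^t* = B ^t* * A ^t*.
Proof. exact: adjmxM. Qed.

Lemma adjr1 n : (1 : 'M[C]_n.+1) ^t* = 1.
Proof. exact: adjmx1. Qed.

Lemma adjrV n (A : 'M[C]_n.+1) : (A^-1) ^t* = (A ^t*)^-1.
Proof. exact: adjmxV. Qed.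

Lemma adjr_unit n (A : 'M[C]_n.+1) :
  (A ^t* \is a GRing.unit) = (A \is a GRing.unit).
Proof. exact: adjmx_unit. Qed.

Lemma unitrZ n (c : C) (A : 'M[C]_n.+1) : c != 0 ->
  (c *: A \is a GRing.unit) = (A \is a GRing.unit).
Proof. by move=> c0; rewrite -[LHS]/(c *: A \in unitmx) unitmxZ ?unitfE. Qed.

Lemma invrZ_mx n (c : C) (A : 'M[C]_n.+1) : A \is a GRing.unit -> c != 0 ->
  (c *: A)^-1 = c^-1 *: A^-1.
Proof. by move=> uA c0; rewrite invrZ// unitfE. Qed.

Lemma unitr_mx_ker n (A : 'M[C]_n.+1) :
  (forall v : 'cV[C]_n.+1, A *m v = 0 -> v = 0) -> A \is a GRing.unit.
Proof.
move=> kerA; change (is_true (A \in unitmx)); rewrite -unitmx_tr -row_free_unit.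
rewrite -kermx_eq0; apply/eqP/row_matrixP => i; rewrite row0.
apply/eqP; rewrite -trmx_eq0; apply/eqP/kerA/trmx_inj.
by rewrite trmx_mul trmxK -row_mul mulmx_ker row0 trmx0.
Qed.

Definition sesqui n (A : 'M[C]_n) (u v : 'cV[C]_n) : C := (u ^t* *m A *m v) 0 0.

Lemma sesquiDl n (A : 'M[C]_n) u1 u2 v :
  sesqui A (u1 + u2) v = sesqui A u1 v + sesqui A u2 v.
Proof. by rewrite /sesqui adjmxD !mulmxDl mxE. Qed.

Lemma sesquiDr n (A : 'M[C]_n) u v1 v2 :
  sesqui A u (v1 + v2) = sesqui A u v1 + sesqui A u v2.
Proof. by rewrite /sesqui !mulmxDr mxE. Qed.

Lemma sesquiZl n (A : 'M[C]_n) c u v : sesqui A (c *: u) v = c^* * sesqui A u v.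
Proof. by rewrite /sesqui adjmxZ -!scalemxAl mxE. Qed.

Lemma sesquiZr n (A : 'M[C]_n) c u v : sesqui A u (c *: v) = c * sesqui A u v.
Proof. by rewrite /sesqui -!scalemxAr mxE. Qed.

Lemma sesqui_delta n (A : 'M[C]_n) k l :
  sesqui A (delta_mx k 0) (delta_mx l 0) = A k l.
Proof.
rewrite /sesqui trmx_delta map_delta_mx -rowE -colE !mxE//.
Qed.

Lemma qform_sesqui n (A : 'M[C]_n) v : qform A v = sesqui A v v.
Proof. by []. Qed.

Lemma conj_sesqui n (A : 'M[C]_n) u v : (sesqui A u v)^* = sesqui (A ^t*) v u.
Proof.
rewrite /sesqui.
transitivity (((u ^t* *m A *m v) ^t*) 0 0); first by rewrite !mxE.
by rewrite !adjmxM trmxCK mulmxA.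
Qed.

Lemma sesquiDm n (A B : 'M[C]_n) u v :
  sesqui (A + B) u v = sesqui A u v + sesqui B u v.
Proof. by rewrite /sesqui mulmxDr mulmxDl mxE. Qed.

Lemma sesquiNm n (A : 'M[C]_n) u v : sesqui (- A) u v = - sesqui A u v.
Proof. by rewrite /sesqui mulmxN mulNmx mxE. Qed.

Lemma sesquiZm n c (A : 'M[C]_n) u v : sesqui (c *: A) u v = c * sesqui A u v.
Proof. by rewrite /sesqui -scalemxAr -scalemxAl mxE. Qed.

Lemma sesquiE n (A : 'M[C]_n) u v :
  sesqui A u v = \sum_k \sum_l (u k 0)^* * v l 0 * A k l.
Proof.
rewrite /sesqui mxE exchange_big /=; apply: eq_bigr => l _.
rewrite mxE big_distrl /=; apply: eq_bigr => k _.
by rewrite !mxE mulrAC.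
Qed.

(** The powers of i average to 0 against every term but the mixed one. *)
Lemma polarization n (A : 'M[C]_n) u v :
  4%:R * sesqui A u v = \sum_(m < 4) 'i ^+ m * qform A (v + 'i ^+ m *: u).
Proof.
have ii : 'i * 'i = -1 :> C by rewrite -expr2 sqrCi.
have iJ m : ('i ^+ m : C) * ('i ^+ m)^* = 1.
  by rewrite -normCK normrX normCi !expr1n.
have term m : 'i ^+ m * qform A (v + 'i ^+ m *: u) =
    'i ^+ m * (sesqui A v v + sesqui A u u) + ('i ^+ m * 'i ^+ m) * sesqui A v u
    + sesqui A u v.
  rewrite qform_sesqui !(sesquiDl, sesquiDr, sesquiZl, sesquiZr).
  have := iJ m; move: ('i ^+ m) (('i ^+ m)^*) => s s' ss'.
  move: (sesqui A v v) (sesqui A v u) (sesqui A u v) (sesqui A u u) => vv vu uv uu.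
  rewrite (_ : s * _ = s * vv + s * s * vu + s * s' * uv + s * s' * s * uu); last by ring.
  by rewrite ss'; ring.
rewrite (eq_bigr _ (fun m _ => term (nat_of_ord m))) !big_ord_recl big_ord0.
rewrite !lift0 !expr0.
have -> : ('i : C) ^+ (3%N) = - 'i by rewrite 2!exprS expr1 ii mulrN1.
have -> : ('i : C) ^+ 2 = -1 by rewrite exprS expr1 ii.
rewrite expr1 !mulrNN ii.
move: (sesqui A u v) (sesqui A v u) (sesqui A v v + _) => uv vu s; ring.
Qed.

Lemma sesqui_eq0 n (A : 'M[C]_n) : (forall v, qform A v = 0) -> A = 0.
Proof.
move=> A0; apply/matrixP => k l; rewrite mxE -sesqui_delta.
apply: (mulfI (_ : 4%:R != 0 :> C)); first by rewrite pnatr_eq0.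
by rewrite polarization big1 ?mulr0// => m _; rewrite A0 mulr0.
Qed.

Lemma psdmx_herm n (A : 'M[C]_n) : psdmx A -> A ^t* = A.
Proof.
move=> psdA; apply/eqP; rewrite -subr_eq0; apply/eqP/sesqui_eq0 => v.
rewrite qform_sesqui sesquiDm sesquiNm -conj_sesqui -qform_sesqui.
by rewrite (CrealP _) ?subrr// ger0_real.
Qed.

Lemma qform0 n (A : 'M[C]_n) : qform A 0 = 0.
Proof. by rewrite /qform mulmx0 mxE. Qed.

Lemma pdmx_psd n (A : 'M[C]_n) : pdmx A -> psdmx A.
Proof.
by move=> pdA v; have [->|/pdA/ltW//] := eqVneq v 0; rewrite qform0.
Qed.

Lemma pdmx_herm n (A : 'M[C]_n) : pdmx A -> A ^t* = A.
Proof. by move=> /pdmx_psd/psdmx_herm. Qed.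

Lemma definite_unit n (A : 'M[C]_n.+1) :
  (forall v, v != 0 -> qform A v != 0) -> A \is a GRing.unit.
Proof.
move=> defA; apply: unitr_mx_ker => v Av; apply/eqP/negPn/negP => /defA.
by rewrite /qform -mulmxA Av mulmx0 mxE eqxx.
Qed.

Lemma pdmx_unit n (A : 'M[C]_n.+1) : pdmx A -> A \is a GRing.unit.
Proof. by move=> pdA; apply: definite_unit => v /pdA; rewrite lt_def => /andP[]. Qed.

(** If a positive form vanishes at v, then perturbing v in the direction of a
    vector u changes the form at first order by the pairing of u and v, which
    must therefore vanish. *)
Lemma psdmx_ker n (A : 'M[C]_n) v : psdmx A -> qform A v = 0 -> A *m v = 0.
Proof.
move=> psdA Av0.
have key u : sesqui A u v = 0.
  set x := sesqui A u v; apply/eqP/negPn/negP => x0.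
  have hA := psdmx_herm psdA.
  have vu : sesqui A v u = x^* by rewrite conj_sesqui hA.
  have x2 : 0 < x * x^* by rewrite -normCK exprn_gt0// normr_gt0.
  pose N := qform A u.
  have N0 : 0 <= N by exact: psdA.
  have h (s : C) : 0 <= s -> 0 <= s * (s * N - 2) * (x * x^*).
    move=> s0; have := psdA (v + (- s * x) *: u).
    rewrite qform_sesqui !(sesquiDl, sesquiDr, sesquiZl, sesquiZr).
    rewrite -!qform_sesqui Av0 vu -/x -/N rmorphM rmorphN /= (CrealP (ger0_real s0)).
    by congr (0 <= _); ring.
  have N1 : 0 < N + 1 by rewrite ltr_wpDl.
  have := h (N + 1)^-1; rewrite invr_ge0 (ltW N1) => /(_ isT).
  rewrite pmulr_lge0// pmulr_rge0 ?invr_gt0//.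
  rewrite -(pmulr_rge0 _ N1) mulrBr mulrA divff ?gt_eqF// mul1r.
  have -> : N - (N + 1) * 2 = - (N + 2) by ring.
  rewrite oppr_ge0 => N2; have : 0 < N + 2 by rewrite ltr_wpDl.
  by move=> /lt_le_trans/(_ N2); rewrite ltxx.
apply/colP => i; rewrite mxE.
by have := key (delta_mx i 0); rewrite /sesqui trmx_delta map_delta_mx -mulmxA -rowE !mxE.
Qed.

(** The defect x = a - b of two square roots satisfies a x + x b = 0, and the
    trace of (a x + x b) x is a sum of values of the two forms. *)
Lemma pdmx_sqrt_inj n (a b : 'M[C]_n.+1) : pdmx a -> pdmx b ->
  a ^+ 2 = b ^+ 2 -> a = b.
Proof.
move=> pa pb ab; pose x := a - b.
have hx : x ^t* = x by rewrite adjmxB !pdmx_herm.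
have sylv : a * x + x * b = 0.
  by rewrite mulrBr mulrBl -!expr2 ab addrA subrK subrr.
have tr0 : \tr (x *m a *m x + x *m b *m x) = 0.
  rewrite mxtraceD (mxtrace_mulC (x *m b)) mulmxA -mulmxA.
  rewrite -[x *m x *m b]mulmxA -mxtraceD -mulmxDr.
  by rewrite -[a *m x + _]/(a * x + x * b) sylv mulmx0 mxtrace0.
have diag (c : 'M[C]_n.+1) i : (x *m c *m x) i i = qform c (col i x).
  rewrite -sesqui_delta /sesqui /qform colE adjmxM hx.
  by rewrite !mulmxA.
have ge0 i : 0 <= (x *m a *m x + x *m b *m x) i i.
  by rewrite mxE !diag addr_ge0// pdmx_psd.
apply/eqP; rewrite -subr_eq0 -/x; apply/eqP/matrixP => k i; rewrite mxE.
have /eqP := tr0; rewrite /mxtrace psumr_eq0//.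
move=> /allP/(_ i (mem_index_enum _))/= /eqP; rewrite mxE !diag => /eqP.
rewrite paddr_eq0 ?pdmx_psd// => /andP[/eqP qa _].
have [|/pa] := eqVneq (col i x) 0; last by rewrite qa ltxx.
by move=> /colP/(_ k); rewrite !mxE.
Qed.

End Adjoint.

(** * Convergence of matrices *)

Section MatrixConvergence.
Variable R : realType.
Local Notation C := R[i].
Context {T : Type} {F : set_system T} {FF : Filter F}.

Lemma cvg_eq_near (U : topologicalType) (f g : T -> U) (l : U) :
  (\forall x \near F, f x = g x) -> f x @[x --> F] --> l -> g x @[x --> F] --> l.
Proof. by move=> fg; apply: cvg_trans; apply: near_eq_cvg; apply: filterS fg. Qed.

Lemma cvg_mxP m n (G : T -> 'M[C]_(m, n)) (L : 'M[C]_(m, n)) :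
  (forall i j, G x i j @[x --> F] --> L i j) <-> G x @[x --> F] --> L.
Proof.
split=> [GL|/cvg_ballP GL i j]; last first.
  by apply/cvg_ballP => e e0; apply: filterS (GL e e0) => x [].
apply/cvg_ballP => e e0.
have h : \forall x \near F, forall ij : 'I_m * 'I_n, ball (L ij.1 ij.2) e (G x ij.1 ij.2).
  apply: filter_forall => -[i j] /=; exact: (cvg_ballP (G ^~ i ^~ j) _).1.
apply: filterS h => x h; split; first exact: e0.
by move=> i j; exact: (h (i, j)).
Qed.

Lemma cvg_mulmx m n q (G : T -> 'M[C]_(m, n)) (H : T -> 'M[C]_(n, q))
    (L : 'M[C]_(m, n)) (K : 'M[C]_(n, q)) :
  G x @[x --> F] --> L -> H x @[x --> F] --> K ->
  (G x *m H x) @[x --> F] --> L *m K.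
Proof.
move=> /cvg_mxP GL /cvg_mxP HK; apply/cvg_mxP => i j.
rewrite mxE; under eq_fun do rewrite mxE.
apply: cvg_big => [|k _]; first exact: add_continuous.
exact: cvgM.
Qed.

Lemma cvg_mulr_mx n (G H : T -> 'M[C]_n.+1) (L K : 'M[C]_n.+1) :
  G x @[x --> F] --> L -> H x @[x --> F] --> K ->
  (G x * H x) @[x --> F] --> L * K.
Proof. exact: cvg_mulmx. Qed.

Lemma cvg_det n (G : T -> 'M[C]_n) (L : 'M[C]_n) :
  G x @[x --> F] --> L -> \det (G x) @[x --> F] --> \det L.
Proof.
move=> /cvg_mxP GL; rewrite /determinant.
apply: cvg_big => [|s _]; first exact: add_continuous.
apply: cvgM; first exact: cvg_cst.
apply: cvg_big => [|i _]; last exact: GL.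
exact: mul_continuous.
Qed.

(** By Cramer's rule the inverse is the adjugate, polynomial in the entries, divided
    by the determinant. *)
Lemma cvg_invmx n (G : T -> 'M[C]_n.+1) (L : 'M[C]_n.+1) : L \is a GRing.unit ->
  G x @[x --> F] --> L -> (G x)^-1 @[x --> F] --> L^-1.
Proof.
move=> uL GL; have dL : \det L != 0.
  by move: uL; rewrite -[X in is_true X]/(L \in unitmx) unitmxE unitfE.
have cdet := cvg_det GL.
have adjc : (\adj (G x)) @[x --> F] --> \adj L.
  apply/cvg_mxP => i j; rewrite mxE; under eq_fun do rewrite mxE.
  apply: cvgM; first exact: cvg_cst.
  apply: (@cvg_det _ (fun x => row' j (col' i (G x)))); apply/cvg_mxP => k l.
  by rewrite !mxE; under eq_fun do rewrite !mxE; move: GL => /cvg_mxP/(_ (lift j k) (lift i l)).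
have -> : L^-1 = (\det L)^-1 *: \adj L.
  by rewrite -[L^-1]/(invmx L) /invmx ifT.
apply: (cvg_eq_near _ (cvgZ (cvgV dL cdet) adjc)).
apply: filterS (cvgr_neq0 _ cdet dL) => x dx.
by rewrite -[(G x)^-1]/(invmx (G x)) /invmx ifT// unitmxE unitfE.
Qed.

End MatrixConvergence.

(** * First-order expansions along a filter *)

Section Slopes.
Variables (R : realType) (d : nat).
Local Notation C := R[i].
Local Notation M := 'M[R[i]]_d.+1.

(** The increment u x plays the role of z - z0; this covers both complex
    derivatives and normal derivatives at the boundary point 0. *)
Definition has_slope (T : Type) (F : set_system T) (u : T -> C) (G : T -> M)
    (L D : M) : Prop :=
  (u x)^-1 *: (G x - L) @[x --> F] --> D.

Context (T : Type) (F : set_system T) {FF : Filter F} (u : T -> C).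
Hypothesis u0 : u x @[x --> F] --> (0 : C).
Hypothesis u_neq0 : \forall x \near F, u x != 0.
Implicit Types (G H : T -> M) (L D : M).

Lemma has_slope_near G H L D : (\forall x \near F, G x = H x) ->
  has_slope F u G L D -> has_slope F u H L D.
Proof.
move=> GH; apply: cvg_eq_near.
by apply: filterS GH => x ->.
Qed.

Lemma has_slope_cvg G L D : has_slope F u G L D -> G x @[x --> F] --> L.
Proof.
move=> GL; rewrite -[L in _ --> L]addr0 -[in X in _ --> X](scale0r D).
apply: (@cvg_eq_near _ _ FF _ (fun x => L + u x *: ((u x)^-1 *: (G x - L)))).
  by apply: filterS u_neq0 => x ux; rewrite scalerA mulfV// scale1r addrC subrK.
by apply: cvgD; [exact: cvg_cst | exact: cvgZ].
Qed.

Lemma has_slope_cst L : has_slope F u (fun=> L) L 0.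
Proof.
by rewrite /has_slope; under eq_fun do rewrite subrr scaler0; exact: cvg_cst.
Qed.

Lemma has_slopeD G H L K D E : has_slope F u G L D -> has_slope F u H K E ->
  has_slope F u (fun x => G x + H x) (L + K) (D + E).
Proof.
move=> GL HK; apply: (cvg_eq_near _ (cvgD GL HK)); apply: nearW => x.
by rewrite -scalerDr opprD addrACA.
Qed.

Lemma has_slopeM G H L K D E : has_slope F u G L D -> has_slope F u H K E ->
  has_slope F u (fun x => G x * H x) (L * K) (D * K + L * E).
Proof.
move=> GL HK; have cH := has_slope_cvg HK.
apply: (cvg_eq_near _ (cvgD (cvg_mulr_mx GL cH) (cvg_mulr_mx (cvg_cst L) HK)));
  apply: nearW => x.
by rewrite -scalerAl -scalerAr -scalerDr mulrBl mulrBr addrA subrK.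
Qed.

Lemma has_slopeV G L D : L \is a GRing.unit ->
  (\forall x \near F, G x \is a GRing.unit) -> has_slope F u G L D ->
  has_slope F u (fun x => (G x)^-1) L^-1 (- (L^-1 * D * L^-1)).
Proof.
move=> uL uG GL; have cG : (G x)^-1 @[x --> F] --> L^-1 by apply: cvg_invmx (has_slope_cvg GL).
apply: (cvg_eq_near _ (cvgN (cvg_mulr_mx (cvg_mulr_mx cG GL) (cvg_cst L^-1)))).
apply: filterS uG => x uGx.
rewrite -scalerAr -scalerAl -scalerN; congr (_ *: _).
by rewrite mulrBr mulVr// mulrBl mul1r -mulrA mulrV// mulr1 opprB.
Qed.

Lemma has_slope_id (z : C) : has_slope F u (fun x => (z + u x)%:M) z%:M 1.
Proof.
rewrite /has_slope; apply: (@cvg_eq_near _ _ FF _ (fun=> 1 : M) _ _ _ (cvg_cst _)).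
apply: filterS u_neq0 => x ux.
by rewrite -raddfB /= addrAC subrr add0r scale_scalar_mx mulVf.
Qed.

End Slopes.

(** * Non-real points and normal approach to 0 *)

Section NonReal.
Variable R : realType.
Local Notation C := R[i].

Lemma normr_Im_le (z : C) : (`|complex.Im z|)%:C%C <= `|z|.
Proof.
have := normc_ge_Re (z * 'i%C).
rewrite ReiNIm normrN normrM; congr (_ <= _).
by rewrite (_ : `|'i%C| = 1 :> C) ?mulr1// complexiE normCi.
Qed.

Lemma nonreal_Im (z : C) : (z \isn't Num.real) = (complex.Im z != 0).
Proof. by case: z => a b; rewrite complex_real. Qed.

Lemma nonreal_neq0 (z : C) : z \isn't Num.real -> z != 0.
Proof. by apply: contraNneq => ->; rewrite real0. Qed.

Lemma nonreal_conj (z : C) : (z^* \isn't Num.real) = (z \isn't Num.real).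
Proof. by case: z => a b; rewrite !complex_real oppr_eq0. Qed.

Lemma nonreal_inv (z : C) : (z^-1 \isn't Num.real) = (z \isn't Num.real).
Proof. by rewrite realV. Qed.

Lemma nonreal_imag (y : R) : y != 0 -> imag y \isn't Num.real.
Proof. by rewrite nonreal_Im. Qed.

Lemma near_nonreal (z : C) : z \isn't Num.real ->
  \forall h \near (0 : C)^', h + z \isn't Num.real.
Proof.
move=> zr; have e0 : 0 < (`|complex.Im z|)%:C%C :> C.
  by rewrite ltcR normr_gt0 -nonreal_Im.
suff h : \forall h \near (0 : C), h + z \isn't Num.real.
  exact: nbhs_dnbhs.
apply: filterS (nbhs0_lt e0) => h hz.
rewrite nonreal_Im; apply/negP => /eqP hz0.
suff : (`|complex.Im z|)%:C%C <= `|h| by move=> /(lt_le_trans hz); rewrite ltxx.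
have : complex.Im z = - complex.Im h.
  by apply/eqP; rewrite -addr_eq0 -hz0; case: (h) (z) => ? ? [? ?] /=; rewrite addrC.
by move=> ->; rewrite normrN normr_Im_le.
Qed.

Lemma norm_imag (y : R) : `|imag y| = `|y|%:C%C.
Proof. by rewrite normc_def /= expr0n add0r sqrtr_sqr. Qed.

Lemma cvg_imag : imag y @[y --> (0 : R)^'] --> (0 : C).
Proof.
apply/cvgr0Pnorm_lt => e e0.
have [e' ee'] : exists e', e = e'%:C%C by apply/complex_realP/gtr0_real.
subst e; move: e0; rewrite ltcR => e0.
apply: nbhs_dnbhs; apply: filterS (nbhs0_lt e0) => y.
by rewrite norm_imag ltcR.
Qed.

Lemma near_imag_nonreal : \forall y \near (0 : R)^', imag y \isn't Num.real.
Proof.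
by apply: filterS (nbhs_dnbhs_neq (0 : R)) => y; exact: nonreal_imag.
Qed.

Lemma near_imag_neq0 : \forall y \near (0 : R)^', imag y != 0.
Proof. by apply: filterS near_imag_nonreal => y; exact: nonreal_neq0. Qed.

End NonReal.
#[export] Hint Resolve near_imag_neq0 cvg_imag : core.

(** * Functions with normal derivatives of all orders *)

Section NormalSmoothness.
Variables (R : realType) (d : nat).
Local Notation C := R[i].
Local Notation M := 'M[R[i]]_d.+1.
Implicit Types (f g : C -> M) (L K D E : M).

Definition derivative_off_real f f' : Prop := forall z, z \isn't Num.real ->
  has_slope (0 : C)^' id (fun h => f (h + z)) (f z) (f' z).

Definition normal_expansion f L D : Prop :=
  has_slope (0 : R)^' (@imag R) (fun y => f (imag y)) L D.

(** The derivative f' is any function that agrees with the complex derivative off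
    the real line. Since nothing is asked on the line itself, the class is closed
    under sums, products and inverses, by induction on k. *)
Fixpoint smooth_upto k f : Prop :=
  (exists L D, normal_expansion f L D) /\
  (exists f', derivative_off_real f f' /\ if k is j.+1 then smooth_upto j f' else True).

Lemma cvg_dnbhs_id : id h @[h --> (0 : C)^'] --> (0 : C).
Proof. exact: nbhs_dnbhs. Qed.

Lemma near_dnbhs_id : \forall h \near (0 : C)^', id h != 0.
Proof. exact: nbhs_dnbhs_neq. Qed.

Lemma derivative_off_real_eq f g f' : {in [pred z : C | z \isn't Num.real], f =1 g} ->
  derivative_off_real f f' -> derivative_off_real g f'.
Proof.
move=> fg df z zr; rewrite -fg//; apply: has_slope_near (df z zr).
by apply: filterS (near_nonreal zr) => h; exact: fg.
Qed.

Lemma normal_expansion_eq f g L D : {in [pred z : C | z \isn't Num.real], f =1 g} ->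
  normal_expansion f L D -> normal_expansion g L D.
Proof.
move=> fg; apply: has_slope_near; apply: filterS (near_imag_nonreal R) => y; exact: fg.
Qed.

Lemma smooth_upto_eq k f g : {in [pred z : C | z \isn't Num.real], f =1 g} ->
  smooth_upto k f -> smooth_upto k g.
Proof.
move=> fg; case: k => [|k] [[L [D e]] [f' [df sf]]]; split.
- by exists L, D; apply: normal_expansion_eq e.
- by exists f'; split; [exact: derivative_off_real_eq df|].
- by exists L, D; apply: normal_expansion_eq e.
- by exists f'; split; [exact: derivative_off_real_eq df|].
Qed.

Lemma smooth_uptoW k f : smooth_upto k.+1 f -> smooth_upto k f.
Proof.
elim: k f => [|k IH] f [e [f' [df sf]]]; split=> //; exists f'; split=> //.
exact: IH.
Qed.

Lemma smooth_upto_cst k L : smooth_upto k (fun=> L).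
Proof.
elim: k L => [|k IH] L; (split; first by exists L, 0; exact: has_slope_cst);
  by exists (fun=> 0); split=> // z zr; exact: has_slope_cst.
Qed.

Lemma smooth_upto_id k : smooth_upto k (fun z => z%:M).
Proof.
have e : exists L D, normal_expansion (fun z : C => z%:M) L D.
  exists 0%:M, 1; apply: has_slope_near (has_slope_id (near_imag_neq0 R) 0).
  by apply: nearW => y; rewrite add0r.
have de : derivative_off_real (fun z => z%:M) (fun=> 1).
  move=> z zr; apply: has_slope_near (has_slope_id near_dnbhs_id z).
  by apply: nearW => y; rewrite addrC.
by case: k => [|k]; split=> //; exists (fun=> 1); split=> //; exact: smooth_upto_cst.
Qed.

Lemma derivative_off_realD f g f' g' :
  derivative_off_real f f' -> derivative_off_real g g' ->
  derivative_off_real (fun z => f z + g z) (fun z => f' z + g' z).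
Proof. by move=> df dg z zr; apply: has_slopeD (df z zr) (dg z zr). Qed.

Lemma normal_expansionM f g L K D E : normal_expansion f L D ->
  normal_expansion g K E ->
  normal_expansion (fun z => f z * g z) (L * K) (D * K + L * E).
Proof.
move=> e e2; exact: (has_slopeM (@cvg_imag R) (near_imag_neq0 R) e e2).
Qed.

Lemma derivative_off_realM f g f' g' :
  derivative_off_real f f' -> derivative_off_real g g' ->
  derivative_off_real (fun z => f z * g z) (fun z => f' z * g z + f z * g' z).
Proof.
move=> df dg z zr.
exact: (has_slopeM cvg_dnbhs_id near_dnbhs_id (df z zr) (dg z zr)).
Qed.

Lemma derivative_off_realV f f' :
  (forall z, z \isn't Num.real -> f z \is a GRing.unit) ->
  derivative_off_real f f' ->
  derivative_off_real (fun z => (f z)^-1) (fun z => - ((f z)^-1 * f' z * (f z)^-1)).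
Proof.
move=> uf df z zr; apply: (has_slopeV cvg_dnbhs_id near_dnbhs_id _ _ (df z zr)).
  exact: uf.
by apply: filterS (near_nonreal zr) => h; exact: uf.
Qed.

Lemma smooth_uptoD k f g : smooth_upto k f -> smooth_upto k g ->
  smooth_upto k (fun z => f z + g z).
Proof.
elim: k f g => [|k IH] f g [[L [D e]] [f' [df sf]]] [[K [E e2]] [g' [dg sg]]].
all: split; first by exists (L + K), (D + E); exact: (has_slopeD e e2).
all: exists (fun z => f' z + g' z); split; first exact: derivative_off_realD df dg.
  by [].
exact: IH.
Qed.

Lemma smooth_uptoM k f g : smooth_upto k f -> smooth_upto k g ->
  smooth_upto k (fun z => f z * g z).
Proof.
elim: k f g => [|k IH] f g sf sg; move: (sf) (sg);
  move=> [[L [D e]] [f' [df sf']]] [[K [E e2]] [g' [dg sg']]].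
all: split; first by exists (L * K), (D * K + L * E);
  exact: normal_expansionM e e2.
all: exists (fun z => f' z * g z + f z * g' z); split; first exact: derivative_off_realM df dg.
  by [].
by apply: smooth_uptoD; apply: IH; [|exact: smooth_uptoW|exact: smooth_uptoW|].
Qed.

Lemma smooth_uptoN k f : smooth_upto k f -> smooth_upto k (fun z => - f z).
Proof.
move=> sf; apply: (@smooth_upto_eq _ (fun z => -1 * f z)).
  by move=> z _; rewrite mulN1r.
by apply: smooth_uptoM => //; exact: smooth_upto_cst.
Qed.

(** Invertibility off the real line says nothing about the limit at 0, hence the
    separate hypothesis on L. *)
Lemma smooth_uptoV k f L : L \is a GRing.unit ->
  f (imag y) @[y --> (0 : R)^'] --> L ->
  (forall z, z \isn't Num.real -> f z \is a GRing.unit) ->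
  smooth_upto k f -> smooth_upto k (fun z => (f z)^-1).
Proof.
move=> uL fL uf.
have eV K D : normal_expansion f K D ->
    normal_expansion (fun z => (f z)^-1) K^-1 (- (K^-1 * D * K^-1)).
  move=> e; have fK : f (imag y) @[y --> (0 : R)^'] --> K.
    exact: (has_slope_cvg (@cvg_imag R) (near_imag_neq0 R) e).
  have KL : K = L.
    by rewrite -(cvg_lim (@norm_hausdorff _ _) fK) (cvg_lim (@norm_hausdorff _ _) fL).
  apply: (has_slopeV (@cvg_imag R) (near_imag_neq0 R) _ _ e); first by rewrite KL.
  by apply: filterS (near_imag_nonreal R) => y; exact: uf.
elim: k => [|k IH] sf; move: (sf); move=> [[K [D e]] [f' [df sf']]].
all: split; first by eexists; eexists; exact: eV e.
all: exists (fun z => - ((f z)^-1 * f' z * (f z)^-1));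
  split; first exact: derivative_off_realV uf df.
  by [].
have IHk := IH (smooth_uptoW sf).
apply: smooth_uptoN; apply: smooth_uptoM; last exact: IHk.
by apply: smooth_uptoM; first exact: IHk.
Qed.

Lemma derivative_off_real_derivable f f' z : z \isn't Num.real ->
  derivative_off_real f f' -> derivable f z 1.
Proof.
move=> zr df; apply/cvg_ex; exists (f' z).
by apply: (cvg_eq_near _ (df z zr)); apply: nearW => h; rewrite /= /GRing.scale/= mulr1.
Qed.

Lemma derivative_off_real_derive1 f f' z : z \isn't Num.real ->
  derivative_off_real f f' -> derive1 f z = f' z.
Proof. by move=> zr df; apply: cvg_lim (df z zr); exact: norm_hausdorff. Qed.

Lemma normal_expansion_value f L D : normal_expansion f L D ->
  f (imag y) @[y --> (0 : R)^'] --> L.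
Proof. by move=> e; exact: (has_slope_cvg (@cvg_imag R) (near_imag_neq0 R) e). Qed.

Lemma normal_valueE f L : f (imag y) @[y --> (0 : R)^'] --> L -> normal_value f = L.
Proof. by move=> fL; apply: cvg_lim fL; exact: norm_hausdorff. Qed.

Lemma normal_derivativeE f L D : f (imag y) @[y --> (0 : R)^'] --> L ->
  normal_slope f L y @[y --> 0^'] --> D -> normal_derivative f = D.
Proof.
move=> fL fD; rewrite /normal_derivative (normal_valueE fL).
by apply: cvg_lim fD; exact: norm_hausdorff.
Qed.

Lemma smooth_upto_normally_smooth f : (forall k, smooth_upto k f) -> normally_smooth f.
Proof.
move=> sf k.
have : smooth_upto 0 (derive1n k f).
  have : smooth_upto (0 + k) f by [].
  elim: k f {sf} => [//|k IH] f.
  rewrite addnS derive1Sn => -[_ [f' [df sf']]]; apply: IH.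
  by apply: smooth_upto_eq sf' => z zr; rewrite (derivative_off_real_derive1 _ df).
move=> [[L [D e]] _] /=; have v := normal_expansion_value e.
split; first by apply/cvg_ex; exists L.
have vE : normal_value (derive1n k f) = L by exact: normal_valueE v.
by apply/cvg_ex; exists D; rewrite vE; exact: e.
Qed.

End NormalSmoothness.

(** * Integrals of complex functions *)

Section ComplexIntegral.
Import HBNNSimple.
Variable R : realType.
Local Notation C := R[i].
Implicit Types (D A : set R) (g h : R -> C).

Lemma normc_le_ReIm (z : C) :
  `|z| <= (`|complex.Re z| + `|complex.Im z|)%:C%C.
Proof.
rewrite {1}[z]complexE (le_trans (ler_normD _ _))// normrM complexiE normCi mul1r.
by rewrite !normc_def /= !expr0n !addr0 !sqrtr_sqr rmorphD.
Qed.

(** Integrals are built from simple functions, whose level sets are measurable. This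
    replaces qmeasure, whose values off the Borel sets are arbitrary, by a measure. *)
Lemma eq_integral_measurable (m1 m2 : set R -> \bar R) D (f : R -> \bar R) :
  (forall A, measurable A -> m1 A = m2 A) ->
  (\int[m1]_(t in D) f t = \int[m2]_(t in D) f t)%E.
Proof.
move=> m12.
have e (k1 k2 : set R -> \bar R) (g : R -> \bar R) :
    (forall A, measurable A -> k1 A = k2 A) ->
    [set sintegral k1 h | h in [set h : {nnsfun R >-> R} | forall x, ((h x)%:E <= g x)%E]] `<=`
    [set sintegral k2 h | h in [set h : {nnsfun R >-> R} | forall x, ((h x)%:E <= g x)%E]].
  move=> k12 _ [h hg <-]; exists h => //; apply: eq_fsbigr => r _.
  by rewrite k12//; exact: measurable_funPTI.
rewrite /integral; congr (ereal_sup _ - ereal_sup _)%E;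
  by rewrite eqEsubset; split; apply: e => // A mA; rewrite m12.
Qed.

Variable m : {measure set R -> \bar R}.

Definition cintegrable D h : Prop :=
  m.-integrable D (EFin \o (fun t => complex.Re (h t))) /\
  m.-integrable D (EFin \o (fun t => complex.Im (h t))).

Lemma cintegralE D h : cintegral m D h =
  (\int[m]_(t in D) complex.Re (h t) +i* \int[m]_(t in D) complex.Im (h t))%C.
Proof. by []. Qed.

Variable D : set R.
Hypothesis mD : measurable D.

Lemma eq_cintegral g h : {in D, g =1 h} -> cintegral m D g = cintegral m D h.
Proof.
by move=> gh; rewrite !cintegralE; congr (_ +i* _)%C; apply: eq_Rintegral => t tD; rewrite gh.
Qed.

Lemma cintegrableD g h : cintegrable D g -> cintegrable D h ->
  cintegrable D (fun t => g t + h t).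
Proof.
move=> [g1 g2] [h1 h2]; split.
  apply: eq_integrable (integrableD mD g1 h1) => //= t _.
  by case: (g t) (h t) => [? ?] [? ?].
apply: eq_integrable (integrableD mD g2 h2) => //= t _.
by case: (g t) (h t) => [? ?] [? ?].
Qed.

Lemma cintegralD g h : cintegrable D g -> cintegrable D h ->
  cintegral m D (fun t => g t + h t) = cintegral m D g + cintegral m D h.
Proof.
move=> [g1 g2] [h1 h2]; rewrite !cintegralE.
apply/eqP; rewrite eq_complex /=; apply/andP; split; apply/eqP.
  by rewrite -RintegralD//; apply: eq_Rintegral => t _; case: (g t) (h t) => [? ?] [? ?].
by rewrite -RintegralD//; apply: eq_Rintegral => t _; case: (g t) (h t) => [? ?] [? ?].
Qed.

Lemma cintegrableZ (c : C) h : cintegrable D h -> cintegrable D (fun t => c * h t).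
Proof.
move=> [h1 h2]; split.
  have := integrableB mD (integrableZl mD (complex.Re c) h1) (integrableZl mD (complex.Im c) h2).
  by apply: eq_integrable => //= t _; case: (c) (h t) => [? ?] [? ?].
have := integrableD mD (integrableZl mD (complex.Re c) h2) (integrableZl mD (complex.Im c) h1).
by apply: eq_integrable => //= t _; case: (c) (h t) => [? ?] [? ?].
Qed.

Lemma cintegralZ (c : C) h : cintegrable D h ->
  cintegral m D (fun t => c * h t) = c * cintegral m D h.
Proof.
move=> [h1 h2]; rewrite !cintegralE; case: c => a b.
apply/eqP; rewrite eq_complex /=; apply/andP; split; apply/eqP.
  rewrite -!RintegralZl// -RintegralB//;
    [|exact: (integrableZl mD a h1)|exact: (integrableZl mD b h2)].
  by apply: eq_Rintegral => t _; case: (h t) => ? ?.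
rewrite -!RintegralZl// -RintegralD//;
  [|exact: (integrableZl mD a h2)|exact: (integrableZl mD b h1)].
by apply: eq_Rintegral => t _; case: (h t) => ? ?.
Qed.

Lemma cintegral_conj h : cintegrable D h ->
  cintegral m D (fun t => (h t)^*) = (cintegral m D h)^*.
Proof.
move=> [h1 h2]; rewrite !cintegralE.
apply/eqP; rewrite eq_complex /=; apply/andP; split; apply/eqP.
  by apply: eq_Rintegral => t _; case: (h t).
rewrite -mulN1r -RintegralZl//.
by apply: eq_Rintegral => t _; rewrite mulN1r; case: (h t).
Qed.

Lemma norm_cintegral_le h (g : R -> R) : cintegrable D h ->
  m.-integrable D (EFin \o g) -> (forall t, D t -> `|h t| <= (g t)%:C%C) ->
  `|cintegral m D h| <= (2 * \int[m]_(t in D) g t)%:C%C.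
Proof.
move=> [h1 h2] ig hg; rewrite (le_trans (normc_le_ReIm _))// lecR cintegralE /=.
rewrite mulr_natl mulr2n; apply: lerD.
  apply: le_trans (le_normr_Rintegral mD h1) _; apply: le_Rintegral => //.
    exact: (integrable_norm h1).
  by move=> t Dt /=; rewrite -lecR (le_trans (normc_ge_Re _))// hg.
apply: le_trans (le_normr_Rintegral mD h2) _; apply: le_Rintegral => //.
  exact: (integrable_norm h2).
by move=> t Dt /=; rewrite -lecR (le_trans (normr_Im_le _))// hg.
Qed.

Lemma cintegrable_le h (g : R -> R) :
  measurable_fun setT (fun t => complex.Re (h t)) -> measurable_fun setT (fun t => complex.Im (h t)) ->
  m.-integrable D (EFin \o g) -> (forall t, D t -> `|h t| <= (g t)%:C%C) ->
  cintegrable D h.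
Proof.
move=> m1 m2 ig hg; split; apply: (le_integrable mD _ _ ig).
- by apply/measurable_EFinP; exact: measurable_funS m1.
- move=> t Dt /=; rewrite lee_fin (le_trans _ (ler_norm _))// -lecR.
  by rewrite (le_trans (normc_ge_Re _))// hg.
- by apply/measurable_EFinP; exact: measurable_funS m2.
- move=> t Dt /=; rewrite lee_fin (le_trans _ (ler_norm _))// -lecR.
  by rewrite (le_trans (normr_Im_le _))// hg.
Qed.

Lemma cintegral_indic A (c : C) : measurable A -> (m setT < +oo)%E ->
  cintegrable D (fun t => c * (\1_A t)%:C%C) /\
  cintegral m D (fun t => c * (\1_A t)%:C%C) = c * (fine (m (A `&` D)))%:C%C.
Proof.
move=> mA mfin.
have i1 : cintegrable D (fun t => (\1_A t)%:C%C).
  split; last first.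
    apply: (eq_integrable mD (cst 0%E)) => //; exact: integrable0.
  apply/integrableP; split; first exact/measurable_EFinP/measurable_indic.
  rewrite (eq_integral (fun t => (\1_A t)%:E)); last first.
    by move=> t _ /=; rewrite ger0_norm.
  rewrite integral_indic// (le_lt_trans _ mfin)// le_measure ?inE//.
  exact: measurableI.
split; first exact: cintegrableZ.
rewrite cintegralZ// cintegralE /=; congr (_ * _).
rewrite /Rintegral integral_indic//; congr (_ +i* _)%C.
by rewrite integral0.
Qed.

End ComplexIntegral.

(** * Entries of a matrix measure *)

Section QformLimits.
Variables (R : realType) (n : nat).
Local Notation C := R[i].

Lemma cvg_Re (T : Type) (F : set_system T) {FF : Filter F} (x : T -> C) (l : C) :
  x t @[t --> F] --> l -> complex.Re (x t) @[t --> F] --> complex.Re l.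
Proof.
move=> xl; apply/cvgrPdist_lt => e e0.
have e0' : 0 < e%:C%C :> C by rewrite ltcR.
move/cvgrPdist_lt: xl => /(_ _ e0'); apply: filterS => t xt.
rewrite -ltcR (le_lt_trans _ xt)//.
by have := normc_ge_Re (l - x t); case: (l) (x t) => [? ?] [? ?].
Qed.

Lemma cvg_qform (T : Type) (F : set_system T) {FF : Filter F} (A : T -> 'M[C]_n)
    (L : 'M[C]_n) v :
  A t @[t --> F] --> L -> qform (A t) v @[t --> F] --> qform L v.
Proof.
move=> AL; apply: (cvg_mxP (fun t => v ^t* *m A t *m v) _).2.
by apply: cvg_mulmx; [apply: cvg_mulmx => //; exact: cvg_cst|exact: cvg_cst].
Qed.

Lemma qform_sum (I : Type) (r : seq I) (P : pred I) (A : I -> 'M[C]_n) v :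
  qform (\sum_(i <- r | P i) A i) v = \sum_(i <- r | P i) qform (A i) v.
Proof. by rewrite /qform mulmx_sumr mulmx_suml summxE. Qed.

End QformLimits.

Section EntryIntegral.
Variables (R : realType) (d : nat) (mu : set R -> 'M[R[i]]_d.+1).
Hypothesis Hmu : matrix_measure mu.
Local Notation C := R[i].
Local Notation M := 'M[R[i]]_d.+1.
Implicit Types (D A : set R) (h g : R -> C) (v : 'cV[C]_d.+1).

(** The values of mu off the Borel sets are arbitrary, hence the truncation. *)
Definition qmeasure_borel v : set R -> \bar R :=
  fun A => if `[< measurable A >] then qmeasure mu v A else 0%E.

Lemma qmeasure_borelE v A : measurable A ->
  qmeasure_borel v A = (complex.Re (qform (mu A) v))%:E.
Proof. by move=> mA; rewrite /qmeasure_borel asboolT. Qed.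

Lemma qmeasure_borel0 v : qmeasure_borel v set0 = 0%E.
Proof.
rewrite qmeasure_borelE//; have [-> _ _] := Hmu.
by rewrite /qform mulmx0 mul0mx mxE.
Qed.

Lemma qmeasure_borel_ge0 v A : (0 <= qmeasure_borel v A)%E.
Proof.
rewrite /qmeasure_borel; case: asboolP => // mA; rewrite /qmeasure lee_fin.
by have [_ + _] := Hmu => /(_ A mA v); rewrite lecE => /andP[].
Qed.

Lemma qmeasure_borel_sigma_additive v : semi_sigma_additive (qmeasure_borel v).
Proof.
move=> F mF tF mUF; rewrite qmeasure_borelE//.
rewrite (_ : (fun _ => _) = fun n =>
    (complex.Re (qform (\sum_(0 <= i < n) mu (F i)) v))%:E); last first.
  apply/funext => n; rewrite qform_sum raddf_sum/= -sumEFin.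
  by apply: eq_bigr => i _; rewrite qmeasure_borelE.
have [_ _ /(_ F mF tF) cF] := Hmu.
apply: cvg_EFin; first exact: nearW.
exact: (@cvg_Re _ _ _ eventually_filter _ _ (@cvg_qform _ _ _ _ eventually_filter _ _ v cF)).
Qed.

Lemma form_measure_exists v : {m : {measure set R -> \bar R} |
  forall A, measurable A -> m A = (complex.Re (qform (mu A) v))%:E}.
Proof.
pose m : {measure set R -> \bar R} := HB.pack (qmeasure_borel v)
  (isMeasure.Build _ _ _ (qmeasure_borel v) (qmeasure_borel0 v)
    (qmeasure_borel_ge0 v) (@qmeasure_borel_sigma_additive v)).
by exists m => A mA; exact: qmeasure_borelE.
Qed.

Definition form_measure v : {measure set R -> \bar R} := sval (form_measure_exists v).

Lemma form_measureE v A : measurable A ->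
  form_measure v A = (complex.Re (qform (mu A) v))%:E.
Proof. exact: (svalP (form_measure_exists v)). Qed.

Lemma form_measure_fin v : (form_measure v setT < +oo)%E.
Proof. by rewrite form_measureE// ltry. Qed.

Lemma integral_qmeasure v D (f : R -> \bar R) :
  (\int[qmeasure mu v]_(t in D) f t = \int[form_measure v]_(t in D) f t)%E.
Proof. by apply: eq_integral_measurable => A mA; rewrite form_measureE. Qed.

Lemma cintegral_qmeasure v D h :
  cintegral (qmeasure mu v) D h = cintegral (form_measure v) D h.
Proof. by rewrite /cintegral !integral_qmeasure. Qed.

Definition mintegrable D h := forall v, cintegrable (form_measure v) D h.

Local Notation polar k l m := (delta_mx l 0 + 'i ^+ m *: delta_mx k 0 : 'cV[C]_d.+1).

Lemma entry_integralE D h k l : entry_integral mu D h k l =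
  4^-1 * \sum_(m < 4) 'i ^+ m * cintegral (form_measure (polar k l m)) D h.
Proof.
by rewrite /entry_integral; congr (_ * _); apply: eq_bigr => m _; rewrite cintegral_qmeasure.
Qed.

Lemma eq_entry_integral D g h k l : {in D, g =1 h} ->
  entry_integral mu D g k l = entry_integral mu D h k l.
Proof.
move=> gh; rewrite !entry_integralE; congr (_ * _); apply: eq_bigr => m _.
by rewrite (eq_cintegral _ gh).
Qed.

Variable D : set R.
Hypothesis mD : measurable D.

Lemma mintegrableD g h : mintegrable D g -> mintegrable D h ->
  mintegrable D (fun t => g t + h t).
Proof. by move=> ig ih v; exact: cintegrableD. Qed.

Lemma mintegrableZ (c : C) h : mintegrable D h -> mintegrable D (fun t => c * h t).
Proof. by move=> ih v; exact: cintegrableZ. Qed.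

Lemma entry_integralD g h k l : mintegrable D g -> mintegrable D h ->
  entry_integral mu D (fun t => g t + h t) k l =
  entry_integral mu D g k l + entry_integral mu D h k l.
Proof.
move=> ig ih; rewrite !entry_integralE -mulrDr -big_split/=; congr (_ * _).
by apply: eq_bigr => m _; rewrite cintegralD// mulrDr.
Qed.

Lemma entry_integralZ (c : C) h k l : mintegrable D h ->
  entry_integral mu D (fun t => c * h t) k l = c * entry_integral mu D h k l.
Proof.
move=> ih; rewrite !entry_integralE mulrCA; congr (_ * _).
rewrite big_distrr/=; apply: eq_bigr => m _.
by rewrite cintegralZ// mulrCA.
Qed.

Lemma cintegral_form_measureZ (c : C) v h : c^* * c = 1 ->
  cintegral (form_measure (c *: v)) D h = cintegral (form_measure v) D h.
Proof.
move=> c1; rewrite /cintegral; congr (fine _ +i* fine _)%C;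
  apply: eq_integral_measurable => A mA; rewrite !form_measureE//;
  by rewrite !qform_sesqui sesquiZl sesquiZr mulrA c1 mul1r.
Qed.

(** Conjugation permutes the four polarization vectors up to phases. *)
Lemma entry_integral_conj h k l : mintegrable D h ->
  entry_integral mu D (fun t => (h t)^*) l k = (entry_integral mu D h k l)^*.
Proof.
move=> ih; rewrite !entry_integralE rmorphM/= fmorphV/= conjC_nat; congr (_ * _).
rewrite rmorph_sum/= (reindex_inj (@oppr_inj 'Z_4)); apply: eq_bigr => m _.
have sJ : 'i ^+ (- (m : 'Z_4)) = ('i ^+ m)^* :> C.
  have i4 : 'i ^+ 4 = 1 :> C by rewrite (exprM _ 2 2) sqrCi sqrrN expr1n.
  have sm : ('i ^+ m : C) * ('i ^+ m)^* = 1 by rewrite -normCK normrX normCi !expr1n.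
  apply: (mulfI (_ : 'i ^+ m != 0 :> C)).
    by apply/negP => /eqP i0; move/eqP: sm; rewrite i0 mul0r eq_sym oner_eq0.
  by rewrite sm -exprD; case: m {sm} => -[|[|[|[|//]]]] i //=; rewrite ?expr0 ?i4.
rewrite sJ.
rewrite [RHS]rmorphM.
congr (_ * _).
transitivity (cintegral (form_measure (polar k l m)) D (fun t => (h t)^*)); last first.
  exact: cintegral_conj.
have -> : delta_mx k 0 + ('i ^+ m)^* *: delta_mx l 0 =
    ('i ^+ m)^* *: (delta_mx l 0 + 'i ^+ m *: delta_mx k 0) :> 'cV[C]_d.+1.
  by rewrite scalerDr scalerA -normCKC normrX normCi !expr1n scale1r addrC.
by rewrite cintegral_form_measureZ// conjCK -normCK normrX normCi !expr1n.
Qed.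

(** A substitute for integration against the total variation of mu_(k,l). *)
Definition mass (g : R -> R) k l : R :=
  \sum_(m < 4) \int[form_measure (polar k l m)]_(t in D) g t.

Lemma norm_entry_integral_le h (g : R -> R) k l : mintegrable D h ->
  (forall v, (form_measure v).-integrable D (EFin \o g)) ->
  (forall t, D t -> `|h t| <= (g t)%:C%C) ->
  `|entry_integral mu D h k l| <= (mass g k l)%:C%C.
Proof.
move=> ih ig hg; rewrite entry_integralE normrM.
have -> : `|4^-1| = 4^-1 :> C by rewrite ger0_norm.
rewrite ler_pdivrMl// (le_trans (ler_norm_sum _ _ _))//.
rewrite (rmorph_sum (real_complex R))/= big_distrr/=; apply: ler_sum => m _.
rewrite normrM normrX normCi expr1n mul1r.
apply: le_trans (norm_cintegral_le mD (ih _) (ig _) hg) _.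
have i0 : 0 <= \int[form_measure (polar k l m)]_(t in D) g t.
  by apply: Rintegral_ge0 => t Dt; rewrite -ler0c (le_trans _ (hg t Dt)).
by rewrite rmorphM/= ler_wpM2r ?ler0c// rmorph_nat ler_nat.
Qed.

(** Polarization recovers the entries of mu from the four positive measures. *)
Lemma entry_integral_indic A (c : C) k l : measurable A ->
  mintegrable D (fun t => c * (\1_A t)%:C%C) /\
  entry_integral mu D (fun t => c * (\1_A t)%:C%C) k l = c * mu (A `&` D) k l.
Proof.
move=> mA; have ci v := cintegral_indic mD c mA (form_measure_fin v).
split; first by move=> v; have [] := ci v.
rewrite entry_integralE; under eq_bigr do rewrite (ci _).2.
have psd : psdmx (mu (A `&` D)) by have [_ + _] := Hmu; apply; exact: measurableI.
rewrite -(sesqui_delta (mu _)) -[RHS](mulKf (_ : 4%:R != 0 :> C)); last first.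
  by rewrite pnatr_eq0.
congr (_ * _); rewrite mulrCA polarization big_distrr/=; apply: eq_bigr => m _.
rewrite mulrCA; congr (_ * (_ * _)).
rewrite form_measureE /=; last exact: measurableI.
by rewrite RRe_real// ger0_real.
Qed.

Lemma mintegrable_sum (I : Type) (r : seq I) (P : pred I) (h : I -> R -> C) :
  (forall i, P i -> mintegrable D (h i)) ->
  mintegrable D (fun t => \sum_(i <- r | P i) h i t).
Proof.
move=> ih; elim: r => [|i r IH].
  have -> : (fun t => \sum_(i <- [::] | P i) h i t) = fun t : R => 0 * (\1_set0 t)%:C%C.
    by apply/funext => t; rewrite big_nil mul0r.
  by have [] := entry_integral_indic 0 ord0 ord0 measurable0.
have [Pi|nPi] := boolP (P i); last by under eq_fun do rewrite big_cons (negbTE nPi).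
by under eq_fun do rewrite big_cons Pi; exact: mintegrableD (ih _ Pi) IH.
Qed.

Lemma entry_integral_sum (I : Type) (r : seq I) (P : pred I) (h : I -> R -> C) k l :
  (forall i, P i -> mintegrable D (h i)) ->
  entry_integral mu D (fun t => \sum_(i <- r | P i) h i t) k l =
  \sum_(i <- r | P i) entry_integral mu D (h i) k l.
Proof.
move=> ih; elim: r => [|i r IH].
  have -> : (fun t => \sum_(i <- [::] | P i) h i t) = fun t : R => 0 * (\1_set0 t)%:C%C.
    by apply/funext => t; rewrite big_nil mul0r.
  by rewrite (entry_integral_indic _ _ _ measurable0).2 mul0r big_nil.
rewrite big_cons; have [Pi|nPi] := boolP (P i); last first.
  by under eq_fun do rewrite big_cons (negbTE nPi).
under eq_fun do rewrite big_cons Pi.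
by rewrite entry_integralD ?IH//; [exact: ih|exact: mintegrable_sum].
Qed.

End EntryIntegral.

(** * Locally Lipschitz functions of polynomial growth *)

Section Tame.
Variable R : realType.
Local Notation C := R[i].
Implicit Types (h g : R -> C) (s t : R).

Definition weight (N : nat) t : R := (1 + t ^+ 2) ^+ N.

Lemma weight_ge1 N t : 1 <= weight N t.
Proof. by rewrite exprn_ege1// lerDl sqr_ge0. Qed.

Lemma weight_ge0 N t : 0 <= weight N t.
Proof. exact: le_trans (weight_ge1 N t). Qed.

Lemma weight_le M N t : (M <= N)%N -> weight M t <= weight N t.
Proof. by move=> MN; rewrite ler_weXn2l// lerDl sqr_ge0. Qed.

Lemma weightD M N t : weight M t * weight N t = weight (M + N) t.
Proof. by rewrite /weight exprD. Qed.

Definition growth (K : R) (N : nat) h : Prop :=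
  forall t, `|h t| <= (K * weight N t)%:C%C.

(** Tame functions form an algebra that contains polynomials and resolvents; the
    growth bound makes them integrable against a measure with moments, and the
    Lipschitz bound makes their Riemann sums converge. *)
Definition tame h : Prop := exists K N, [/\ 0 <= K, growth K N h &
  forall s t, `|t - s| <= 1 -> `|h t - h s| <= (K * `|t - s| * weight N t)%:C%C].

Lemma growth_le K K' N N' h : 0 <= K -> K <= K' -> (N <= N')%N ->
  growth K N h -> growth K' N' h.
Proof.
move=> K0 KK NN hK t; rewrite (le_trans (hK t))// lecR.
by apply: ler_pM => //; [exact: weight_ge0|exact: weight_le].
Qed.

Lemma tame_cst (c : C) : tame (fun=> c).
Proof.
exists (complex.Re `|c|), 0%N; split.
- by rewrite -ler0c RRe_real ?normr_real.
- by move=> t; rewrite /weight expr0 mulr1 RRe_real ?normr_real.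
- move=> s t _; rewrite subrr normr0 ler0c !mulr_ge0 ?weight_ge0//.
  by rewrite -ler0c RRe_real ?normr_real.
Qed.

Lemma norm_realC (x : R) : `|x%:C%C| = `|x|%:C%C :> C.
Proof. by rewrite normc_def /= expr0n addr0 sqrtr_sqr. Qed.

Lemma tame_id : tame (fun t => t%:C%C).
Proof.
exists 1, 1%N; split=> // [t|s t _].
  rewrite norm_realC lecR mul1r /weight expr1.
  by rewrite -real_normK ?num_real//; nra.
rewrite -rmorphB norm_realC lecR mul1r ler_peMr//; exact: weight_ge1.
Qed.

Lemma tame_conj h : tame h -> tame (fun t => (h t)^*).
Proof.
move=> [K [N [K0 hK hL]]]; exists K, N; split=> // [t|s t st].
  by rewrite norm_conjC; exact: hK.
by rewrite -rmorphB norm_conjC; exact: hL.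
Qed.

Lemma tameD g h : tame g -> tame h -> tame (fun t => g t + h t).
Proof.
move=> [K [N [K0 gK gL]]] [K' [N' [K'0 hK hL]]].
exists (K + K'), (N + N')%N; split=> [|t|s t st]; first exact: addr_ge0.
  rewrite (le_trans (ler_normD _ _))// mulrDl rmorphD lerD//.
    by apply: (growth_le _ _ _ gK) => //; exact: leq_addr.
  by apply: (growth_le _ _ _ hK) => //; exact: leq_addl.
rewrite opprD addrACA (le_trans (ler_normD _ _))// !mulrDl rmorphD lerD//.
  rewrite (le_trans (gL _ _ st))// lecR ler_wpM2l ?mulr_ge0//.
  by apply: weight_le; exact: leq_addr.
rewrite (le_trans (hL _ _ st))// lecR ler_wpM2l ?mulr_ge0//.
by apply: weight_le; exact: leq_addl.
Qed.

Lemma tameM g h : tame g -> tame h -> tame (fun t => g t * h t).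
Proof.
move=> [K [N [K0 gK gL]]] [K' [N' [K'0 hK hL]]].
exists (3 * (K * K')), (N + N')%N; split=> [|t|s t st].
- by rewrite !mulr_ge0.
- rewrite normrM (le_trans (ler_pM _ _ (gK t) (hK t)))// -rmorphM lecR.
  rewrite mulrACA weightD ler_wpM2r ?weight_ge0//.
  by rewrite ler_peMl ?mulr_ge0// ler1n.
have gs : `|g s| <= (2 * K * weight N t)%:C%C.
  have -> : g s = g t - (g t - g s) by rewrite opprB addrC subrK.
  rewrite (le_trans (ler_normB _ _))// -mulrA mulr_natl mulr2n rmorphD lerD//.
  rewrite (le_trans (gL _ _ st))// lecR ler_wpM2r ?weight_ge0//.
  by rewrite ler_piMr.
have -> : g t * h t - g s * h s = (g t - g s) * h t + g s * (h t - h s).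
  by rewrite mulrBl mulrBr addrA subrK.
rewrite (le_trans (ler_normD _ _))// !normrM.
have := lerD (ler_pM (normr_ge0 _) (normr_ge0 _) (gL _ _ st) (hK t))
  (ler_pM (normr_ge0 _) (normr_ge0 _) gs (hL _ _ st)).
move=> /le_trans; apply; rewrite -!rmorphM -rmorphD lecR -weightD.
by rewrite le_eqVlt; apply/orP; left; apply/eqP; ring.
Qed.

Lemma tameZ (c : C) h : tame h -> tame (fun t => c * h t).
Proof. exact/tameM/tame_cst. Qed.

Lemma tameX h n : tame h -> tame (fun t => h t ^+ n).
Proof.
move=> th; elim: n => [|n IH].
  by under eq_fun do rewrite expr0; exact: tame_cst.
by under eq_fun do rewrite exprS; exact: tameM.
Qed.

Lemma tame_sum (I : Type) (r : seq I) (P : pred I) (h : I -> R -> C) :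
  (forall i, P i -> tame (h i)) -> tame (fun t => \sum_(i <- r | P i) h i t).
Proof.
move=> th; elim: r => [|i r IH].
  by under eq_fun do rewrite big_nil; exact: tame_cst.
have [Pi|nPi] := boolP (P i); last by under eq_fun do rewrite big_cons (negbTE nPi).
by under eq_fun do rewrite big_cons Pi; apply: tameD => //; exact: th.
Qed.

Lemma lipschitz_measurable (f : R -> R) K N : 0 <= K ->
  (forall s t, `|t - s| <= 1 -> `|f t - f s| <= K * `|t - s| * weight N t) ->
  measurable_fun setT f.
Proof.
move=> K0 fL; apply: continuous_measurable_fun => t.
apply/cvgrPdist_le => e e0.
pose B := K * weight N t + 1.
have B0 : 0 < B by rewrite ltr_wpDl// mulr_ge0// weight_ge0.
near=> s.
have st : `|t - s| <= Num.min 1 (e / B).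
  by near: s; apply: cvgr_dist_le => //; rewrite lt_min ltr01 divr_gt0.
move: st; rewrite le_min => /andP[st1 st2].
rewrite (le_trans (fL _ _ st1))//.
have := ler_wpM2l (ltW B0) st2; rewrite mulrCA divff ?gt_eqF// mulr1 => h.
apply: le_trans h; rewrite mulrAC ler_wpM2r//.
by rewrite lerDl.
Unshelve. all: by end_near.
Qed.

Lemma tame_measurable h : tame h ->
  measurable_fun setT (fun t => complex.Re (h t)) /\
  measurable_fun setT (fun t => complex.Im (h t)).
Proof.
move=> [K [N [K0 hK hL]]]; split; apply: (lipschitz_measurable K0) => s t st;
  rewrite -lecR; apply: le_trans (hL s t st).
  by have := normc_ge_Re (h t - h s); case: (h t) (h s) => [? ?] [? ?].
by have := normr_Im_le (h t - h s); case: (h t) (h s) => [? ?] [? ?].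
Qed.

End Tame.

(** * The resolvent kernel *)

Section Resolvent.
Variable R : realType.
Local Notation C := R[i].
Implicit Types h : R -> C.

Definition resolvent (z : C) (t : R) : C := (1 - z * t%:C%C)^-1.

Definition cmod (z : C) : R := complex.Re `|z|.

Lemma cmodE (z : C) : (cmod z)%:C%C = `|z|.
Proof. by rewrite RRe_real// normr_real. Qed.

Lemma cmod_ge0 (z : C) : 0 <= cmod z.
Proof. by rewrite -ler0c cmodE. Qed.

Definition resolvent_bound (z : C) : R := cmod z / `|complex.Im z|.

Lemma resolvent_bound_ge0 (z : C) : 0 <= resolvent_bound z.
Proof. by rewrite divr_ge0// cmod_ge0. Qed.

Lemma resolvent_den (z : C) (t : R) :
  `|complex.Im z|%:C%C <= `|1 - z * t%:C%C| * `|z|.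
Proof.
rewrite -(norm_conjC z) -normrM; apply: le_trans (normr_Im_le _); rewrite lecR.
case: z => a b /=; rewrite -normrN le_eqVlt; apply/orP; left; apply/eqP; congr `|_|.
by ring.
Qed.

Lemma resolvent_den_neq0 (z : C) (t : R) : z \isn't Num.real -> 1 - z * t%:C%C != 0.
Proof.
move=> zr; apply/negP => /eqP e; have := resolvent_den z t.
rewrite e normr0 mul0r lecR.
by move: zr; rewrite nonreal_Im -normr_gt0 => /lt_le_trans h /h; rewrite ltxx.
Qed.

Lemma norm_resolvent_le (z : C) (t : R) : z \isn't Num.real ->
  `|resolvent z t| <= (resolvent_bound z)%:C%C.
Proof.
move=> zr; rewrite normfV rmorphM fmorphV/= cmodE.
have d0 : 0 < `|1 - z * t%:C%C| by rewrite normr_gt0 resolvent_den_neq0.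
rewrite -[leLHS]mul1r ler_pdivrMr// mulrAC ler_pdivlMr; last first.
  by rewrite ltcR normr_gt0 -nonreal_Im.
by rewrite mul1r mulrC; exact: resolvent_den.
Qed.

Lemma resolventB (z : C) (s t : R) : z \isn't Num.real ->
  resolvent z t - resolvent z s = z * (t - s)%:C%C * (resolvent z t * resolvent z s).
Proof.
move=> zr; have := resolvent_den_neq0 t zr; have := resolvent_den_neq0 s zr.
by rewrite /resolvent rmorphB/= => ds dt; field; rewrite ds dt.
Qed.

Definition bounded_lipschitz h : Prop := exists K : R,
  [/\ 0 <= K, forall t, `|h t| <= K%:C%C &
      forall s t, `|h t - h s| <= (K * `|t - s|)%:C%C].

Lemma bounded_lipschitz_tame h : bounded_lipschitz h -> tame h.
Proof.
move=> [K [K0 hK hL]]; exists K, 0%N; split=> [//|t|s t _];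
  rewrite /weight expr0 mulr1; [exact: hK|exact: hL].
Qed.

Lemma bounded_lipschitz_affine (c e : C) h :
  bounded_lipschitz h -> bounded_lipschitz (fun t => c * (h t - e)).
Proof.
move=> [K [K0 hK hL]]; exists (cmod c * (K + cmod e)); split=> [|t|s t].
- by rewrite mulr_ge0 ?addr_ge0 ?cmod_ge0.
- rewrite normrM (rmorphM (real_complex R)) (rmorphD (real_complex R))/= !cmodE ler_wpM2l//.
  by rewrite (le_trans (ler_normB _ _))// lerD2r.
- rewrite -mulrBr opprB addrA subrK normrM -mulrA (rmorphM (real_complex R))/= cmodE.
  rewrite ler_wpM2l// (le_trans (hL _ _))// lecR ler_wpM2r// lerDl cmod_ge0//.
Qed.

Lemma bounded_lipschitz_resolvent (z : C) :
  z \isn't Num.real -> bounded_lipschitz (resolvent z).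
Proof.
move=> zr; pose B := resolvent_bound z; have B0 := resolvent_bound_ge0 z.
exists (B + cmod z * (B * B)); split=> [|t|s t].
- by rewrite addr_ge0 ?mulr_ge0 ?cmod_ge0.
- rewrite (le_trans (norm_resolvent_le _ zr))// lecR lerDl.
  by rewrite !mulr_ge0 ?cmod_ge0.
- rewrite resolventB// !normrM norm_realC.
  rewrite (le_trans (ler_wpM2l _ (ler_pM _ _ (norm_resolvent_le t zr)
    (norm_resolvent_le s zr))))//; first by rewrite mulr_ge0// ler0c.
  by rewrite -cmodE -!rmorphM lecR mulrAC ler_wpM2r// lerDr.
Qed.

Lemma tame_resolvent (z : C) : z \isn't Num.real -> tame (resolvent z).
Proof. by move=> zr; exact/bounded_lipschitz_tame/bounded_lipschitz_resolvent. Qed.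

Lemma conj_resolvent (z : C) (t : R) : (resolvent z t)^* = resolvent z^* t.
Proof.
rewrite /resolvent fmorphV rmorphB rmorph1 rmorphM /=; congr (1 - _ * _)^-1.
exact: conjc_real.
Qed.

Lemma mul_resolvent (z : C) (t : R) : z \isn't Num.real ->
  t%:C%C * resolvent z t = z^-1 * (resolvent z t - 1).
Proof.
move=> zr; have := resolvent_den_neq0 t zr; have := nonreal_neq0 zr.
by rewrite /resolvent => z0 dt; field; rewrite z0 dt.
Qed.

Lemma resolvent0 (t : R) : resolvent 0 t = 1.
Proof. by rewrite /resolvent mul0r subr0 invr1. Qed.

(** Uniformity in y allows an expansion at the boundary point 0. *)
Lemma norm_resolvent_imag (y t : R) : `|resolvent (imag y) t| <= 1.
Proof.
rewrite normfV; have h : 1 <= `|1 - imag y * t%:C%C|.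
  have := normc_ge_Re (1 - imag y * t%:C%C).
  by rewrite /= mul0r mulr0 subrr subr0 normr1.
by rewrite invf_le1// (lt_le_trans ltr01).
Qed.

(** First-order expansion of the powers of the resolvent, uniform in t up to the
    weight t^2; the base point may be 0, where the resolvent is 1. *)
Lemma resolvent_expansion (B : R) (j : nat) : 0 <= B ->
  exists2 c : R, 0 <= c & forall (z0 z : C) (t : R),
    1 - z0 * t%:C%C != 0 -> 1 - z * t%:C%C != 0 ->
    `|resolvent z0 t| <= B%:C%C -> `|resolvent z t| <= B%:C%C ->
    `|resolvent z t ^+ j - resolvent z0 t ^+ j
      - (z - z0) * (j%:R * t%:C%C * resolvent z0 t ^+ j.+1)|
    <= (c * t ^+ 2)%:C%C * `|z - z0| ^+ 2.
Proof.
move=> B0; elim: j => [|j [c c0 IH]].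
  exists 0 => // z0 z t _ _ _ _.
  by rewrite !expr0 subrr mul0r mul0r mulr0 subrr normr0 mul0r mul0r.
exists (B * c + j.+1%:R * (B ^+ j.+2 * B)) => [|z0 z t d0 d r0 r1].
  by apply: addr_ge0; apply: mulr_ge0 => //; apply: mulr_ge0 => //; exact: exprn_ge0.
set r := resolvent z t; set q := resolvent z0 t; set u := z - z0; set x : C := t%:C%C.
have rq : r = q + u * x * (q * r).
  by rewrite /r /q /u /x /resolvent; field; rewrite d0 d.
have -> : r ^+ j.+1 - q ^+ j.+1 - u * (j.+1%:R * x * q ^+ j.+2) =
    r * (r ^+ j - q ^+ j - u * (j%:R * x * q ^+ j.+1))
    + j.+1%:R * (u ^+ 2 * x ^+ 2 * (q ^+ j.+2 * r)).
  have e1 : r * q ^+ j = q ^+ j.+1 + u * x * (q ^+ j.+1 * r).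
    by rewrite {1}rq exprS; ring.
  have e2 : q ^+ j.+1 * r = q ^+ j.+2 + u * x * (q ^+ j.+2 * r).
    by rewrite {1}rq !exprS; ring.
  rewrite !mulrBr -exprS e1.
  have -> : r * (u * (j%:R * x * q ^+ j.+1)) = u * (j%:R * x * (q ^+ j.+1 * r)) by ring.
  by rewrite e2 -natr1; ring.
rewrite (le_trans (ler_normD _ _))// [(_ + _) * t ^+ 2]mulrDl.
rewrite [X in _ <= X * _](rmorphD (real_complex R)) [leRHS]mulrDl lerD//.
  rewrite normrM -[B * c * _]mulrA (rmorphM (real_complex R) B)/=.
  by rewrite -[leRHS]mulrA ler_pM//; exact: IH.
have hq : `|q| ^+ j.+2 * `|r| <= (B ^+ j.+2 * B)%:C%C.
  rewrite (rmorphM (real_complex R)); apply: ler_pM => //.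
  by rewrite rmorphXn; apply: lerXn2r; rewrite ?nnegrE // ler0c.
have x2 : `|x| ^+ 2 = (t ^+ 2)%:C%C.
  by rewrite norm_realC -rmorphXn/= real_normK ?num_real.
rewrite normrM (normrM (u ^+ 2 * x ^+ 2)) (normrM (u ^+ 2)) (normrM (q ^+ _)) !normrX.
rewrite ger0_norm// x2.
have -> : (j.+1%:R * (B ^+ j.+2 * B) * t ^+ 2)%:C%C * `|u| ^+ 2 =
    j.+1%:R * (`|u| ^+ 2 * (t ^+ 2)%:C%C * (B ^+ j.+2 * B)%:C%C) :> C.
  rewrite !(rmorphM (real_complex R)) /= rmorph_nat.
  by move: (`|u| ^+ 2) => y; ring.
rewrite ler_wpM2l// ler_wpM2l// mulr_ge0 ?exprn_ge0// ler0c sqr_ge0//.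
Qed.

End Resolvent.

(** * Riemann sums *)

Section StepFunctions.
Variable R : realType.
Local Notation C := R[i].
Implicit Types (h : R -> C) (s t : R) (n j : nat).

(** The cells have width 1/(n+1) and cover the interval from -(n+1) to n+1. *)
Definition node n j : R := j%:R / n.+1%:R - n.+1%:R.

Definition cell n j : set R := `[node n j, node n j.+1[%classic.

Definition cells n : nat := (2 * n.+1 ^ 2)%N.

Definition step n h t : C := \sum_(j < cells n) h (node n j) * (\1_(cell n j) t)%:C%C.

Lemma measurable_cell n j : measurable (cell n j).
Proof. exact: measurable_itv. Qed.

Lemma node_le n i j : (i <= j)%N -> node n i <= node n j.
Proof. by move=> ij; rewrite lerD2r ler_pM2r ?invr_gt0 ?ltr0n// ler_nat. Qed.

Lemma nodeS n j : node n j.+1 = node n j + n.+1%:R^-1.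
Proof. by rewrite /node -addn1 natrD mulrDl div1r addrAC. Qed.

Lemma step_cell n h t (j : 'I_(cells n)) : cell n j t -> step n h t = h (node n j).
Proof.
move=> tj; rewrite /step (bigD1 j)//= big1 => [|i ij].
  by rewrite addr0 indicE mem_set// mulr1.
rewrite indicE memNset ?mulr0// => ti; move: tj ti ij.
rewrite /cell/= !in_itv/= => /andP[j1 j2] /andP[i1 i2] /negP[].
apply/eqP/val_inj/eqP => /=; rewrite eqn_leq; apply/andP; split.
  rewrite leqNgt; apply/negP => /(node_le n) ji.
  by have := lt_le_trans j2 (le_trans ji i1); rewrite ltxx.
rewrite leqNgt; apply/negP => /(node_le n) ij.
by have := lt_le_trans i2 (le_trans ij j1); rewrite ltxx.
Qed.

Lemma step_cases n h t :
  (exists2 s, step n h t = h s & `|t - s| <= n.+1%:R^-1) \/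
  (step n h t = 0 /\ n.+1%:R <= `|t|).
Proof.
pose N : R := n.+1%:R; have N0 : 0 < N by rewrite ltr0n.
have [[j tj]|nj] := pselect (exists j : 'I_(cells n), cell n j t).
  left; exists (node n j); first exact: step_cell.
  move: tj; rewrite /cell/= in_itv/= nodeS => /andP[j1 j2].
  by rewrite ger0_norm ?subr_ge0// lerBlDl ltW.
right; split.
  rewrite /step big1// => j _; rewrite indicE memNset ?mulr0// => tj.
  by apply: nj; exists j.
rewrite leNgt; apply/negP; rewrite ltr_norml => /andP[t1 t2]; apply: nj.
have x0 : 0 <= (t + N) * N by rewrite mulr_ge0 ?ltW// -ltrBlDr sub0r.
have /andP[k1 k2] := truncn_itv x0; set k := Num.truncn _ in k1 k2.
have kn : (k < cells n)%N.
  rewrite -(ltr_nat R) (le_lt_trans k1)//.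
  have -> : (cells n)%:R = (N + N) * N by rewrite /cells natrM natrX /N; ring.
  by rewrite ltr_pM2r// ltrD2r.
exists (Ordinal kn); rewrite /cell/= in_itv/= /node -/N.
by rewrite lerBlDr ler_pdivrMr// k1 ltrBrDr ltr_pdivlMr.
Qed.

(** Off the cells |t| >= n + 1, and the additional factor 1 + t^2 in the weight pays for
    the division by n + 1. *)
Lemma step_error n h t K N : 0 <= K -> growth K N h ->
  (forall s t, `|t - s| <= 1 -> `|h t - h s| <= (K * `|t - s| * weight N t)%:C%C) ->
  `|h t - step n h t| <= (K / n.+1%:R * weight N.+1 t)%:C%C.
Proof.
move=> K0 hK hL; have n0 : 0 < n.+1%:R :> R by rewrite ltr0n.
have [[s -> st]|[-> nt]] := step_cases n h t.
  rewrite (le_trans (hL s t _))//; first by rewrite (le_trans st)// invf_le1// ler1n.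
  rewrite lecR -!mulrA ler_wpM2l// ler_pM//; first exact: weight_ge0.
  exact: weight_le.
rewrite subr0 (le_trans (hK t))// lecR -!mulrA ler_wpM2l// [leRHS]mulrC.
rewrite ler_pdivlMr// (_ : weight N.+1 t = weight N t * (1 + t ^+ 2)); last first.
  by rewrite /weight exprSr.
rewrite ler_wpM2l ?weight_ge0//.
rewrite -real_normK ?num_real//.
have n1 : 1 <= n.+1%:R :> R by rewrite ler1n.
by nra.
Qed.

End StepFunctions.

Section RiemannSums.
Variables (R : realType) (d : nat) (mu : set R -> 'M[R[i]]_d.+1).
Hypothesis Hmu : matrix_measure mu.
Local Notation C := R[i].
Implicit Types (D A : set R) (h g : R -> C) (v : 'cV[C]_d.+1).

Definition riemann_sum n D h k l : C :=
  \sum_(j < cells n) h (node R n j) * mu (cell n j `&` D) k l.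

Lemma mintegrable_step n D h : measurable D -> mintegrable Hmu D (step n h).
Proof.
move=> mD; apply: mintegrable_sum => // j _.
by have [] := entry_integral_indic Hmu mD (h (node R n j)) ord0 ord0 (measurable_cell n j).
Qed.

Lemma entry_integral_step n D h k l : measurable D ->
  entry_integral mu D (step n h) k l = riemann_sum n D h k l.
Proof.
move=> mD; rewrite (@entry_integral_sum _ _ _ Hmu _ mD); last first.
  move=> j _.
  by have [] := entry_integral_indic Hmu mD (h (node R n j)) ord0 ord0 (measurable_cell n j).
apply: eq_bigr => j _.
by have [_ ->] := entry_integral_indic Hmu mD (h (node R n j)) k l (measurable_cell n j).
Qed.

Lemma riemann_sum_error n D h (g : R -> R) k l : measurable D ->
  mintegrable Hmu D h ->
  (forall v, (form_measure Hmu v).-integrable D (EFin \o g)) ->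
  (forall t, D t -> `|h t - step n h t| <= (g t)%:C%C) ->
  `|entry_integral mu D h k l - riemann_sum n D h k l| <= (mass Hmu D g k l)%:C%C.
Proof.
move=> mD ih ig hg; rewrite -entry_integral_step// -mulN1r.
have is' := mintegrable_step n h mD.
rewrite -(entry_integralZ mD _ _ _ is') -(entry_integralD mD _ _ ih); last first.
  exact: mintegrableZ.
apply: (@norm_entry_integral_le _ _ _ Hmu) => // [|t Dt].
  by apply: mintegrableD => //; exact: mintegrableZ.
by rewrite mulN1r; exact: hg.
Qed.

Lemma mass_scale D (g : R -> R) c k l : measurable D ->
  (forall v, (form_measure Hmu v).-integrable D (EFin \o g)) ->
  mass Hmu D (fun t => c * g t) k l = c * mass Hmu D g k l.
Proof.
by move=> mD ig; rewrite /mass big_distrr/=; apply: eq_bigr => m _; rewrite RintegralZl.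
Qed.

Lemma mass_ge0 D (g : R -> R) k l : (forall t, 0 <= g t) -> 0 <= mass Hmu D g k l.
Proof. by move=> g0; apply: sumr_ge0 => m _; apply: Rintegral_ge0 => t _. Qed.

Hypothesis Hmom : has_moments mu.

Lemma power_integrable v k : (form_measure Hmu v).-integrable setT (fun t : R => (t ^+ k)%:E).
Proof.
have /integrableP[mk ik] := Hmom k v.
by apply/integrableP; split=> //; rewrite -integral_qmeasure.
Qed.

Lemma weight_integrable v N (c : R) D : measurable D ->
  (form_measure Hmu v).-integrable D (EFin \o (fun t => c * weight N t)).
Proof.
move=> mD; apply: (@integrableS _ _ _ _ setT) => //.
apply: (@integrableZl _ _ _ _ _ measurableT c (EFin \o weight N)).
have -> : (EFin \o weight N : R -> \bar R) =
    fun t => (\sum_(i < N.+1) ('C(N, i)%:R%:E * (t ^+ (2 * i))%:E))%E.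
  apply/funext => t /=; rewrite /weight exprDn -sumEFin; apply: eq_bigr => i _.
  by rewrite expr1n mul1r -exprM -EFinM mulr_natl.
by apply: (integrable_sum measurableT) => i _; apply: integrableZl => //; exact: power_integrable.
Qed.

Lemma mintegrable_growth D h K N : measurable D ->
  measurable_fun setT (fun t => complex.Re (h t)) ->
  measurable_fun setT (fun t => complex.Im (h t)) ->
  growth K N h -> mintegrable Hmu D h.
Proof.
move=> mD m1 m2 hK v.
by apply: (cintegrable_le mD m1 m2 (weight_integrable v N K mD)) => t _; exact: hK.
Qed.

Lemma mintegrable_tame D h : measurable D -> tame h -> mintegrable Hmu D h.
Proof.
move=> mD th; have [m1 m2] := tame_measurable th.
by have [K [N [_ hK _]]] := th; exact: mintegrable_growth hK.
Qed.

Lemma norm_entry_integral_growth D h K N k l : measurable D -> 0 <= K ->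
  mintegrable Hmu D h -> (forall t, D t -> `|h t| <= (K * weight N t)%:C%C) ->
  `|entry_integral mu D h k l| <= (K * mass Hmu setT (weight N) k l)%:C%C.
Proof.
move=> mD K0 ih hK; rewrite (le_trans (norm_entry_integral_le mD k l ih _ hK))//.
  by move=> v; exact: weight_integrable.
have iw D' v : measurable D' -> (form_measure Hmu v).-integrable D' (EFin \o weight N).
  move=> mD'; have := weight_integrable v N 1 mD'.
  by under eq_fun do rewrite mul1r.
rewrite lecR mass_scale//; last by move=> v; exact: iw.
rewrite ler_wpM2l//; apply: ler_sum => m _.
rewrite Rintegral_mkcond; apply: le_Rintegral => //.
- rewrite -restrict_EFin; apply: (proj1 (integrable_mkcond _ mD)); exact: iw.
- exact: iw.
- by move=> t _; rewrite /patch; case: ifP => // _; exact: weight_ge0.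
Qed.

Lemma riemann_sum_tame D h k l : measurable D -> tame h ->
  exists2 c : R, 0 <= c & forall n,
    `|entry_integral mu D h k l - riemann_sum n D h k l| <= (c / n.+1%:R)%:C%C.
Proof.
move=> mD th; have ih := mintegrable_tame mD th; have [K [N [K0 hK hL]]] := th.
exists (K * mass Hmu D (weight N.+1) k l).
  by rewrite mulr_ge0// mass_ge0// => t; exact: weight_ge0.
move=> n; have iw v : (form_measure Hmu v).-integrable D (EFin \o weight N.+1).
  by have := weight_integrable v N.+1 1 mD; under eq_fun do rewrite mul1r.
rewrite mulrAC -(mass_scale _ _ _ mD iw); apply: riemann_sum_error => //.
  by move=> v; exact: weight_integrable.
by move=> t _; exact: step_error.
Qed.

End RiemannSums.

(** * The sesquilinear form of a matrix measure *)

Section SmallNumbers.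
Variable R : realType.
Local Notation C := R[i].

Lemma le0_of_inv_bound (r c : R) : 0 <= c -> (forall n, r <= c / n.+1%:R) -> r <= 0.
Proof.
move=> c0 rc; rewrite leNgt; apply/negP => r0.
have cr0 : 0 <= c / r by rewrite divr_ge0// ltW.
have /andP[_ h] := truncn_itv cr0; have := rc (Num.truncn (c / r)).
by rewrite leNgt ltr_pdivrMr ?ltr0n// mulrC -ltr_pdivrMr// h.
Qed.

Lemma eq_of_inv_bound (x y : C) (c : R) : 0 <= c ->
  (forall n, `|x - y| <= (c / n.+1%:R)%:C%C) -> x = y.
Proof.
move=> c0 xy; apply/eqP; rewrite -subr_eq0 -normr_eq0 -cmodE.
rewrite (_ : cmod (x - y) = 0)//; apply/eqP; rewrite eq_le cmod_ge0 andbT.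
by apply: (le0_of_inv_bound c0) => n; rewrite -lecR cmodE.
Qed.

Lemma ge0_of_inv_bound (x : C) (c : R) : 0 <= c ->
  (forall n, exists2 y : C, 0 <= y & `|x - y| <= (c / n.+1%:R)%:C%C) -> 0 <= x.
Proof.
move=> c0 xy; rewrite lecE /=; apply/andP; split.
  rewrite -normr_eq0; apply/eqP/le_anti/andP; split=> //.
  apply: (le0_of_inv_bound c0) => n; have [y y0 xyn] := xy n.
  rewrite -lecR (le_trans _ xyn)// (le_trans _ (normr_Im_le _))// lecR.
  by move: (ger0_Im y0); case: (x) (y) => [? ?] [? ?] /= ->; rewrite subr0.
rewrite -oppr_le0; apply: (le0_of_inv_bound c0) => n; have [y y0 xyn] := xy n.
have : complex.Re y - complex.Re x <= c / n.+1%:R.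
  rewrite -lecR (le_trans _ xyn)// distrC (le_trans _ (normc_ge_Re _))// lecR.
  by case: (x) (y) {y0 xyn} => [? ?] [? ?] /=; exact: ler_norm.
by apply: le_trans; rewrite lerDr; move: y0; rewrite lecE => /andP[].
Qed.

End SmallNumbers.

Section Form.
Variables (R : realType) (d : nat) (mu : set R -> 'M[R[i]]_d.+1).
Hypothesis Hmu : matrix_measure mu.
Hypothesis Hmom : has_moments mu.
Local Notation C := R[i].
Local Notation M := 'M[R[i]]_d.+1.
Implicit Types (D A : set R) (h : R -> C) (P Q : R -> M) (X : M) (v : 'cV[C]_d.+1).

Definition mtame P : Prop := forall i j, tame (fun t => P t i j).

Lemma mtame_cst X : mtame (fun=> X).
Proof. by move=> i j; exact: tame_cst. Qed.

Lemma mtameD P Q : mtame P -> mtame Q -> mtame (fun t => P t + Q t).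
Proof. by move=> tP tQ i j; under eq_fun do rewrite mxE; exact: tameD. Qed.

Lemma mtameM P Q : mtame P -> mtame Q -> mtame (fun t => P t * Q t).
Proof.
move=> tP tQ i j; under eq_fun do rewrite mxE.
by apply: tame_sum => k _; exact: tameM.
Qed.

Lemma mtameZ h P : tame h -> mtame P -> mtame (fun t => h t *: P t).
Proof. by move=> th tP i j; under eq_fun do rewrite mxE; exact: tameM. Qed.

Lemma mtameN P : mtame P -> mtame (fun t => - P t).
Proof.
move=> tP; under eq_fun do rewrite -scaleN1r; apply: mtameZ => //.
exact: tame_cst.
Qed.

Lemma mtameB P Q : mtame P -> mtame Q -> mtame (fun t => P t - Q t).
Proof. by move=> tP tQ; apply: mtameD => //; exact: mtameN. Qed.

Lemma mtame_sum (I : Type) (r : seq I) (p : pred I) (F : I -> R -> M) :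
  (forall i, p i -> mtame (F i)) -> mtame (fun t => \sum_(i <- r | p i) F i t).
Proof.
move=> tF i j; under eq_fun do rewrite summxE.
by apply: tame_sum => k pk; exact: tF.
Qed.

Lemma mtame_mxeval (q : {poly M}) : mtame (fun t => mxeval q t%:C%C).
Proof.
have -> : (fun t => mxeval q t%:C%C) =
    fun t => \sum_(i < size q) (t%:C%C ^+ i) *: q`_i.
  apply/funext => t; rewrite /mxeval horner_coef; apply: eq_bigr => i _.
  by rewrite -rmorphXn/= -[_ * _]/(_ *m _) mul_mx_scalar.
by apply: mtame_sum => i _; apply: mtameZ; [exact/tameX/tame_id|exact: mtame_cst].
Qed.

Variable D : set R.
Hypothesis mD : measurable D.

Definition form P Q : M := matrix_integral mu D P Q.

Local Notation E := (entry_integral mu D).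

Lemma formE P Q i j : form P Q i j =
  \sum_k \sum_l E (fun t => (P t k i)^* * Q t l j) k l.
Proof.
rewrite mxE; apply: eq_bigr => k _; apply: eq_bigr => l _.
by under eq_fun do rewrite !mxE.
Qed.

Lemma eq_form P P' Q Q' : P =1 P' -> Q =1 Q' -> form P Q = form P' Q'.
Proof. by move=> /funext -> /funext ->. Qed.

Lemma tame_pair P Q k i l j : mtame P -> mtame Q ->
  tame (fun t => (P t k i)^* * Q t l j).
Proof. by move=> tP tQ; apply: tameM => //; apply: tame_conj. Qed.

Lemma mintegrable_pair P Q k i l j : mtame P -> mtame Q ->
  mintegrable Hmu D (fun t => (P t k i)^* * Q t l j).
Proof. by move=> tP tQ; apply: mintegrable_tame => //; exact: tame_pair. Qed.

Lemma form_adj P Q : mtame P -> mtame Q -> (form P Q) ^t* = form Q P.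
Proof.
move=> tP tQ; apply/matrixP => i j; rewrite 2!mxE !formE.
rewrite rmorph_sum exchange_big/=; apply: eq_bigr => k _.
rewrite rmorph_sum; apply: eq_bigr => l _.
have ih := @mintegrable_pair P Q k j l i tP tQ.
apply: (etrans (esym (entry_integral_conj mD k l ih))).
by apply: (eq_entry_integral Hmu) => t _; rewrite rmorphM/= conjCK mulrC.
Qed.

Lemma formDr P Q Q' : mtame P -> mtame Q -> mtame Q' ->
  form P (fun t => Q t + Q' t) = form P Q + form P Q'.
Proof.
move=> tP tQ tQ'; apply/matrixP => i j; rewrite [RHS]mxE !formE -big_split/=.
apply: eq_bigr => k _; rewrite -big_split/=; apply: eq_bigr => l _.
rewrite -(entry_integralD mD _ _ (mintegrable_pair k i l j tP tQ) (mintegrable_pair k i l j tP tQ')).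
by apply: (eq_entry_integral Hmu) => t _; rewrite mxE mulrDr.
Qed.

Lemma formMr P Q X : mtame P -> mtame Q -> form P (fun t => Q t * X) = form P Q * X.
Proof.
move=> tP tQ; apply/matrixP => i j; rewrite formE [RHS]mxE.
under [RHS]eq_bigr do rewrite formE big_distrl/=.
rewrite [RHS]exchange_big/=; apply: eq_bigr => k _.
under [RHS]eq_bigr do rewrite big_distrl/=.
rewrite [RHS]exchange_big/=; apply: eq_bigr => l _.
have im m : mintegrable Hmu D (fun t => X m j * ((P t k i)^* * Q t l m)).
  by apply: mintegrableZ => //; exact: mintegrable_pair.
under [RHS]eq_bigr => m _ do
  rewrite mulrC -(entry_integralZ mD _ _ _ (mintegrable_pair k i l m tP tQ)).
rewrite -(@entry_integral_sum _ _ _ Hmu _ mD); last by move=> m _; exact: im.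
apply: (eq_entry_integral Hmu) => t _; rewrite mxE big_distrr/=; apply: eq_bigr => m _.
by rewrite mulrA mulrC.
Qed.

Lemma formDl P P' Q : mtame P -> mtame P' -> mtame Q ->
  form (fun t => P t + P' t) Q = form P Q + form P' Q.
Proof.
move=> tP tP' tQ; have tPP := mtameD tP tP'.
by rewrite -form_adj// formDr// adjmxD !form_adj.
Qed.

Lemma formMl P Q X : mtame P -> mtame Q ->
  form (fun t => P t * X) Q = X ^t* * form P Q.
Proof.
move=> tP tQ; have tPX := mtameM tP (mtame_cst X).
by rewrite -form_adj// formMr// adjrM form_adj.
Qed.

Lemma form_scaler P Q (c : C) : mtame P -> mtame Q ->
  form P (fun t => c *: Q t) = c *: form P Q.
Proof.
move=> tP tQ; rewrite (@eq_form _ P _ (fun t => Q t * c%:M))//.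
  by rewrite formMr// -[_ * _]/(_ *m _) mul_mx_scalar.
by move=> t; rewrite -[_ * _]/(_ *m _) mul_mx_scalar.
Qed.

Lemma formBr P Q Q' : mtame P -> mtame Q -> mtame Q' ->
  form P (fun t => Q t - Q' t) = form P Q - form P Q'.
Proof.
move=> tP tQ tQ'; rewrite formDr//; last exact: mtameN.
congr (_ + _); rewrite -scaleN1r -form_scaler//; apply: eq_form => // t.
by rewrite scaleN1r.
Qed.

Lemma form_kernel h P Q :
  form P (fun t => h t *: Q t) = form (fun t => (h t)^* *: P t) Q.
Proof.
apply/matrixP => i j; rewrite !formE; apply: eq_bigr => k _; apply: eq_bigr => l _.
apply: (eq_entry_integral Hmu) => t _; rewrite !mxE rmorphM/= conjCK.
by rewrite mulrA [_ * h t]mulrC.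
Qed.

(** The Riemann sums are sums of values of the positive forms mu(cell), and positivity
    passes to the limit. *)
Lemma form_diag_ge0 P i : mtame P -> 0 <= form P P i i.
Proof.
move=> tP; pose q k l t := (P t k i)^* * P t l i.
have tq k l : tame (q k l) by exact: tame_pair.
have [c c0 hc] : exists2 c : 'I_d.+1 -> 'I_d.+1 -> R, (forall k l, 0 <= c k l) &
    forall k l n, `|E (q k l) k l - riemann_sum mu n D (q k l) k l|
      <= (c k l / n.+1%:R)%:C%C.
  have h k l := riemann_sum_tame Hmu Hmom k l mD (tq k l).
  exists (fun k l => sval (cid2 (h k l))) => k l; first by case: cid2.
  by move=> n; case: cid2 => ? ? /=; apply.
apply: (@ge0_of_inv_bound _ _ (\sum_k \sum_l c k l)).
  by apply: sumr_ge0 => k _; apply: sumr_ge0.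
move=> n; exists (\sum_k \sum_l riemann_sum mu n D (q k l) k l).
  have -> : \sum_k \sum_l riemann_sum mu n D (q k l) k l =
      \sum_(j < cells n) qform (mu (cell n j `&` D)) (col i (P (node R n j))).
    under eq_bigr do rewrite exchange_big/=.
    rewrite exchange_big/=; apply: eq_bigr => j _.
    rewrite qform_sesqui sesquiE; apply: eq_bigr => k _; apply: eq_bigr => l _.
    by rewrite !mxE.
  apply: sumr_ge0 => j _; have [_ psd _] := Hmu.
  by apply: psd; apply: measurableI => //; exact: measurable_cell.
rewrite formE -sumrB (le_trans (ler_norm_sum _ _ _))//.
rewrite big_distrl/= (rmorph_sum (real_complex R)); apply: ler_sum => k _.
rewrite -sumrB (le_trans (ler_norm_sum _ _ _))//.
by rewrite big_distrl/= (rmorph_sum (real_complex R)); apply: ler_sum => l _; exact: hc.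
Qed.

(** The column v is stored in a square matrix X, so that the value at v becomes a
    diagonal entry of the form of P X. *)
Lemma form_psd P : mtame P -> psdmx (form P P).
Proof.
move=> tP v; pose X : M := v *m delta_mx 0 ord0.
have -> : qform (form P P) v = (X ^t* * form P P * X) ord0 ord0.
  have Xe : X *m delta_mx ord0 0 = v.
    rewrite /X -mulmxA mul_delta_mx (_ : delta_mx 0 0 = 1%:M) ?mulmx1//.
    by apply/matrixP => a b; rewrite !ord1 !mxE.
  rewrite -sesqui_delta /sesqui /qform -{1 2}Xe adjmxM.
  by congr (_ 0 0); rewrite -[X ^t* * _ * X]/(X ^t* *m form P P *m X) !mulmxA.
have tPX := mtameM tP (mtame_cst X).
by rewrite -mulrA -formMr// -formMl//; exact: form_diag_ge0.
Qed.

End Form.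

Section FormConsequences.
Variables (R : realType) (d : nat) (mu : set R -> 'M[R[i]]_d.+1).
Hypothesis Hmu : matrix_measure mu.
Hypothesis Hmom : has_moments mu.
Local Notation C := R[i].
Local Notation M := 'M[R[i]]_d.+1.
Implicit Types (D A : set R) (h : R -> C) (P Q : R -> M) (X : M) (v : 'cV[C]_d.+1).

Local Notation formT := (form mu setT).

(** Along the multiples of the null vector v the quadratic form is affine; being
    nonnegative, it has no linear term. *)
Lemma block_null (A B D : M) v :
  (forall X Y : M, 0 <= (X ^t* * (A * X) + Y ^t* * (B ^t* * X) +
    (X ^t* * (B * Y) + Y ^t* * (D * Y))) 0 0) ->
  qform D v = 0 -> B *m v = 0.
Proof.
move=> psd Dv0.
have [X Xe] : exists X : 'cV[C]_d.+1 -> M, forall w, X w *m delta_mx ord0 0 = w.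
  exists (fun w => w *m delta_mx 0 ord0) => w.
  rewrite -mulmxA mul_delta_mx (_ : delta_mx 0 0 = 1%:M) ?mulmx1//.
  by apply/matrixP => i j; rewrite !ord1 !mxE.
have addE (F G : M) : (F + G) 0 0 = F 0 0 + G 0 0 by rewrite mxE.
have XX F w w' : ((X w) ^t* * (F * X w')) 0 0 = sesqui F w w'.
  rewrite mulrA -sesqui_delta /sesqui -{2}(Xe w) -[X in _ = (_ *m X) _ _](Xe w').
  rewrite adjmxM; congr (_ 0 0).
  by rewrite -[(X w) ^t* * _ * X w']/((X w) ^t* *m F *m X w') !mulmxA.
have {psd} ineq u w : 0 <= sesqui A u u + sesqui (B ^t*) w u + (sesqui B u w + sesqui D w w).
  by rewrite -(XX A u u) -(XX (B ^t*) w u) -(XX B u w) -(XX D w w) -!addE; exact: psd.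
have key u : sesqui B u v = 0.
  apply/eqP/negPn/negP => b0; pose a := sesqui A u u.
  have a0 : 0 <= a.
    have := ineq u 0; rewrite -(scale0r (0 : 'cV[C]_d.+1)) !sesquiZl !sesquiZr.
    by rewrite conjC0 !mul0r !addr0.
  set b := sesqui B u v in b0.
  pose s := - (a + 1) / (2 * b).
  have := ineq u (s *: v); rewrite !sesquiZl !sesquiZr -conj_sesqui -/a -/b.
  rewrite (_ : sesqui D v v = 0)// !mulr0 addr0.
  have sb : s * b = - (a + 1) / 2 by rewrite /s; field.
  have -> : s^* * b^* = - (a + 1) / 2.
    rewrite -rmorphM sb rmorphM rmorphN rmorphD rmorph1 fmorphV/= conjC_nat.
    by rewrite (CrealP (ger0_real a0)).
  have -> : a + - (a + 1) / 2 + s * b = -1 by rewrite sb; field.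
  by rewrite oppr_ge0 => /le_lt_trans/(_ ltr01); rewrite ltxx.
apply/colP => i; rewrite mxE.
by have := key (delta_mx i 0); rewrite /sesqui trmx_delta map_delta_mx -mulmxA -rowE !mxE.
Qed.

(** Cauchy-Schwarz for a null vector of the form. *)
Lemma form_null P Q v : mtame P -> mtame Q ->
  qform (formT Q Q) v = 0 -> formT P Q *m v = 0.
Proof.
move=> tP tQ; apply: (@block_null (formT P P)) => X Y.
have tPX := mtameM tP (mtame_cst X); have tQY := mtameM tQ (mtame_cst Y).
have tsum := mtameD tPX tQY.
have := @form_diag_ge0 _ _ _ Hmu Hmom setT measurableT _ 0 tsum.
rewrite (formDr Hmu Hmom measurableT tsum tPX tQY).
rewrite (formDl Hmu Hmom measurableT tPX tQY tPX) (formDl Hmu Hmom measurableT tPX tQY tQY).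
rewrite (formMl Hmu Hmom measurableT _ tP tPX) (formMl Hmu Hmom measurableT _ tQ tPX).
rewrite (formMl Hmu Hmom measurableT _ tP tQY) (formMl Hmu Hmom measurableT _ tQ tQY).
rewrite (formMr Hmu Hmom measurableT _ tP tP) (formMr Hmu Hmom measurableT _ tQ tP).
rewrite (formMr Hmu Hmom measurableT _ tP tQ) (formMr Hmu Hmom measurableT _ tQ tQ).
by rewrite (form_adj Hmu Hmom measurableT tP tQ); apply.
Qed.

Lemma scalar_integralE D h : measurable D -> mintegrable Hmu D h ->
  scalar_integral mu D h = form mu D (fun=> 1) (fun t => h t *: 1).
Proof.
move=> mD ih; apply/matrixP => i j; rewrite formE mxE.
have term k l : entry_integral mu D (fun t => ((1 : M) k i)^* * (h t *: (1 : M)) l j) k l =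
    (k == i)%:R * (l == j)%:R * entry_integral mu D h k l.
  rewrite -(entry_integralZ mD _ _ _ ih); apply: (eq_entry_integral Hmu) => t _.
  by rewrite !mxE conjC_nat; ring.
under eq_bigr do under eq_bigr do rewrite term.
rewrite (bigD1 i)//= [X in _ + X]big1 ?addr0; last first.
  by move=> k ki; rewrite big1// => l _; rewrite (negbTE ki) !mul0r.
rewrite (bigD1 j)//= [X in _ + X]big1 ?addr0; last first.
  by move=> l lj; rewrite (negbTE lj) mulr0 mul0r.
by rewrite !eqxx !mul1r.
Qed.

Lemma entry_integral_restrict A h k l :
  entry_integral mu A h k l =
  entry_integral mu setT (fun t => (\1_A t)%:C%C * h t) k l.
Proof.
rewrite !(entry_integralE Hmu); congr (_ * _); apply: eq_bigr => m _; congr (_ * _).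
rewrite !cintegralE; congr (_ +i* _)%C; rewrite Rintegral_mkcond;
  apply: eq_Rintegral => t _; rewrite /patch indicE; case: ifP => tA;
  by case: (h t) => a b /=; rewrite ?mul0r ?mul1r ?subr0 ?addr0.
Qed.

End FormConsequences.

(** * The matrix measure with density P *)

Section Density.
Variables (R : realType) (d : nat) (mu : set R -> 'M[R[i]]_d.+1).
Hypothesis Hmu : matrix_measure mu.
Hypothesis Hmom : has_moments mu.
Local Notation C := R[i].
Local Notation M := 'M[R[i]]_d.+1.
Variable P : R -> M.
Hypothesis tP : mtame P.
Implicit Types (D A : set R) (h : R -> C) (v : 'cV[C]_d.+1).

(** For the values P of a polynomial p this is poly_measure mu p, by definition. *)
Definition density_measure A : M := form mu A P P.

Local Notation q k l i j := (fun t => (P t k i)^* * P t l j).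

Lemma Rintegral_sigma_additive (m : {measure set R -> \bar R}) (f : R -> R)
    (F : (set R)^nat) : m.-integrable setT (EFin \o f) ->
  (forall n, measurable (F n)) -> trivIset setT F ->
  \sum_(0 <= k < n) \int[m]_(t in F k) f t @[n --> \oo] -->
    \int[m]_(t in \bigcup_n F n) f t.
Proof.
move=> intf mF tF; have mUF := bigcupT_measurable F mF.
have fin A : measurable A -> (\int[m]_(t in A) (f t)%:E \is a fin_num)%E.
  by move=> mA; apply: integrable_fin_num => //; exact: integrableS intf.
have h : (\sum_(0 <= k < n) \int[m]_(t in F k) (f t)%:E)%E @[n --> \oo] -->
    (\int[m]_(t in \bigcup_n F n) (f t)%:E)%E.
  exact: (@charge_semi_sigma_additive _ _ _ (induced_charge intf) F mF tF mUF).
rewrite -(fineK (fin _ mUF)) in h.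
apply: (cvg_eq_near _ (fine_cvg h)); apply: nearW => n /=.
rewrite /Rintegral.
rewrite -[RHS]/(fine (\sum_(0 <= k < n) fine (\int[m]_(t in F k) (f t)%:E))%:E) -sumEFin.
by congr fine; apply: eq_bigr => k _; rewrite fineK//; exact: fin.
Qed.

Lemma cintegral_sigma_additive (m : {measure set R -> \bar R}) h (F : (set R)^nat) :
  cintegrable m setT h ->
  (forall n, measurable (F n)) -> trivIset setT F ->
  \sum_(0 <= k < n) cintegral m (F k) h @[n --> \oo] --> cintegral m (\bigcup_n F n) h.
Proof.
move=> [h1 h2] mF tF.
have c1 := Rintegral_sigma_additive h1 mF tF.
have c2 := Rintegral_sigma_additive h2 mF tF.
apply/cvgrPdist_lt => e e0.
have [e' ee'] : exists e', e = e'%:C%C by apply/complex_realP/gtr0_real.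
subst e; move: e0; rewrite ltcR => e0; have e20 : 0 < e' / 2 by rewrite divr_gt0.
move/cvgrPdist_lt: c1 => /(_ _ e20) c1; move/cvgrPdist_lt: c2 => /(_ _ e20) c2.
apply: filterS2 c1 c2 => n c1 c2.
apply: le_lt_trans (normc_le_ReIm _) _; rewrite ltcR (splitr e') ltrD//.
  apply: le_lt_trans c1; rewrite le_eqVlt; apply/orP; left; apply/eqP; congr `|_|.
  by rewrite raddfB raddf_sum.
apply: le_lt_trans c2; rewrite le_eqVlt; apply/orP; left; apply/eqP; congr `|_|.
by rewrite raddfB raddf_sum.
Qed.

Lemma entry_integral_sigma_additive h (F : (set R)^nat) k l :
  mintegrable Hmu setT h -> (forall n, measurable (F n)) -> trivIset setT F ->
  \sum_(0 <= i < n) entry_integral mu (F i) h k l @[n --> \oo] -->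
    entry_integral mu (\bigcup_n F n) h k l.
Proof.
move=> ih mF tF; rewrite (entry_integralE Hmu).
have e : (fun n => \sum_(0 <= i < n) entry_integral mu (F i) h k l) =
    fun n => 4^-1 * \sum_(m < 4) 'i ^+ m * \sum_(0 <= i < n)
      cintegral (form_measure Hmu (delta_mx l 0 + 'i ^+ m *: delta_mx k 0)) (F i) h.
  apply/funext => n; rewrite big_distrr/=.
  under eq_bigr do rewrite (entry_integralE Hmu) big_distrr/=.
  rewrite exchange_big/=; apply: eq_bigr => m _.
  by rewrite !big_distrr/=.
rewrite e; apply: cvgM; first exact: cvg_cst.
apply: cvg_big => [|m _]; first exact: add_continuous.
apply: cvgM; first exact: cvg_cst.
exact: cintegral_sigma_additive.
Qed.

Lemma matrix_measure_density : matrix_measure density_measure.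
Proof.
split.
- apply/matrixP => i j; rewrite formE mxE big1// => k _; rewrite big1// => l _.
  rewrite (entry_integralE Hmu) big1 ?mulr0// => m _.
  by rewrite cintegralE !Rintegral_set0 mulr0.
- by move=> A mA; exact: form_psd.
- move=> F mF tF; apply/cvg_mxP => i j; rewrite formE.
  rewrite (_ : (fun n => _) = fun n => \sum_k \sum_l
      \sum_(0 <= m < n) entry_integral mu (F m) (q k l i j) k l); last first.
    apply/funext => n; rewrite summxE; under eq_bigr do rewrite formE.
    by rewrite exchange_big/=; apply: eq_bigr => k _; rewrite exchange_big.
  apply: cvg_big => [|k _]; first exact: add_continuous.
  apply: cvg_big => [|l _]; first exact: add_continuous.
  apply: entry_integral_sigma_additive => //.
  by apply: mintegrable_tame => //; exact: tame_pair.
Qed.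

End Density.

(** * Integration against a density *)

Section ChangeOfMeasure.
Variables (R : realType) (d : nat) (mu : set R -> 'M[R[i]]_d.+1).
Hypothesis Hmu : matrix_measure mu.
Hypothesis Hmom : has_moments mu.
Local Notation C := R[i].
Local Notation M := 'M[R[i]]_d.+1.
Variable P : R -> M.
Hypothesis tP : mtame P.
Implicit Types (D A : set R) (h : R -> C) (v : 'cV[C]_d.+1).

Local Notation q i j k l := (fun t => (P t k i)^* * P t l j).
Local Notation rho := (density_measure mu P).
Local Notation Hrho := (matrix_measure_density Hmu Hmom tP).

Lemma measurable_step n h : measurable_fun setT (fun t => complex.Re (step n h t)) /\
  measurable_fun setT (fun t => complex.Im (step n h t)).
Proof.
have e : step n h = fun t => \sum_(j < cells n)
    ((complex.Re (h (node R n j)) * \1_(cell n j) t) +i*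
     (complex.Im (h (node R n j)) * \1_(cell n j) t))%C.
  apply/funext => t; apply: eq_bigr => j _.
  by case: (h _) => a b; apply/eqP; rewrite eq_complex /= !mulr0 subr0 add0r !eqxx.
rewrite e; split.
  rewrite (_ : (fun t => _) = fun t =>
      \sum_(j < cells n) complex.Re (h (node R n j)) * \1_(cell n j) t); last first.
    by apply/funext => t; rewrite raddf_sum.
  by apply: measurable_sum => j; apply: measurable_funM => //; apply: measurable_indic; exact: measurable_cell.
rewrite (_ : (fun t => _) = fun t =>
    \sum_(j < cells n) complex.Im (h (node R n j)) * \1_(cell n j) t); last first.
  by apply/funext => t; rewrite raddf_sum.
by apply: measurable_sum => j; apply: measurable_funM => //; apply: measurable_indic; exact: measurable_cell.
Qed.

Lemma measurable_Re_Im_mul (g h : R -> C) :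
  measurable_fun setT (fun t => complex.Re (g t)) ->
  measurable_fun setT (fun t => complex.Im (g t)) ->
  measurable_fun setT (fun t => complex.Re (h t)) ->
  measurable_fun setT (fun t => complex.Im (h t)) ->
  measurable_fun setT (fun t => complex.Re (g t * h t)) /\
  measurable_fun setT (fun t => complex.Im (g t * h t)).
Proof.
move=> g1 g2 h1 h2; split.
  have -> : (fun t => complex.Re (g t * h t)) = fun t =>
      complex.Re (g t) * complex.Re (h t) - complex.Im (g t) * complex.Im (h t).
    by apply/funext => t; case: (g t) (h t) => [? ?] [? ?].
  by apply: measurable_funB; exact: measurable_funM.
have -> : (fun t => complex.Im (g t * h t)) = fun t =>
    complex.Re (g t) * complex.Im (h t) + complex.Im (g t) * complex.Re (h t).
  by apply/funext => t; case: (g t) (h t) => [? ?] [? ?].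
by apply: measurable_funD; exact: measurable_funM.
Qed.

Variable h : R -> C.
Variable K : R.
Hypotheses (K0 : 0 <= K) (hK : forall t, `|h t| <= K%:C%C)
  (hL : forall s t, `|h t - h s| <= (K * `|t - s|)%:C%C).

Let th : tame h.
Proof. by apply: bounded_lipschitz_tame; exists K; split. Qed.

Lemma step_mul_error n t (g : R -> C) L N : 0 <= L -> growth L N g ->
  `|(h t - step n h t) * g t| <= (K * L / n.+1%:R * weight N.+1 t)%:C%C.
Proof.
move=> L0 gL; rewrite normrM.
have se : `|h t - step n h t| <= (K / n.+1%:R * weight 1 t)%:C%C.
  apply: step_error => // [s|s u _]; rewrite /weight expr0 mulr1; [exact: hK|exact: hL].
rewrite (le_trans (ler_pM _ _ se (gL t)))// -rmorphM lecR -[N.+1]/(1 + N)%N -weightD.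
by rewrite le_eqVlt; apply/orP; left; apply/eqP; ring.
Qed.

Lemma mintegrable_step_mul n (g : R -> C) : tame g ->
  mintegrable Hmu setT (fun t => step n h t * g t).
Proof.
move=> tg; have [L [N [L0 gL _]]] := tg.
have [m1 m2] := measurable_step n h; have [m3 m4] := tame_measurable tg.
have [m5 m6] := measurable_Re_Im_mul m1 m2 m3 m4.
apply: (@mintegrable_growth _ _ _ Hmu Hmom _ _ (K * L) N) => // t.
rewrite normrM (le_trans (ler_pM _ _ (_ : _ <= K%:C%C) (gL t)))//.
  by have [[s -> _]|[-> _]] := step_cases n h t; rewrite ?normr0 ?ler0c.
by rewrite -rmorphM mulrA.
Qed.

Lemma form_step n k l : riemann_sum rho n setT h k l =
  \sum_i \sum_j entry_integral mu setT (fun t => step n h t * q k l i j t) i j.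
Proof.
rewrite /riemann_sum.
under eq_bigr => c _ do rewrite setIT /density_measure formE big_distrr/=.
rewrite exchange_big/=; apply: eq_bigr => i _.
under eq_bigr => c _ do rewrite big_distrr/=.
rewrite exchange_big/=; apply: eq_bigr => j _.
have tq : tame (q k l i j) by exact: tame_pair.
have ic (c : 'I_(cells n)) : mintegrable Hmu setT
    (fun t => (\1_(cell n c) t)%:C%C * q k l i j t).
  have [m3 m4] := tame_measurable tq; have [L [N [L0 gL _]]] := tq.
  have mi : measurable_fun setT (fun t : R => complex.Re ((\1_(cell n c) t)%:C%C : C)).
    by apply: measurable_indic; exact: measurable_cell.
  have mi2 : measurable_fun setT (fun t : R => complex.Im ((\1_(cell n c) t)%:C%C : C)) by [].
  have [m5 m6] := measurable_Re_Im_mul mi mi2 m3 m4.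
  apply: (mintegrable_growth Hmu Hmom measurableT m5 m6 (_ : growth L N _)) => t.
  rewrite normrM (le_trans _ (gL t))// ler_piMl// indicE.
  by case: (_ \in _); rewrite ?normr1 ?normr0.
under eq_bigr => c _ do rewrite (entry_integral_restrict Hmu)
  -(entry_integralZ measurableT _ _ _ (ic c)).
rewrite -(@entry_integral_sum _ _ _ Hmu _ measurableT); last first.
  by move=> c _; apply: mintegrableZ.
apply: (eq_entry_integral Hmu) => t _; rewrite /step big_distrl/=.
by apply: eq_bigr => c _; rewrite mulrA.
Qed.

(** The step functions of h are integrated against the density cell by cell. *)
Lemma form_riemann k l : exists2 c : R, 0 <= c & forall n,
  `|form mu setT P (fun t => h t *: P t) k l - riemann_sum rho n setT h k l|
    <= (c / n.+1%:R)%:C%C.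
Proof.
have tq i j : tame (q k l i j) by exact: tame_pair.
have hb i j : exists2 c : R, 0 <= c & forall n,
    `|entry_integral mu setT (fun t => (h t - step n h t) * q k l i j t) i j|
      <= (c / n.+1%:R)%:C%C.
  have [L [N [L0 gL _]]] := tq i j.
  exists (K * L * mass Hmu setT (weight N.+1) i j).
    by rewrite !mulr_ge0// mass_ge0// => t; exact: weight_ge0.
  move=> n; rewrite [X in _ <= X%:C%C]mulrAC.
  apply: (@norm_entry_integral_growth _ _ _ Hmu Hmom _ _ (K * L / n.+1%:R) N.+1 i j measurableT) => //.
  - by rewrite !mulr_ge0.
  - have -> : (fun t => (h t - step n h t) * q k l i j t) =
        fun t => h t * q k l i j t + -1 * (step n h t * q k l i j t).
      by apply/funext => t; ring.
    apply: (mintegrableD measurableT).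
      by apply: (mintegrable_tame Hmu Hmom measurableT); exact: tameM th (tq i j).
    by apply: (mintegrableZ measurableT); exact: mintegrable_step_mul.
  - by move=> t _; exact: (step_mul_error n t L0 gL).
exists (\sum_i \sum_j sval (cid2 (hb i j))).
  by apply: sumr_ge0 => i _; apply: sumr_ge0 => j _; case: cid2.
move=> n; rewrite formE form_step -sumrB (le_trans (ler_norm_sum _ _ _))//.
rewrite big_distrl/= (rmorph_sum (real_complex R)); apply: ler_sum => i _.
rewrite -sumrB (le_trans (ler_norm_sum _ _ _))//.
rewrite big_distrl/= (rmorph_sum (real_complex R)); apply: ler_sum => j _.
case: cid2 => c c0 /= /(_ n); congr (`| _ | <= _).
have i1 : mintegrable Hmu setT (fun t => h t * q k l i j t).
  by apply: (mintegrable_tame Hmu Hmom measurableT); exact: tameM th (tq i j).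
have i2 := mintegrable_step_mul n (tq i j).
rewrite -[X in _ - X]mul1r -mulNr -(entry_integralZ measurableT _ _ _ i2).
rewrite -[X in X + _](_ : entry_integral mu setT (fun t => h t * q k l i j t) i j = _).
  rewrite -(entry_integralD measurableT _ _ i1); last exact: (mintegrableZ measurableT).
  by apply: (eq_entry_integral Hmu) => t _; ring.
by apply: (eq_entry_integral Hmu) => t _; rewrite mxE; ring.
Qed.

Definition tail n : set R := ~` `]- n.+1%:R, n.+1%:R[%classic.

Lemma measurable_tail n : measurable (tail n).
Proof. by apply: measurableC; exact: measurable_itv. Qed.

Lemma tailE n t : tail n t <-> n.+1%:R <= `|t|.
Proof.
rewrite /tail/= in_itv/= -ltr_norml; split => [/negP|]; rewrite leNgt//.
by move=> /negP.
Qed.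

(** Off the interval, 1 + t^2 is larger than n + 1: moments of mu higher by two than
    those of the density control the tails. *)
Lemma density_tail v : exists2 c : R, 0 <= c & forall n,
  fine (form_measure Hrho v (tail n)) <= c / n.+1%:R.
Proof.
have tq i j k l : tame (q i j k l) by exact: tame_pair.
have hb i j k l : exists2 c : R, 0 <= c & forall n,
    `|entry_integral mu (tail n) (q i j k l) k l| <= (c / n.+1%:R)%:C%C.
  have [L [N [L0 gL _]]] := tq i j k l.
  exists (L * mass Hmu setT (weight N.+1) k l).
    by rewrite !mulr_ge0// mass_ge0// => t; exact: weight_ge0.
  move=> n; rewrite [X in _ <= X%:C%C]mulrAC.
  apply: (@norm_entry_integral_growth _ _ _ Hmu Hmom _ _ (L / n.+1%:R) N.+1 k l (measurable_tail n)) => //.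
  - by rewrite mulr_ge0.
  - by apply: (mintegrable_tame Hmu Hmom) => //; exact: measurable_tail.
  move=> t /tailE nt; rewrite (le_trans (gL t))// lecR -!mulrA ler_wpM2l// [leRHS]mulrC.
  rewrite ler_pdivlMr ?ltr0n// (_ : weight N.+1 t = weight N t * (1 + t ^+ 2)); last first.
    by rewrite /weight exprSr.
  rewrite ler_wpM2l ?weight_ge0// -real_normK ?num_real//.
  have n1 : 1 <= n.+1%:R :> R by rewrite ler1n.
  by nra.
pose w i j : R := cmod ((v i 0)^* * v j 0).
have w0 i j : 0 <= w i j by exact: cmod_ge0.
exists (\sum_i \sum_j w i j * \sum_k \sum_l sval (cid2 (hb i j k l))).
  apply: sumr_ge0 => i _; apply: sumr_ge0 => j _; apply: mulr_ge0 => //.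
  by apply: sumr_ge0 => k _; apply: sumr_ge0 => l _; case: cid2.
move=> n; rewrite form_measureE/=; last exact: measurable_tail.
rewrite -lecR (le_trans _ (_ : `|qform (rho (tail n)) v| <= _))//.
  by rewrite (le_trans _ (normc_ge_Re _))// lecR ler_norm.
rewrite qform_sesqui sesquiE (le_trans (ler_norm_sum _ _ _))//.
rewrite big_distrl/= (rmorph_sum (real_complex R)); apply: ler_sum => i _.
rewrite (le_trans (ler_norm_sum _ _ _))//.
rewrite big_distrl/= (rmorph_sum (real_complex R)); apply: ler_sum => j _.
rewrite normrM -mulrA (rmorphM (real_complex R)) /= /w cmodE ler_wpM2l// /density_measure formE.
rewrite (le_trans (ler_norm_sum _ _ _))//.
rewrite big_distrl/= (rmorph_sum (real_complex R)); apply: ler_sum => k _.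
rewrite (le_trans (ler_norm_sum _ _ _))//.
rewrite big_distrl/= (rmorph_sum (real_complex R)); apply: ler_sum => l _.
by case: cid2 => c c0 /= /(_ n).
Qed.

Lemma form_measure_density_integrable v (g : R -> R) L : measurable_fun setT g ->
  (forall t, `|g t| <= L) -> (form_measure Hrho v).-integrable setT (EFin \o g).
Proof.
move=> mg gL; have L0 : 0 <= L by apply: le_trans (gL 0).
have i1 : (form_measure Hrho v).-integrable setT (EFin \o cst L).
  apply/integrableP; split; first exact/measurable_EFinP.
  under eq_integral do rewrite /=.
  rewrite integral_cst//= lte_mul_pinfty ?lee_fin//.
  exact: form_measure_fin.
apply: (le_integrable measurableT _ _ i1); first exact/measurable_EFinP.
by move=> t _ /=; rewrite lee_fin (le_trans (gL t))// ler_norm.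
Qed.

Lemma density_riemann k l : exists2 c : R, 0 <= c & forall n,
  `|entry_integral rho setT h k l - riemann_sum rho n setT h k l| <= (c / n.+1%:R)%:C%C.
Proof.
pose vm (m : 'I_4) : 'cV[C]_d.+1 := delta_mx l 0 + 'i ^+ m *: delta_mx k 0.
pose g n (t : R) : R := K / n.+1%:R + K * \1_(tail n) t.
have mg n : measurable_fun setT (g n).
  apply: measurable_funD => //; apply: measurable_funM => //.
  by apply: measurable_indic; exact: measurable_tail.
have gb n t : `|g n t| <= K + K.
  rewrite (le_trans (ler_normD _ _))// lerD// ger0_norm// ?mulr_ge0//.
    by rewrite ler_piMr// invf_le1// ler1n.
  by rewrite ler_piMr// indicE lern1 leq_b1.
have ig n v : (form_measure Hrho v).-integrable setT (EFin \o g n).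
  exact: form_measure_density_integrable (mg n) (gb n).
have ih : mintegrable Hrho setT h.
  have [m1 m2] := tame_measurable th.
  move=> v; split; apply: (form_measure_density_integrable v _ (_ : forall t, _ <= K)) => // t.
    by rewrite -lecR (le_trans (normc_ge_Re _)).
  by rewrite -lecR (le_trans (normr_Im_le _)).
have hc m := density_tail (vm m).
exists (\sum_(m < 4) (K * fine (form_measure Hrho (vm m) setT) + K * sval (cid2 (hc m)))).
  apply: sumr_ge0 => m _; rewrite addr_ge0// mulr_ge0 ?fine_ge0//.
  by case: cid2.
move=> n; rewrite (le_trans (riemann_sum_error k l measurableT ih (ig n) _))//.
  move=> t _; have [[s -> ts]|[-> nt]] := step_cases n h t.
    rewrite (le_trans (hL s t))// lecR /g -[leLHS]addr0 lerD//; last by rewrite mulr_ge0.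
    by rewrite ler_wpM2l.
  rewrite subr0 (le_trans (hK t))// lecR /g indicE mem_set ?mulr1; last exact/tailE.
  by rewrite lerDr divr_ge0.
rewrite lecR /mass big_distrl/=; apply: ler_sum => m _; rewrite -/(vm m).
have it : (form_measure Hrho (vm m)).-integrable setT (EFin \o \1_(tail n)).
  apply: (@form_measure_density_integrable _ _ 1).
    by apply: measurable_indic; exact: measurable_tail.
  by move=> t; rewrite indicE; case: (_ \in _); rewrite ?normr1 ?normr0.
rewrite /g RintegralD//; last 2 first.
- apply: (@form_measure_density_integrable _ _ (K / n.+1%:R)) => // t.
  by rewrite ger0_norm ?divr_ge0.
- exact: (@integrableZl _ _ _ _ _ measurableT K (EFin \o \1_(tail n))).
rewrite Rintegral_cst// RintegralZl// mulrDl lerD//; first by rewrite mulrAC.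
rewrite -mulrA ler_wpM2l// /Rintegral integral_indic ?setIT//; last exact: measurable_tail.
by case: cid2.
Qed.

(** Both sides are limits of the same Riemann sums. *)
Lemma scalar_integral_density :
  scalar_integral rho setT h = form mu setT P (fun t => h t *: P t).
Proof.
apply/matrixP => k l; rewrite [LHS]mxE.
have [c1 c10 h1] := form_riemann k l; have [c2 c20 h2] := density_riemann k l.
apply: (@eq_of_inv_bound _ _ _ (c2 + c1)) => [|n]; first exact: addr_ge0.
rewrite (_ : _ - _ = (entry_integral rho setT h k l - riemann_sum rho n setT h k l) -
  (form mu setT P (fun t => h t *: P t) k l - riemann_sum rho n setT h k l)).
  by rewrite (le_trans (ler_normB _ _))// mulrDl rmorphD lerD.
by rewrite opprB addrA subrK.
Qed.

End ChangeOfMeasure.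

(** * Matrix polynomials and the resolvent form *)

Section MatrixPolynomials.
Variables (R : realType) (d : nat).
Local Notation C := R[i].
Local Notation M := 'M[R[i]]_d.+1.
Implicit Types (q : {poly M}) (z : C) (c : M).

Lemma mulr_scalar_mx (A : M) z : A * z%:M = z *: A.
Proof. exact: mul_mx_scalar. Qed.

Lemma mul_scalar_mxr (A : M) z : z%:M * A = z *: A.
Proof. exact: mul_scalar_mx. Qed.

Lemma mxevalD q q' z : mxeval (q + q') z = mxeval q z + mxeval q' z.
Proof. exact: hornerD. Qed.

Lemma mxeval0 z : mxeval (0 : {poly M}) z = 0.
Proof. exact: horner0. Qed.

Lemma mxeval1 z : mxeval (1 : {poly M}) z = 1.
Proof. exact: hornerC. Qed.

Lemma mxevalMC q c z : mxeval (q * c%:P) z = mxeval q z * c.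
Proof.
rewrite /mxeval hornerM_comm ?hornerC//.
by rewrite /comm_poly hornerC mulr_scalar_mx mul_scalar_mxr.
Qed.

Lemma mxevalXM q z : mxeval ('X * q) z = z *: mxeval q z.
Proof. by rewrite /mxeval -commr_polyX hornerMX mulr_scalar_mx. Qed.

End MatrixPolynomials.

Section ResolventForm.
Variables (R : realType) (d : nat) (mu : set R -> 'M[R[i]]_d.+1).
Hypothesis Hmu : matrix_measure mu.
Hypothesis Hmom : has_moments mu.
Local Notation C := R[i].
Local Notation M := 'M[R[i]]_d.+1.
Implicit Types (q : {poly M}) (z : C) (c : M).

Local Notation ev q := (fun t : R => mxeval q t%:C%C).
Local Notation formT := (form mu setT).
Local Notation adjT := (form_adj Hmu Hmom measurableT).

Lemma mtame_resolvent z q : z \isn't Num.real ->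
  mtame (fun t => resolvent z t *: mxeval q t%:C%C).
Proof. by move=> zr; apply: mtameZ; [exact: tame_resolvent|exact: mtame_mxeval]. Qed.

Lemma innerE q q' : inner mu q q' = formT (ev q) (ev q').
Proof. by []. Qed.

Lemma innerDr q q1 q2 : inner mu q (q1 + q2) = inner mu q q1 + inner mu q q2.
Proof.
rewrite !innerE -(formDr Hmu Hmom measurableT); try exact: mtame_mxeval.
by apply: eq_form => // t; rewrite mxevalD.
Qed.

Lemma innerMr q q' c : inner mu q (q' * c%:P) = inner mu q q' * c.
Proof.
rewrite !innerE -(formMr Hmu Hmom measurableT); try exact: mtame_mxeval.
by apply: eq_form => // t; rewrite mxevalMC.
Qed.

(** The matrix entry, between q and q', of the inverse of 1 - zT, where T is the
    multiplication by t in the space of square integrable functions. *)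
Definition green z q q' : M := formT (ev q) (fun t => resolvent z t *: mxeval q' t%:C%C).

(** The Gram matrix of q / (1 - zt) and q' / (1 - zt). *)
Definition green_norm z q q' : M :=
  formT (fun t => resolvent z t *: mxeval q t%:C%C)
        (fun t => resolvent z t *: mxeval q' t%:C%C).

Variable z : C.
Hypothesis zr : z \isn't Num.real.

Let zJr : z^* \isn't Num.real.
Proof. by rewrite nonreal_conj. Qed.

Lemma green_adj q q' : (green z q q') ^t* = green z^* q' q.
Proof.
rewrite /green adjT; [|exact: mtame_mxeval|exact: mtame_resolvent].
rewrite (form_kernel Hmu); apply: eq_form => // t.
by rewrite conj_resolvent conjCK.
Qed.

Lemma greenDr q q1 q2 : green z q (q1 + q2) = green z q q1 + green z q q2.
Proof.
rewrite /green -(formDr Hmu Hmom measurableT);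
  try solve [exact: mtame_mxeval | exact: mtame_resolvent].
by apply: eq_form => // t; rewrite mxevalD scalerDr.
Qed.

Lemma greenMr q q' c : green z q (q' * c%:P) = green z q q' * c.
Proof.
rewrite /green -(formMr Hmu Hmom measurableT);
  try solve [exact: mtame_mxeval | exact: mtame_resolvent].
by apply: eq_form => // t; rewrite mxevalMC scalerAl.
Qed.

Lemma greenDl q q1 q2 : green z (q1 + q2) q = green z q1 q + green z q2 q.
Proof.
rewrite /green -(formDl Hmu Hmom measurableT);
  try solve [exact: mtame_mxeval | exact: mtame_resolvent].
by apply: eq_form => // t; rewrite mxevalD.
Qed.

Lemma greenMl q q' c : green z (q * c%:P) q' = c ^t* * green z q q'.
Proof.
rewrite /green -(formMl Hmu Hmom measurableT);
  try solve [exact: mtame_mxeval | exact: mtame_resolvent].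
by apply: eq_form => // t; rewrite mxevalMC.
Qed.

Lemma green0l q : green z 0 q = 0.
Proof. by rewrite -(mul0r 0%:P) greenMl adjmx0 mul0r. Qed.

Lemma green0r q : green z q 0 = 0.
Proof. by rewrite -(mul0r 0%:P) greenMr mulr0. Qed.

(** t / (1 - zt) = (1 / (1 - zt) - 1) / z. *)
Lemma greenXr q q' : green z q ('X * q') = z^-1 *: (green z q q' - inner mu q q').
Proof.
have tq := mtame_mxeval q; have tq' := mtame_mxeval q'; have tr := mtame_resolvent q' zr.
rewrite /green innerE -(formBr Hmu Hmom measurableT tq tr tq').
rewrite -(form_scaler Hmu Hmom measurableT _ tq); last exact: mtameB.
apply: eq_form => // t.
by rewrite mxevalXM scalerA mulrC mul_resolvent// -scalerA scalerBl scale1r.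
Qed.

Lemma greenXl q q' : green z ('X * q) q' = green z q ('X * q').
Proof.
rewrite /green.
transitivity (formT (ev q) (fun t => t%:C%C *: (resolvent z t *: mxeval q' t%:C%C))).
  rewrite [RHS](form_kernel Hmu); apply: eq_form => // t.
  by rewrite mxevalXM [_^*]conjc_real.
by apply: eq_form => // t; rewrite mxevalXM !scalerA mulrC.
Qed.

(** The resolvent identity, integrated. *)
Lemma green_imag q q' :
  z *: green z q q' - (z *: green z q' q) ^t* = (z - z^*) *: green_norm z q q'.
Proof.
have tq := mtame_mxeval q; have tr := mtame_resolvent q' zr.
have trJ := mtame_resolvent q' zJr.
rewrite adjmxZ green_adj /green /green_norm.
rewrite -(form_scaler Hmu Hmom measurableT z tq tr).
rewrite -(form_scaler Hmu Hmom measurableT z^* tq trJ).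
have tz := mtameZ (tame_cst z) tr; have tzJ := mtameZ (tame_cst z^*) trJ.
rewrite -(formBr Hmu Hmom measurableT tq tz tzJ).
have tr' := mtame_resolvent q zr.
rewrite -(form_scaler Hmu Hmom measurableT (z - z^*) tr' tr).
transitivity (formT (fun t => (resolvent z^* t)^* *: mxeval q t%:C%C)
  (fun t => (z - z^*) *: (resolvent z t *: mxeval q' t%:C%C))); last first.
  by apply: eq_form => // t; rewrite conj_resolvent conjCK.
rewrite -(form_kernel Hmu); apply: eq_form => // t; rewrite !scalerA -scalerBl; congr (_ *: _).
have := resolvent_den_neq0 t zr; have := resolvent_den_neq0 t zJr.
by rewrite /resolvent => d1 d2; field; rewrite d1 d2.
Qed.

Lemma green_norm_psd q : psdmx (green_norm z q q).
Proof. by apply: (form_psd Hmu Hmom measurableT); exact: mtame_resolvent. Qed.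

(** If q v / (1 - zt) is a null vector, then so is its product q v by 1 - zt. *)
Lemma green_norm_null q q' (v : 'cV[C]_d.+1) :
  qform (green_norm z q q) v = 0 -> inner mu q' q *m v = 0.
Proof.
move=> /(form_null Hmu Hmom (P := fun t => (1 - z^* * t%:C%C) *: mxeval q' t%:C%C)).
have t1 : mtame (fun t => (1 - z^* * t%:C%C) *: mxeval q' t%:C%C).
  apply: mtameZ; last exact: mtame_mxeval.
  apply: tameD; first exact: tame_cst.
  by under eq_fun do rewrite -mulN1r; do 2 apply: tameZ; exact: tame_id.
move=> /(_ t1 (mtame_resolvent _ zr)) <-; congr (_ *m v).
transitivity (formT (fun t => (1 - z * t%:C%C)^* *: mxeval q' t%:C%C)
  (fun t => resolvent z t *: mxeval q t%:C%C)); last first.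
  by apply: eq_form => // t; rewrite rmorphB rmorph1 rmorphM/= [(t%:C%C)^*]conjc_real.
rewrite -(form_kernel Hmu); apply: eq_form => // t.
by rewrite scalerA /resolvent divff ?scale1r// resolvent_den_neq0.
Qed.

End ResolventForm.

(** * Orthogonal polynomials and functions of the second kind *)

Section NoncommutativeIdentities.
Variable U : unitRingType.
Implicit Types x y u a b : U.

Lemma mulVr_recurrence0 x y a b : x \is a GRing.unit ->
  x^-1 * (y * a + x * b) = b + x^-1 * y * a.
Proof. by move=> ux; rewrite mulrDr !mulrA mulVr// mul1r addrC. Qed.

Lemma mulVr_recurrence x y u a a' b : y \is a GRing.unit ->
  y^-1 * (u * a' + y * b + x * a) = b + y^-1 * u * a' + y^-1 * x * a.
Proof.
by move=> uy; rewrite !mulrDr !mulrA mulVr// mul1r [y^-1 * u * a' + b]addrC.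
Qed.

Lemma continued_fraction_step x y a :
  x \is a GRing.unit -> y \is a GRing.unit -> a \is a GRing.unit ->
  a * (x^-1 * y * a)^-1 * a = y^-1 * x * a.
Proof.
move=> ux uy ua; rewrite invrM ?unitrMr ?unitrV// invrM ?unitrV// invrK.
by rewrite !mulrA mulrV// mul1r.
Qed.

End NoncommutativeIdentities.

Lemma imag_part_null (R : realType) n (A N : 'M[R[i]]_n) (c z : R[i]) v :
  z *: A - (z *: A) ^t* = c *: N -> A *m v = 0 -> c != 0 -> qform N v = 0.
Proof.
move=> e Av c0; have := congr1 (fun X => sesqui X v v) e.
have A0 : sesqui A v v = 0 by rewrite /sesqui -mulmxA Av mulmx0 mxE.
rewrite /= sesquiDm sesquiNm -conj_sesqui !sesquiZm A0 mulr0 conjC0 subrr.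
by move=> /esym/eqP; rewrite mulf_eq0 (negbTE c0) => /eqP.
Qed.

(* Below, these forms are used through their algebraic laws; only the expansions in z go
   back to the integrals. *)
Opaque form green green_norm inner sesqui.

Section OrthogonalPolynomials.
Variables (R : realType) (d : nat) (mu : set R -> 'M[R[i]]_d.+1).
Variables (p : nat -> {poly 'M[R[i]]_d.+1}) (a b : nat -> 'M[R[i]]_d.+1).
Local Notation C := R[i].
Local Notation M := 'M[R[i]]_d.+1.
Hypothesis Hmu : matrix_measure mu.
Hypothesis Hp : orthonormal_polynomials mu p.
Hypothesis p0 : p 0%N = 1.
Hypothesis prec : forall n, 'X * p n =
  p n.+1 * (a n)%:P + p n * (b n)%:P + preceding p n * (preceding a n)%:P.
Hypothesis bH : forall n, b n = b n ^t*.
Hypothesis aP : forall n, pdmx (a n).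
Implicit Types (z : C) (n m k : nat).

Let Hmom : has_moments mu. Proof. by case: Hp. Qed.

Let orth n m : inner mu (p n) (p m) = (n == m)%:R.
Proof. by case: Hp. Qed.

Lemma jacobi_a_unit n : a n \is a GRing.unit.
Proof. exact: pdmx_unit. Qed.

Lemma jacobi_a_herm n : (a n) ^t* = a n.
Proof. exact: pdmx_herm. Qed.

Lemma preceding_a_herm n : (preceding a n) ^t* = preceding a n.
Proof. by case: n => [|n]; [exact: adjmx0|exact: jacobi_a_herm]. Qed.

Lemma recurrence_eval n z : z *: mxeval (p n) z = mxeval (p n.+1) z * a n +
  mxeval (p n) z * b n + mxeval (preceding p n) z * preceding a n.
Proof. by rewrite -mxevalXM prec !mxevalD !mxevalMC. Qed.

(** The solution of the three-term recurrence at 1/z that is square summable; it starts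
    at the transform of mu itself. *)
Definition second_kind : C -> nat -> M := locked (fun z n => green mu z 1 (p n)).

Lemma second_kindE z n : second_kind z n = green mu z 1 (p n).
Proof. by rewrite /second_kind -lock. Qed.

Section FixedPoint.
Variable z : C.
Hypothesis zr : z \isn't Num.real.
Let zJr : z^* \isn't Num.real. Proof. by rewrite nonreal_conj. Qed.
Let z0 : z != 0. Proof. exact: nonreal_neq0. Qed.

Local Notation G := (green mu z).
Local Notation s := (second_kind z).

Lemma green_recr q n : z^-1 *: (G q (p n) - inner mu q (p n)) =
  G q (p n.+1) * a n + G q (p n) * b n + G q (preceding p n) * preceding a n.
Proof. by rewrite -greenXr// prec !greenDr// !greenMr. Qed.

Lemma green_recl q n : G ('X * p n) q =
  a n * G (p n.+1) q + b n * G (p n) q + preceding a n * G (preceding p n) q.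
Proof.
by rewrite prec !greenDl// !greenMl// jacobi_a_herm -bH preceding_a_herm.
Qed.

(** Both sides satisfy the same recurrence in m as long as m stays below n. *)
Lemma green_lower m n : (m <= n)%N ->
  G (p m) (p n) = (mxeval (p m) (z^-1)^*) ^t* * s n.
Proof.
suff : ((m <= n)%N -> G (p m) (p n) = (mxeval (p m) (z^-1)^*) ^t* * s n) /\
    ((m <= n)%N -> G (preceding p m) (p n) =
       (mxeval (preceding p m) (z^-1)^*) ^t* * s n) by case.
elim: m => [|m [IH1 IH2]]; split=> mn.
- by rewrite p0 mxeval1 adjr1 mul1r second_kindE.
- by rewrite green0l// mxeval0 adjmx0 mul0r.
- have mn' := ltnW mn.
  apply: (mulrI (jacobi_a_unit m)).
  have := green_recl (p n) m; rewrite greenXl// greenXr// orth (ltn_eqF mn) subr0.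
  rewrite (IH1 mn') (IH2 mn') -addrA => /esym/(canRL (addrK _)) ->.
  have := congr1 (fun X : M => X ^t*) (recurrence_eval m (z^-1)^*).
  rewrite adjmxZ conjCK !adjmxD !adjrM jacobi_a_herm -bH preceding_a_herm.
  by rewrite scalerAl => ->; rewrite -addrA mulrDl !mulrDl !mulrA addrK.
- exact: IH1 (ltnW mn).
Qed.

Lemma second_kind_step n : z^-1 *: s n.+1 =
  s n.+2 * a n.+1 + s n.+1 * b n.+1 + s n * a n.
Proof.
by rewrite !second_kindE; have := green_recr 1 n.+1; rewrite -{2}p0 orth subr0.
Qed.

Lemma second_kind_step0 : z^-1 *: (s 0 - 1) = s 1 * a 0%N + s 0 * b 0%N.
Proof.
by rewrite !second_kindE; have := green_recr 1 0; rewrite -{2}p0 orth mulr0 addr0.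
Qed.

(** By green_imag, a vector v in the kernel makes p_n v / (1 - zt), hence p_n v, a null
    vector. *)
Lemma green_diag_unit n : G (p n) (p n) \is a GRing.unit.
Proof.
apply: unitr_mx_ker => v Gv.
suff : inner mu (p n) (p n) *m v = 0 by rewrite orth eqxx mul1mx.
apply: (green_norm_null Hmu Hmom zr).
apply: (imag_part_null (green_imag Hmu Hmom zr (p n) (p n)) Gv).
by rewrite subr_eq0 eq_sym -CrealE.
Qed.

Lemma green_diag n : G (p n) (p n) = (mxeval (p n) (z^-1)^*) ^t* * s n.
Proof. exact: green_lower. Qed.

Lemma second_kind_unit n : s n \is a GRing.unit.
Proof.
have := green_diag_unit n; rewrite green_diag -[X in is_true X]/(_ \in unitmx).
by rewrite unitmx_mul => /andP[].
Qed.

Lemma orthogonal_poly_unitJ n : mxeval (p n) (z^-1)^* \is a GRing.unit.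
Proof.
have := green_diag_unit n; rewrite green_diag -[X in is_true X]/(_ \in unitmx).
by rewrite unitmx_mul => /andP[+ _]; rewrite adjmx_unit.
Qed.

End FixedPoint.

Lemma orthogonal_poly_unit z n : z \isn't Num.real ->
  mxeval (p n) z^-1 \is a GRing.unit.
Proof.
move=> zr; have := @orthogonal_poly_unitJ z^* _ n; rewrite nonreal_conj => /(_ zr).
by rewrite fmorphV /= conjCK.
Qed.

(** This turns out to be the n-th Schur iterate of f: dividing the recurrence by s_n
    gives the Schur step. *)
Definition weyl n z : M :=
  b n + (second_kind z n)^-1 * second_kind z n.+1 * a n.

Section WeylFunctions.
Variable z : C.
Hypothesis zr : z \isn't Num.real.
Let zJr : z^* \isn't Num.real. Proof. by rewrite nonreal_conj. Qed.
Let z0 : z != 0. Proof. exact: nonreal_neq0. Qed.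
Local Notation G := (green mu z).
Local Notation s := (second_kind z).

Lemma weyl0 : weyl 0 z = z^-1 *: (1 - (s 0)^-1).
Proof.
have us := second_kind_unit zr 0.
rewrite /weyl -mulVr_recurrence0// -second_kind_step0// -scalerAr.
by rewrite mulrBr mulVr// mulr1.
Qed.

Lemma unitr_mulmx (A B : M) :
  (A * B \is a GRing.unit) = (A \is a GRing.unit) && (B \is a GRing.unit).
Proof. exact: unitmx_mul. Qed.

Lemma weyl_sub n : weyl n z - b n = (s n)^-1 * s n.+1 * a n.
Proof. by rewrite /weyl addrC addKr. Qed.

Lemma weylS n : weyl n.+1 z = z^-1%:M - a n * (weyl n z - b n)^-1 * a n.
Proof.
have us k : s k \is a GRing.unit by exact: second_kind_unit.
have ua := jacobi_a_unit n.
rewrite weyl_sub continued_fraction_step//; apply/eqP; rewrite eq_sym subr_eq; apply/eqP.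
rewrite /weyl -mulVr_recurrence// -second_kind_step// -scalerAr mulVr//.
by rewrite scalemx1.
Qed.

Let phi n : M := weyl n z - b n.
Let H n : {poly M} := p n.+1 * (a n)%:P - p n * (phi n)%:P.

Let GH k n : (k <= n)%N -> G (p k) (H n) = 0.
Proof.
move=> kn; have us := second_kind_unit zr n.
rewrite /H -mulrN -polyCN greenDr// !greenMr// !green_lower ?(leqW kn)//.
by rewrite /phi weyl_sub mulrN -!mulrA (mulrA (s n)) mulrV// mul1r mulrA subrr.
Qed.

Let innerH n : inner mu (p n) (H n) = - phi n.
Proof.
rewrite /H -mulrN -polyCN (innerDr Hmu Hmom) !(innerMr Hmu Hmom) !orth eqxx.
by rewrite (ltn_eqF (ltnSn n)) mul0r mul1r add0r.
Qed.

Let GHH n : z *: G (H n) (H n) = phi n.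
Proof.
have GHS : G (H n) (H n) = a n * G (p n.+1) (H n).
  rewrite {1}/H -mulrN -polyCN greenDl// !greenMl// jacobi_a_herm.
  by rewrite (GH (leqnn n)) mulr0 addr0.
have e := green_recl zr (H n) n; rewrite (GH (leqnn n)) mulr0 addr0 in e.
have e0 : preceding a n * G (preceding p n) (H n) = 0.
  by case: n {GHS e} => [|n]; rewrite ?mul0r//= (GH (leqnSn n)) mulr0.
rewrite e0 addr0 -GHS greenXl// greenXr// (GH (leqnn n)) innerH sub0r opprK in e.
by rewrite -e scalerA mulfV// scale1r.
Qed.

(** The imaginary part of the n-th Weyl function is Im z times the squared norm of
    (p_(n+1) a_n - p_n (f_n(z) - b_n)) / (1 - z t). *)
Lemma weyl_imag n :
  weyl n z - (weyl n z) ^t* = (z - z^*) *: green_norm mu z (H n) (H n).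
Proof.
rewrite -(green_imag Hmu Hmom zr) GHH /phi adjmxB -bH opprB.
by rewrite addrA subrK.
Qed.

Lemma ImE_sub : z - z^* = 2 * 'i * 'Im z.
Proof.
rewrite ImE; have i2 : ('i : C) * 'i = -1 by rewrite -expr2 sqrCi.
have -> : 2 * 'i * ('i * (z^* - z) / 2) = ('i * 'i) * (z^* - z) :> C by field.
by rewrite i2 mulN1r opprB.
Qed.

Lemma weyl_mxIm n : mxIm (weyl n z) = 'Im z *: green_norm mu z (H n) (H n).
Proof.
rewrite /mxIm weyl_imag ImE_sub scalerA mulrA mulVf ?mul1r//.
by rewrite mulf_neq0 ?neq0Ci// pnatr_eq0.
Qed.

Let Im_neq0 : 'Im z != 0.
Proof. by rewrite -complexIm (inj_eq (@complexI R) _ 0) -nonreal_Im. Qed.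

Lemma weyl_psd n : psdmx (('Im z)^-1 *: mxIm (weyl n z)).
Proof.
by rewrite weyl_mxIm scalerA mulVf// scale1r; exact: green_norm_psd.
Qed.

Lemma weyl_nondegenerate n (v : 'cV[C]_d.+1) : mxIm (weyl n z) *m v = 0 -> v = 0.
Proof.
rewrite weyl_mxIm -scalemxAl => /eqP; rewrite scaler_eq0 (negbTE Im_neq0)/= => /eqP Nv.
have q0 : qform (green_norm mu z (H n) (H n)) v = 0.
  by rewrite /qform -mulmxA Nv mulmx0 mxE.
have := green_norm_null Hmu Hmom zr (p n.+1) q0.
rewrite /H -mulrN -polyCN (innerDr Hmu Hmom) !(innerMr Hmu Hmom) !orth eqxx.
rewrite [_ == n]eq_sym (ltn_eqF (ltnSn n)) mul0r mul1r addr0 => av.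
have ua := jacobi_a_unit n.
by rewrite -[v]mul1mx -[1%:M](mulVr ua) -[_ * a n]/(_ *m a n) -mulmxA av mulmx0.
Qed.

End WeylFunctions.
End OrthogonalPolynomials.

Transparent form green green_norm inner sesqui.

(** * Smoothness of resolvent integrals *)

Lemma has_slope_of_quadratic (R : realType) (d : nat) (T : Type) (F : set_system T)
    {FF : Filter F} (u : T -> R[i]) (G : T -> 'M[R[i]]_d.+1) (L D : 'M[R[i]]_d.+1) :
  u x @[x --> F] --> (0 : R[i]) -> (\forall x \near F, u x != 0) ->
  (forall i j, exists2 c : R, 0 <= c & \forall x \near F,
     `|(G x - L - u x *: D) i j| <= c%:C%C * `|u x| ^+ 2) ->
  has_slope F u G L D.
Proof.
move=> u0 un0 GL; apply/cvg_mxP => i j; have [c c0 Gc] := GL i j.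
apply/cvgrPdist_lt => e e0.
have c10 : 0 < (c + 1)%:C%C :> R[i] by rewrite ltcR ltr_wpDl.
move/cvgrPdist_lt: u0 => /(_ _ (divr_gt0 e0 c10)) u0.
apply: filterS3 u0 un0 Gc => x ux un Gx.
have -> : D i j - ((u x)^-1 *: (G x - L)) i j = - (u x)^-1 * (G x - L - u x *: D) i j.
  by rewrite !mxE; field.
rewrite normrM normrN normfV.
have nu : 0 < `|u x| by rewrite normr_gt0.
rewrite mulrC ltr_pdivrMr// (le_lt_trans Gx)//.
rewrite expr2 mulrA ltr_pM2r//; move: ux; rewrite sub0r normrN ltr_pdivlMr// => ux.
apply: le_lt_trans ux; rewrite mulrC ler_wpM2l// lecR lerDl//.
Qed.

Section ResolventIntegrals.
Variables (R : realType) (d : nat) (mu : set R -> 'M[R[i]]_d.+1).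
Hypothesis Hmu : matrix_measure mu.
Hypothesis Hmom : has_moments mu.
Local Notation C := R[i].
Local Notation M := 'M[R[i]]_d.+1.
Implicit Types (Q : R -> M) (z : C).
Local Notation formT := (form mu setT).

Lemma form1_bound Q i j : mtame Q -> exists2 c : R, 0 <= c & forall (e : R) (h : R -> C),
  0 <= e -> tame h -> (forall t, `|h t| <= (e * t ^+ 2)%:C%C) ->
  `|formT (fun=> 1) (fun t => h t *: Q t) i j| <= (c * e)%:C%C.
Proof.
move=> tQ.
have hb k l : exists2 c : R, 0 <= c & forall (e : R) (h : R -> C),
    0 <= e -> tame h -> (forall t, `|h t| <= (e * t ^+ 2)%:C%C) ->
    `|entry_integral mu setT (fun t => ((1 : M) k i)^* * (h t *: Q t) l j) k l|
      <= (c * e)%:C%C.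
  have [K [N [K0 QK _]]] := tQ l j.
  exists (K * mass Hmu setT (weight N.+1) k l).
    by rewrite mulr_ge0// mass_ge0// => t; exact: weight_ge0.
  move=> e h e0 th he; rewrite mulrAC.
  apply: (@norm_entry_integral_growth _ _ _ Hmu Hmom _ _ (K * e) N.+1 k l measurableT) => //.
  - by rewrite mulr_ge0.
  - apply: (mintegrable_tame Hmu Hmom measurableT).
    by apply: (tame_pair (P := fun=> 1)); [exact: mtame_cst|exact: mtameZ].
  move=> t _; rewrite (_ : ((1 : M) k i)^* = (k == i)%:R); last by rewrite mxE conjC_nat.
  rewrite normrM.
  rewrite (le_trans (ler_piMl _ _))//; first by rewrite ger0_norm// lern1 leq_b1.
  rewrite mxE normrM (le_trans (ler_pM _ _ (he t) (QK t)))//.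
  rewrite -rmorphM lecR (_ : weight N.+1 t = weight N t * (1 + t ^+ 2)); last first.
    by rewrite /weight exprSr.
  rewrite -subr_ge0 (_ : _ - _ = K * e * weight N t); last by ring.
  by rewrite !mulr_ge0// weight_ge0.
exists (\sum_k \sum_l sval (cid2 (hb k l))).
  by apply: sumr_ge0 => k _; apply: sumr_ge0 => l _; case: cid2.
move=> e h e0 th he; rewrite formE (le_trans (ler_norm_sum _ _ _))//.
rewrite big_distrl/= (rmorph_sum (real_complex R)); apply: ler_sum => k _.
rewrite (le_trans (ler_norm_sum _ _ _))//.
rewrite big_distrl/= (rmorph_sum (real_complex R)); apply: ler_sum => l _.
by case: cid2 => c c0 /= /(_ e h e0 th he).
Qed.

(** Derivatives in z raise the power of the resolvent, hence the exponent j. *)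
Definition theta Q (j : nat) z : M :=
  formT (fun=> 1) (fun t => resolvent z t ^+ j *: Q t).

Lemma mtame_theta Q j z : mtame Q -> tame (resolvent z) ->
  mtame (fun t => resolvent z t ^+ j *: Q t).
Proof. by move=> tQ tr; apply: mtameZ => //; exact: tameX. Qed.

Lemma theta_expansion Q j (B : R) i l : mtame Q -> 0 <= B ->
  exists2 c : R, 0 <= c & forall z0 z,
    tame (resolvent z0) -> tame (resolvent z) ->
    (forall t : R, [/\ 1 - z0 * t%:C%C != 0, 1 - z * t%:C%C != 0,
       `|resolvent z0 t| <= B%:C%C & `|resolvent z t| <= B%:C%C]) ->
    `|(theta Q j z - theta Q j z0 - (z - z0) *:
        (j%:R *: theta (fun t => t%:C%C *: Q t) j.+1 z0)) i l| <= c%:C%C * `|z - z0| ^+ 2.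
Proof.
move=> tQ B0; have [c c0 hc] := resolvent_expansion j B0.
have [K K0 hK] := form1_bound i l tQ.
exists (K * c) => [|z0 z tr0 tr rB]; first exact: mulr_ge0.
have t1 : mtame (fun=> 1 : M) by exact: mtame_cst.
have ttQ : mtame (fun t => t%:C%C *: Q t) by apply: mtameZ => //; exact: tame_id.
pose E t := resolvent z t ^+ j - resolvent z0 t ^+ j
      - (z - z0) * (j%:R * t%:C%C * resolvent z0 t ^+ j.+1).
have tE : tame E.
  rewrite /E; apply: tameD; last first.
    under eq_fun do rewrite -mulrN -mulN1r mulrA.
    apply: tameM; first exact: tame_cst.
    apply: tameM; last exact: tameX.
    by apply: tameM; [exact: tame_cst|exact: tame_id].
  apply: tameD; first exact: tameX.
  by under eq_fun do rewrite -mulN1r; apply: tameZ; exact: tameX.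
have -> : theta Q j z - theta Q j z0 - (z - z0) *:
        (j%:R *: theta (fun t => t%:C%C *: Q t) j.+1 z0) =
    formT (fun=> 1) (fun t => E t *: Q t).
  rewrite /theta scalerA -(formBr Hmu Hmom measurableT t1); try exact: mtame_theta.
  have m1 := mtame_theta j.+1 ttQ tr0.
  rewrite -(form_scaler Hmu Hmom measurableT _ t1 m1).
  rewrite -(formBr Hmu Hmom measurableT t1); last first.
  - by apply: mtameZ => //; exact: tame_cst.
  - by apply: mtameB; exact: mtame_theta.
  apply: eq_form => // t; rewrite !scalerA -!scalerBl /E; congr (_ *: _); ring.
have z2 : exists x : R, `|z - z0| ^+ 2 = x%:C%C /\ 0 <= x.
  by exists (cmod (z - z0) ^+ 2); rewrite rmorphXn/= cmodE sqr_ge0.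
have [x [ex x0]] := z2.
rewrite ex -rmorphM -mulrA; apply: hK => // [|t]; first exact: mulr_ge0.
have [d0 d1 r0 r1] := rB t; rewrite (le_trans (hc _ _ _ d0 d1 r0 r1))// ex -rmorphM.
by rewrite mulrAC.
Qed.

Lemma theta_normal_expansion Q j : mtame Q ->
  normal_expansion (theta Q j) (theta Q j 0) (j%:R *: theta (fun t => t%:C%C *: Q t) j.+1 0).
Proof.
move=> tQ; apply: has_slope_of_quadratic => // i l.
have [c c0 hc] := theta_expansion j i l tQ ler01.
exists c => //; apply: filterS (near_imag_nonreal R) => y yr.
have := hc 0 (imag y); rewrite subr0; apply.
- rewrite (_ : resolvent 0 = fun=> 1); first exact: tame_cst.
  by apply/funext => t; rewrite resolvent0.
- exact: tame_resolvent.
- move=> t; split; rewrite ?resolvent0 ?normr1//.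
  + by rewrite mul0r subr0 oner_eq0.
  + exact: resolvent_den_neq0.
  + exact: norm_resolvent_imag.
Qed.

Lemma theta_derivative Q j : mtame Q ->
  derivative_off_real (theta Q j) (fun z => j%:R *: theta (fun t => t%:C%C *: Q t) j.+1 z).
Proof.
move=> tQ z zr; apply: has_slope_of_quadratic.
- exact: cvg_dnbhs_id.
- exact: near_dnbhs_id.
(* On the disc of radius e around z, imaginary parts are at least e in modulus. *)
move=> i l; pose e := `|complex.Im z| / 2.
have e0 : 0 < e by rewrite divr_gt0// normr_gt0 -nonreal_Im.
pose B := (cmod z + e) / e.
have B0 : 0 <= B by rewrite divr_ge0 ?addr_ge0 ?cmod_ge0// ltW.
have [c c0 hc] := theta_expansion j i l tQ B0.
exists c => //.
have e0' : 0 < e%:C%C :> C by rewrite ltcR.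
have hs : \forall h \near (0 : C)^', `|h| < e%:C%C.
  by apply: nbhs_dnbhs; exact: nbhs0_lt.
apply: filterS2 hs (near_nonreal zr) => h he hzr.
have := hc z (h + z); rewrite addrK; apply => [||t]; try exact: tame_resolvent.
have he' : cmod h < e by rewrite -ltcR cmodE.
have ImB : e <= `|complex.Im (h + z)|.
  have -> : complex.Im (h + z) = complex.Im z + complex.Im h.
    by case: (h) (z) => [? ?] [? ?] /=; rewrite addrC.
  have hI : `|complex.Im h| <= e.
    by rewrite -lecR (le_trans (normr_Im_le _))// ltW.
  rewrite (le_trans _ (lerB_normD _ _))// lerBrDr.
  by rewrite (le_trans (lerD (lexx _) hI))// /e -splitr.
split; try exact: resolvent_den_neq0.
- rewrite (le_trans (norm_resolvent_le _ zr))// lecR /resolvent_bound /B.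
  apply: ler_pM; rewrite ?invr_ge0 ?cmod_ge0//.
    by rewrite lerDl ltW.
  by rewrite lef_pV2 ?posrE ?normr_gt0 -?nonreal_Im// /e ler_pdivrMr// ler_peMr// ler1n.
- rewrite (le_trans (norm_resolvent_le _ hzr))// lecR /resolvent_bound /B.
  apply: ler_pM; rewrite ?invr_ge0 ?cmod_ge0//.
    rewrite -lecR cmodE (le_trans (ler_normD _ _))// -!cmodE -rmorphD lecR addrC lerD2l.
    exact: ltW.
  by rewrite lef_pV2 ?posrE ?normr_gt0 -?nonreal_Im.
Qed.

Lemma theta_smooth k Q j : mtame Q -> smooth_upto k (theta Q j).
Proof.
elim: k Q j => [|k IH] Q j tQ.
  split; first by eexists; eexists; exact: theta_normal_expansion.
  by eexists; split; [exact: theta_derivative|].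
split; first by eexists; eexists; exact: theta_normal_expansion.
eexists; split; first exact: theta_derivative.
apply: (@smooth_upto_eq _ _ _ (fun z => j%:R%:M * theta (fun t => t%:C%C *: Q t) j.+1 z)).
  by move=> z _; rewrite mul_scalar_mxr.
apply: smooth_uptoM; first exact: smooth_upto_cst.
by apply: IH; apply: mtameZ => //; exact: tame_id.
Qed.

Lemma green_theta q z : green mu z 1 q = theta (fun t => mxeval q t%:C%C) 1 z.
Proof.
rewrite /green /theta; apply: eq_form => t; last by rewrite expr1.
by rewrite mxeval1.
Qed.

Lemma green_smooth k q : smooth_upto k (fun z => green mu z 1 q).
Proof.
apply: smooth_upto_eq (theta_smooth k 1 (mtame_mxeval q)) => z _.
by rewrite green_theta.
Qed.

Lemma green_normal_value q :
  green mu (imag y) 1 q @[y --> (0 : R)^'] --> inner mu 1 q.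
Proof.
have := normal_expansion_value (theta_normal_expansion (j := 1) (mtame_mxeval q)).
have -> : theta (fun t => mxeval q t%:C%C) 1 0 = inner mu 1 q.
  rewrite /theta innerE; apply: eq_form => t; first by rewrite mxeval1.
  by rewrite expr1 resolvent0 scale1r.
apply: cvg_trans; apply: near_eq_cvg; apply: nearW => y.
by rewrite green_theta.
Qed.

End ResolventIntegrals.

(** * One step of the Schur algorithm *)

Section SchurStep.
Variables (R : realType) (d : nat).
Local Notation C := R[i].
Local Notation M := 'M[R[i]]_d.+1.
Implicit Types (f g : C -> M) (a b : M) (z : C).

Local Notation off_real := [pred z : C | z \isn't Num.real].

Lemma cvg_imag_eq f g b : {in off_real, f =1 g} ->
  f (imag y) @[y --> (0 : R)^'] --> b -> g (imag y) @[y --> (0 : R)^'] --> b.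
Proof.
by move=> fg; apply: cvg_eq_near; apply: filterS (near_imag_nonreal R) => y; exact: fg.
Qed.

Lemma nevanlinna_eq f g : {in off_real, f =1 g} -> nevanlinna f -> nevanlinna g.
Proof.
move=> fg [df fJ fI]; split=> z zr.
- move: (df z zr) => /cvg_ex[D hD]; apply/cvg_ex; exists D.
  apply: (cvg_eq_near _ hD); apply: filterS (near_nonreal zr) => h hz.
  by rewrite /= [_ *: 1]mulr1 !fg.
- by rewrite -!fg ?inE ?nonreal_conj//; exact: fJ.
- by rewrite -fg//; exact: fI.
Qed.

Lemma degenerate_eq f g : {in off_real, f =1 g} -> degenerate f -> degenerate g.
Proof. by move=> fg [z zr [v v0 fv]]; exists z => //; exists v; rewrite -?fg. Qed.

Lemma schur_stage_eq f g b a : {in off_real, f =1 g} ->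
  schur_stage f b a -> schur_stage g b a.
Proof.
move=> fg [nf df f0 f1 pa].
have gf : {in off_real, g =1 f} by move=> z zr; rewrite fg.
split.
- exact: nevanlinna_eq fg nf.
- by move=> dg; apply: df; exact: degenerate_eq gf dg.
- exact: cvg_imag_eq fg f0.
- exact: normal_expansion_eq fg f1.
- exact: pa.
Qed.

Lemma schur_aE f b a : f (imag y) @[y --> (0 : R)^'] --> b ->
  normal_slope f b y @[y --> 0^'] --> a ^+ 2 -> pdmx a -> schur_a f = a.
Proof.
move=> f0 f1 pa; rewrite /schur_a (normal_derivativeE f0 f1).
case: xgetP => [x _ [px xa]|/(_ a)[]]; last by split.
exact: pdmx_sqrt_inj.
Qed.

(** For X = f z - b, the step is (a^-1 (X - z a^2) X^-1 a) / z. *)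
Lemma schur_stepE f b a z : f (imag y) @[y --> (0 : R)^'] --> b ->
  normal_slope f b y @[y --> 0^'] --> a ^+ 2 -> pdmx a ->
  z != 0 -> f z - b \is a GRing.unit ->
  schur_step f z = z^-1%:M - a * (f z - b)^-1 * a.
Proof.
move=> f0 f1 pa z0 ub; rewrite /schur_step (normal_valueE f0) (schur_aE f0 f1 pa).
have ua := pdmx_unit pa; move: (f z - b) ub => X uX.
rewrite mulrBr mulrBl mulrBl -[a^-1 * X * X^-1]mulrA mulrV// mulr1 mulVr//.
rewrite expr2 -scalerAr -!scalerAl mulrA mulVr// mul1r scalerBr scalerA mulVf// scale1r.
by rewrite scalemx1.
Qed.

Lemma imag_part_unit (A : M) (c : C) (b : M) : b ^t* = b -> psdmx (c *: mxIm A) -> c != 0 ->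
  (forall v : 'cV[C]_d.+1, mxIm A *m v = 0 -> v = 0) -> A - b \is a GRing.unit.
Proof.
move=> bH psdA c0 kA; apply: unitr_mx_ker => v Av; apply: kA.
have ImAb : mxIm A = mxIm (A - b).
  by rewrite /mxIm adjmxB bH opprB addrA subrK.
have q0 : qform (c *: mxIm A) v = 0.
  rewrite ImAb qform_sesqui sesquiZm /mxIm sesquiZm sesquiDm sesquiNm -conj_sesqui.
  have -> : sesqui (A - b) v v = 0 by rewrite /sesqui -mulmxA Av mulmx0 mxE.
  by rewrite conjC0 subrr !mulr0.
have := psdmx_ker psdA q0; rewrite -scalemxAl => /eqP.
by rewrite scaler_eq0 (negbTE c0) => /eqP.
Qed.

Lemma complex_Im_neq0 z : z \isn't Num.real -> 'Im z != 0.
Proof. by rewrite -complexIm (inj_eq (@complexI R) _ 0) -nonreal_Im. Qed.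

Lemma nevanlinna_sub_unit f b z : b ^t* = b -> nevanlinna f -> ~ degenerate f ->
  z \isn't Num.real -> f z - b \is a GRing.unit.
Proof.
move=> bH [_ _ fI] df zr; apply: (imag_part_unit bH (fI z zr)).
  by rewrite invr_eq0 complex_Im_neq0.
move=> v fv; apply/eqP/negPn/negP => v0; apply: df.
by exists z => //; exists v.
Qed.

Lemma schur_stage_step f b a z : b ^t* = b -> schur_stage f b a ->
  z \isn't Num.real -> schur_step f z = z^-1%:M - a * (f z - b)^-1 * a.
Proof.
move=> bH [nf df f0 f1 pa] zr; apply: (schur_stepE f0 f1 pa (nonreal_neq0 zr)).
exact: nevanlinna_sub_unit.
Qed.

Lemma normal_expansion_stage f b a : nevanlinna f -> ~ degenerate f ->
  normal_expansion f b (a ^+ 2) -> pdmx a -> schur_stage f b a.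
Proof.
move=> nf df e pa; split; [exact: nf|exact: df| |exact: e|exact: pa].
exact: normal_expansion_value e.
Qed.

Lemma smooth_upto_derivable f z : smooth_upto 0 f -> z \isn't Num.real -> derivable f z 1.
Proof. by move=> [_ [f' [df _]]] zr; exact: derivative_off_real_derivable df. Qed.

End SchurStep.

(** * Weyl functions are Schur iterates *)

Section WeylIterates.
Variables (R : realType) (d : nat) (mu : set R -> 'M[R[i]]_d.+1).
Variables (p : nat -> {poly 'M[R[i]]_d.+1}) (a b : nat -> 'M[R[i]]_d.+1).
Local Notation C := R[i].
Local Notation M := 'M[R[i]]_d.+1.
Hypothesis Hmu : matrix_measure mu.
Hypothesis Hp : orthonormal_polynomials mu p.
Hypothesis p0 : p 0%N = 1.
Hypothesis prec : forall n, 'X * p n =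
  p n.+1 * (a n)%:P + p n * (b n)%:P + preceding p n * (preceding a n)%:P.
Hypothesis bH : forall n, b n = b n ^t*.
Hypothesis aP : forall n, pdmx (a n).
Implicit Types (z : C) (n m k : nat).

Let Hmom : has_moments mu. Proof. by case: Hp. Qed.

Let orth n m : inner mu (p n) (p m) = (n == m)%:R.
Proof. by case: Hp. Qed.

Local Notation s := (second_kind mu p).
Local Notation weyl := (weyl mu p a b).
Local Notation off_real := [pred z : C | z \isn't Num.real].

Lemma weyl_adj n z : z \isn't Num.real -> (weyl n z) ^t* = weyl n z^*.
Proof.
move=> zr; have zJr : z^* \isn't Num.real by rewrite nonreal_conj.
elim: n => [|n IH].
  rewrite (weyl0 Hmu Hp p0 prec bH aP zr) (weyl0 Hmu Hp p0 prec bH aP zJr).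
  rewrite adjmxZ adjmxB adjr1 adjrV fmorphV !second_kindE p0.
  by rewrite (green_adj Hmu Hmom zr).
rewrite (weylS Hmu Hp p0 prec bH aP zr) (weylS Hmu Hp p0 prec bH aP zJr).
rewrite adjmxB adjmx_scalar fmorphV !adjrM (jacobi_a_herm aP) adjrV adjmxB IH -bH.
by rewrite mulrA.
Qed.

Lemma moment_recurrence j n : inner mu 1 ('X^(j.+1) * p n) =
  inner mu 1 ('X^j * p n.+1) * a n + inner mu 1 ('X^j * p n) * b n +
  inner mu 1 ('X^j * preceding p n) * preceding a n.
Proof.
rewrite exprSr -mulrA prec !mulrDr !mulrA.
by rewrite !(innerDr Hmu Hmom) !(innerMr Hmu Hmom).
Qed.

(** Multiplication by t lowers the index by at most one, so that orthogonality of p_n to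
    p_0 = 1 yields orthogonality to all lower powers. *)
Lemma low_moment j n : (j < n)%N -> inner mu 1 ('X^j * p n) = 0.
Proof.
elim: j n => [|j IH] n jn; first by rewrite expr0 mul1r -p0 orth ltn_eqF.
case: n jn => // n jn; rewrite moment_recurrence /= !IH ?mul0r ?addr0//.
  exact: ltnW.
exact: ltnW (ltnW _).
Qed.

Lemma moment_step n : inner mu 1 ('X^(n.+1) * p n.+1) = inner mu 1 ('X^n * p n) * a n.
Proof.
by rewrite moment_recurrence (@low_moment n n.+2)// (@low_moment n n.+1)// !mul0r !add0r.
Qed.

Lemma moment_unit n : inner mu 1 ('X^n * p n) \is a GRing.unit.
Proof.
elim: n => [|n IH]; first by rewrite expr0 mul1r -p0 orth unitr1.
by rewrite moment_step unitr_mulmx IH (jacobi_a_unit aP).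
Qed.

(** 1/(1 - zt) is z^j t^j / (1 - zt) up to a polynomial in t of degree below j, which
    is orthogonal to p_n. *)
Lemma second_kind_normalized j n z : z \isn't Num.real -> (j <= n)%N ->
  green mu z 1 ('X^j * p n) = z ^- j *: s z n.
Proof.
move=> zr; elim: j => [|j IH] jn.
  by rewrite expr0 invr1 scale1r mul1r second_kindE.
rewrite exprS -mulrA (greenXr Hmu Hmom zr) IH ?(ltnW jn)// low_moment// subr0 scalerA.
by rewrite exprS invfM.
Qed.

Let Psi n z := green mu z 1 ('X^n * p n).

Let Psi_unit n z : z \isn't Num.real -> Psi n z \is a GRing.unit.
Proof.
move=> zr; rewrite /Psi second_kind_normalized// unitrZ.
  exact: second_kind_unit.
by rewrite invr_eq0 expf_neq0// nonreal_neq0.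
Qed.

(** The functions of the second kind vanish at 0 to the order n. Dividing by z^n leaves
    functions that extend to 0 with the invertible limit moment_unit. *)
Lemma weyl_normalized n : {in off_real,
  weyl n =1 fun z => b n + z%:M * ((Psi n z)^-1 * Psi n.+1 z * a n)}.
Proof.
move=> z zr; have z0 := nonreal_neq0 zr; rewrite /weyl; congr (_ + _).
have us := second_kind_unit Hmu Hp p0 prec bH aP zr n.
rewrite /Psi !second_kind_normalized// invrZ_mx ?invr_eq0 ?expf_neq0// invrK.
rewrite -scalerAl -scalerAr scalerA -scalerAl mul_scalar_mxr scalerA mulrA -exprS.
by rewrite mulfV ?expf_neq0// scale1r.
Qed.

Lemma weyl_smooth k n : smooth_upto k (weyl n).
Proof.
apply: (@smooth_upto_eq _ _ _
  (fun z => b n + z%:M * ((Psi n z)^-1 * Psi n.+1 z * a n))).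
  by move=> z zr; rewrite weyl_normalized.
apply: smooth_uptoD; first exact: smooth_upto_cst.
apply: smooth_uptoM; first exact: smooth_upto_id.
apply: smooth_uptoM; last exact: smooth_upto_cst.
apply: smooth_uptoM; last exact: green_smooth.
apply: (smooth_uptoV (moment_unit n)) => [|z zr|].
- exact: green_normal_value.
- exact: Psi_unit.
- exact: green_smooth.
Qed.

(** The ratio of two consecutive leading moments is a_n, by moment_step. *)
Lemma weyl_normal_expansion n : normal_expansion (weyl n) (b n) (a n ^+ 2).
Proof.
have [[L [D e]] _] := weyl_smooth 0 n.
have uM := moment_unit n.
have W0 : (Psi n (imag y))^-1 * Psi n.+1 (imag y) * a n @[y --> (0 : R)^'] --> a n ^+ 2.
  have -> : a n ^+ 2 = (inner mu 1 ('X^n * p n))^-1 * inner mu 1 ('X^(n.+1) * p n.+1) * a n.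
    by rewrite moment_step mulrA mulVr// mul1r.
  apply: cvg_mulr_mx; last exact: cvg_cst.
  apply: cvg_mulr_mx; last exact: (green_normal_value Hmu Hmom).
  by apply: (cvg_invmx uM); exact: (green_normal_value Hmu Hmom).
apply: (cvg_eq_near _ W0).
apply: filterS (near_imag_nonreal R) => y yr.
rewrite weyl_normalized// addrC addKr mul_scalar_mxr scalerA mulVf ?scale1r//.
exact: nonreal_neq0.
Qed.

Lemma weyl_nevanlinna n : nevanlinna (weyl n).
Proof.
split=> z zr; first exact: smooth_upto_derivable (weyl_smooth 0 n) zr.
- exact: weyl_adj.
- exact: weyl_psd.
Qed.

Lemma weyl_not_degenerate n : ~ degenerate (weyl n).
Proof.
move=> [z zr [v v0 wv]]; move/eqP: v0; apply.
by apply: weyl_nondegenerate wv.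
Qed.

Lemma weyl_stage n : schur_stage (weyl n) (b n) (a n).
Proof.
exact: (normal_expansion_stage (weyl_nevanlinna n) (@weyl_not_degenerate n)
  (@weyl_normal_expansion n) (aP n)).
Qed.

Lemma schur_iterate_weyl n m f : {in off_real, f =1 weyl n} ->
  {in off_real, schur_iterate m f =1 weyl (n + m)}.
Proof.
move=> fw; elim: m => [|m IH] z zr; first by rewrite /schur_iterate/= addn0 fw.
have st : schur_stage (schur_iterate m f) (b (n + m)%N) (a (n + m)%N).
  by apply: schur_stage_eq (weyl_stage (n + m)) => x xr; rewrite IH.
rewrite /schur_iterate iterS -/(schur_iterate m f).
rewrite (schur_stage_step (esym (bH _)) st zr) IH//.
by rewrite addnS (weylS Hmu Hp p0 prec bH aP zr).
Qed.

Lemma weyl_schur_parameters n f : {in off_real, f =1 weyl n} ->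
  schur_parameters (fun k => b (n + k)%N) (fun k => a (n + k)%N) f.
Proof.
move=> fw; have wf : {in off_real, weyl n =1 f} by move=> z zr; rewrite fw.
split.
- exact: nevanlinna_eq wf (weyl_nevanlinna n).
- apply: smooth_upto_normally_smooth => k.
  exact: smooth_upto_eq wf (weyl_smooth k n).
- move=> m; apply: schur_stage_eq (weyl_stage (n + m)) => z zr.
  by rewrite (schur_iterate_weyl m fw).
Qed.

End WeylIterates.

(** * Imaginary parts of inverses *)

Section RingIdentities.
Variable U : unitRingType.
Implicit Types x y m a : U.

Lemma invr_sub x y : x \is a GRing.unit -> y \is a GRing.unit ->
  x^-1 - y^-1 = - (x^-1 * (x - y) * y^-1).
Proof.
by move=> ux uy; rewrite mulrBr mulVr// mulrBl mul1r -mulrA mulrV// mulr1 opprB.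
Qed.

Lemma mulN_sandwich x y m a a' :
  a * (- (x * m * y)) * a' = (a * x) * (- m) * (y * a').
Proof. by rewrite !(mulrN, mulNr) !mulrA. Qed.

Lemma continued_fraction_inv x a : x \is a GRing.unit -> a \is a GRing.unit ->
  a * (a * x^-1 * a)^-1 * a = x.
Proof.
move=> ux ua; rewrite invrM ?unitrMr ?unitrV// invrM ?unitrV// invrK.
by rewrite !mulrA mulrV// mul1r -mulrA mulVr// mulr1.
Qed.

End RingIdentities.

Section ImaginaryParts.
Variables (R : realType) (d : nat).
Local Notation C := R[i].
Local Notation M := 'M[R[i]]_d.+1.
Implicit Types (A B N X Y a b : M) (z : C) (v : 'cV[C]_d.+1).

Lemma mxImD A B : mxIm (A + B) = mxIm A + mxIm B.
Proof. by rewrite /mxIm adjmxD opprD addrACA scalerDr. Qed.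

Lemma mxImN A : mxIm (- A) = - mxIm A.
Proof. by rewrite /mxIm adjmxN -opprD scalerN. Qed.

Lemma mxIm_herm A : A ^t* = A -> mxIm A = 0.
Proof. by move=> AH; rewrite /mxIm AH subrr scaler0. Qed.

Lemma mxIm_congr A Y : mxIm (Y * A * Y ^t*) = Y * mxIm A * Y ^t*.
Proof.
rewrite /mxIm !adjrM trmxCK -scalerAr -scalerAl mulrBr mulrBl.
by rewrite !mulrA.
Qed.

Lemma mxIm_inv A : A \is a GRing.unit ->
  mxIm A^-1 = - (A^-1 * mxIm A * (A^-1) ^t*).
Proof.
move=> uA; have uAJ : A ^t* \is a GRing.unit by rewrite adjr_unit.
by rewrite /mxIm adjrV invr_sub// -scalerAr -scalerAl scalerN.
Qed.

Lemma qform_congr A Y v : qform (Y * A * Y ^t*) v = qform A (Y ^t* *m v).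
Proof. by rewrite /qform adjmxM trmxCK -[Y * A * _]/(Y *m A *m _) !mulmxA. Qed.

Lemma psdmx_congr A Y : psdmx A -> psdmx (Y * A * Y ^t*).
Proof. by move=> pA v; rewrite qform_congr. Qed.

Lemma pdmx_congr A Y : Y \is a GRing.unit -> pdmx A -> pdmx (Y * A * Y ^t*).
Proof.
move=> uY pA v v0; rewrite qform_congr; apply: pA; apply: contra_neq v0 => Yv.
have uYJ : Y ^t* \is a GRing.unit by rewrite adjr_unit.
by rewrite -[v]mul1mx -[1%:M](mulVr uYJ) -[_ * Y ^t*]/(_ *m Y ^t*) -mulmxA Yv mulmx0.
Qed.

Lemma sqnorm_ge0 v : 0 <= (v ^t* *m v) 0 0.
Proof.
rewrite mxE; apply: sumr_ge0 => i _; rewrite !mxE mulrC -normCK.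
by rewrite exprn_ge0.
Qed.

Lemma sqnorm_eq0 v : (v ^t* *m v) 0 0 = 0 -> v = 0.
Proof.
rewrite mxE => /eqP; rewrite psumr_eq0 => [|i _]; last first.
  by rewrite !mxE mulrC -normCK exprn_ge0.
move=> /allP v0; apply/colP => i; have := v0 i (mem_index_enum _).
rewrite !mxE mulrC -normCK /= expf_eq0/= normr_eq0 => /eqP ->.
by [].
Qed.

Lemma qform1 v : qform 1 v = (v ^t* *m v) 0 0.
Proof. by rewrite /qform mulmx1. Qed.

Lemma pdmx1 : pdmx (1 : M).
Proof.
move=> v v0; rewrite qform1 lt_def sqnorm_ge0 andbT.
by apply: contra_neq v0; exact: sqnorm_eq0.
Qed.

Lemma mxIm_scalar z : mxIm (z%:M : M) = ('Im z)%:M.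
Proof.
rewrite /mxIm adjmx_scalar -raddfB/= ImE_sub scale_scalar_mx mulrA mulVf ?mul1r//.
by rewrite mulf_neq0 ?neq0Ci// pnatr_eq0.
Qed.

Lemma Im_inv z : z \isn't Num.real -> ('Im z)^-1 * 'Im z^-1 = - (z * z^*)^-1.
Proof.
move=> zr; have z0 := nonreal_neq0 zr; have zJ0 : z^* != 0 by rewrite conjC_eq0.
apply: (mulfI (complex_Im_neq0 zr)); rewrite mulrA mulfV ?complex_Im_neq0// mul1r.
apply: (mulfI (_ : 2 * 'i != 0 :> C)); first by rewrite mulf_neq0 ?neq0Ci// pnatr_eq0.
by rewrite -ImE_sub mulrA -ImE_sub fmorphV; field; rewrite z0 zJ0.
Qed.

Lemma nonreal_sqnorm_gt0 z : z \isn't Num.real -> 0 < (z * z^*)^-1.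
Proof. by move=> zr; rewrite invr_gt0 -normCK exprn_gt0// normr_gt0 nonreal_neq0. Qed.

(** Im(1/z) / Im z = -1/|z|^2 is strictly negative, -X contributes a nonpositive term and
    the Hermitian b none. *)
Lemma fraction_den_pd z b X : z \isn't Num.real -> b ^t* = b ->
  psdmx (('Im z)^-1 *: mxIm X) ->
  pdmx (- (('Im z)^-1 *: mxIm (z^-1%:M - b - X))).
Proof.
move=> zr bH psdX v v0; rewrite !mxImD !mxImN (mxIm_herm bH) oppr0 addr0 mxIm_scalar.
rewrite scalerDr scalerN opprD opprK scale_scalar_mx Im_inv// -scalemx1 scaleNr opprK.
rewrite qform_sesqui sesquiDm sesquiZm -!qform_sesqui.
by rewrite ltr_wpDr ?psdX// mulr_gt0 ?nonreal_sqnorm_gt0// pdmx1.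
Qed.

Lemma fraction_den_unit z b X : z \isn't Num.real -> b ^t* = b ->
  psdmx (('Im z)^-1 *: mxIm X) -> z^-1%:M - b - X \is a GRing.unit.
Proof.
move=> zr bH psdX; apply: unitr_mx_ker => v Av; apply/eqP/negPn/negP => v0.
have := fraction_den_pd zr bH psdX v0.
rewrite qform_sesqui sesquiNm sesquiZm /mxIm sesquiZm sesquiDm sesquiNm -conj_sesqui.
have -> : sesqui (z^-1%:M - b - X) v v = 0 by rewrite /sesqui -mulmxA Av mulmx0 mxE.
by rewrite conjC0 subrr !mulr0 oppr0 ltxx.
Qed.

Lemma fraction_pd z a b X : z \isn't Num.real -> pdmx a -> b ^t* = b ->
  psdmx (('Im z)^-1 *: mxIm X) ->
  pdmx (('Im z)^-1 *: mxIm (a * (z^-1%:M - b - X)^-1 * a)).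
Proof.
move=> zr pa bH psdX; have uA := fraction_den_unit zr bH psdX.
have pdA := fraction_den_pd zr bH psdX; move: (z^-1%:M - b - X) uA pdA => A uA pdA.
have aH := pdmx_herm pa.
have -> : ('Im z)^-1 *: mxIm (a * A^-1 * a) =
    (a * A^-1) * (- (('Im z)^-1 *: mxIm A)) * (a * A^-1) ^t*.
  rewrite -{2}aH mxIm_congr mxIm_inv// adjrM aH mulN_sandwich.
  move: (mxIm A) ('Im z)^-1 (a * A^-1) (A^-1 ^t* * a) => m c x y.
  by rewrite -[- (c *: m)]scalerN -scalerAr -scalerAl.
apply: pdmx_congr => //.
by rewrite unitr_mulmx unitrV uA pdmx_unit.
Qed.

End ImaginaryParts.

(** * Finite continued fractions *)

Section FiniteFractions.
Variables (R : realType) (d : nat) (a b : nat -> 'M[R[i]]_d.+1).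
Local Notation C := R[i].
Local Notation M := 'M[R[i]]_d.+1.
Hypothesis bH : forall n, b n = b n ^t*.
Hypothesis aP : forall n, pdmx (a n).
Local Notation off_real := [pred z : C | z \isn't Num.real].

(** The recurrence of the p_n builds this continued fraction from the inside: each step
    adds the newest coefficients a_m, b_m at the outside. *)
Fixpoint fraction n (z : C) : M :=
  if n is m.+1 then a m * (z^-1%:M - b m - fraction m z)^-1 * a m else 0.

Lemma fraction_psd n z : z \isn't Num.real -> psdmx (('Im z)^-1 *: mxIm (fraction n z)).
Proof.
move=> zr; elim: n => [|n IH] /=; last by apply/pdmx_psd/fraction_pd => //; rewrite -bH.
rewrite mxIm_herm ?adjmx0// scaler0 => v.
by rewrite /qform mulmx0 mul0mx mxE lexx.
Qed.

Let den n z := z^-1%:M - b n - fraction n z.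

Let den_unit n z : z \isn't Num.real -> den n z \is a GRing.unit.
Proof. by move=> zr; exact: (fraction_den_unit zr (esym (bH n)) (fraction_psd n zr)). Qed.

Lemma fraction_adj n z : z \isn't Num.real -> (fraction n z) ^t* = fraction n z^*.
Proof.
move=> zr; elim: n => [|n IH] /=; first exact: adjmx0.
by rewrite !adjrM (pdmx_herm (aP n)) adjrV !adjmxB adjmx_scalar fmorphV -bH IH mulrA.
Qed.

(** This is z (z^-1 - b_n - fraction n z), which tends to 1 at 0. *)
Let nden n z : M := 1 - z%:M * b n - z%:M * fraction n z.

Let fraction_normalized n : {in off_real,
  fraction n.+1 =1 fun z => z%:M * (a n * (nden n z)^-1 * a n)}.
Proof.
move=> z zr; have z0 := nonreal_neq0 zr.
have -> : nden n z = z *: den n z.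
  by rewrite /nden /den !scalerBr !mul_scalar_mxr scale_scalar_mx mulfV.
rewrite invrZ_mx ?den_unit// mul_scalar_mxr -scalerAr -scalerAl scalerA mulfV//.
by rewrite scale1r.
Qed.

Let nden_unit n z : z \isn't Num.real -> nden n z \is a GRing.unit.
Proof.
move=> zr; have z0 := nonreal_neq0 zr.
have -> : nden n z = z *: den n z.
  by rewrite /nden /den !scalerBr !mul_scalar_mxr scale_scalar_mx mulfV.
by rewrite unitrZ// den_unit.
Qed.

Let cvg_imag_mx : (imag y)%:M @[y --> (0 : R)^'] --> (0 : M).
Proof.
apply/cvg_mxP => i j; rewrite mxE; under eq_fun do rewrite mxE.
have [_|_] := eqVneq i j; last by under eq_fun do rewrite mulr0n; exact: cvg_cst.
by under eq_fun do rewrite mulr1n; exact: cvg_imag.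
Qed.

Let nden_normal_value n (L : M) : fraction n (imag y) @[y --> (0 : R)^'] --> L ->
  nden n (imag y) @[y --> (0 : R)^'] --> (1 : M).
Proof.
move=> gL; have -> : (1 : M) = 1 - 0 * b n - 0 * L by rewrite !mul0r !subr0.
have c1 : (imag y)%:M * b n @[y --> (0 : R)^'] --> 0 * b n.
  by apply: cvg_mulr_mx; [exact: cvg_imag_mx|exact: cvg_cst].
have c2 : (imag y)%:M * fraction n (imag y) @[y --> (0 : R)^'] --> 0 * L.
  by apply: cvg_mulr_mx; [exact: cvg_imag_mx|exact: gL].
by apply: cvgB; [apply: cvgB; [exact: cvg_cst|exact: c1]|exact: c2].
Qed.

Lemma fraction_smooth k n : smooth_upto k (fraction n).
Proof.
elim: n => [|n IH]; first exact: smooth_upto_cst.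
apply: (@smooth_upto_eq _ _ _ (fun z => z%:M * (a n * (nden n z)^-1 * a n))).
  by move=> z zr; rewrite fraction_normalized.
apply: smooth_uptoM; first exact: smooth_upto_id.
apply: smooth_uptoM; last exact: smooth_upto_cst.
apply: smooth_uptoM; first exact: smooth_upto_cst.
have [L gL] : exists L : M, fraction n (imag y) @[y --> (0 : R)^'] --> L.
  by case: k IH => [|k] [[L [D e]] _]; exists L; exact: normal_expansion_value e.
apply: (@smooth_uptoV _ _ _ (nden n) (1 : M) (unitr1 _)); [exact: nden_normal_value gL|exact: nden_unit|].
apply: smooth_uptoD; last first.
  by apply: smooth_uptoN; apply: smooth_uptoM => //; exact: smooth_upto_id.
apply: smooth_uptoD; first exact: smooth_upto_cst.
apply: smooth_uptoN; apply: smooth_uptoM; first exact: smooth_upto_id.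
exact: smooth_upto_cst.
Qed.

Lemma fraction_normal_expansion n : normal_expansion (fraction n.+1) 0 (a n ^+ 2).
Proof.
have [[L [D e]] _] := fraction_smooth 0 n.
have nv := nden_normal_value (normal_expansion_value e).
have W0 : a n * (nden n (imag y))^-1 * a n @[y --> (0 : R)^'] --> a n ^+ 2.
  have -> : a n ^+ 2 = a n * 1^-1 * a n by rewrite invr1 mulr1 expr2.
  apply: cvg_mulr_mx; last exact: cvg_cst.
  apply: cvg_mulr_mx; first exact: cvg_cst.
  by apply: (cvg_invmx (unitr1 _)); exact: nv.
apply: (cvg_eq_near _ W0).
apply: filterS (near_imag_nonreal R) => y yr.
rewrite fraction_normalized// subr0 mul_scalar_mxr scalerA mulVf ?scale1r//.
exact: nonreal_neq0.
Qed.

Lemma fraction_nevanlinna n (c : M) : c ^t* = c -> nevanlinna (fun z => c + fraction n z).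
Proof.
move=> cH; split=> z zr.
- apply: smooth_upto_derivable zr; apply: smooth_uptoD; first exact: smooth_upto_cst.
  exact: fraction_smooth.
- by rewrite adjmxD cH fraction_adj.
- by rewrite mxImD mxIm_herm// add0r; exact: fraction_psd.
Qed.

Lemma fraction_not_degenerate n (c : M) : c ^t* = c ->
  ~ degenerate (fun z => c + fraction n.+1 z).
Proof.
move=> cH [z zr [v v0]]; rewrite mxImD mxIm_herm// add0r => gv.
have bnH : (b n) ^t* = b n by rewrite -bH.
have := fraction_pd zr (aP n) bnH (fraction_psd n zr) v0.
rewrite -/(fraction n.+1 z) qform_sesqui sesquiZm /sesqui -mulmxA gv mulmx0 mxE mulr0.
by rewrite ltxx.
Qed.

Lemma fraction_stage n (c : M) : c ^t* = c ->
  schur_stage (fun z => c + fraction n.+1 z) c (a n).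
Proof.
move=> cH; have e : normal_expansion (fun z => c + fraction n.+1 z) c (a n ^+ 2).
  have e0 : normal_expansion (fun=> c) c 0 by exact: has_slope_cst.
  rewrite -[c in normal_expansion _ c _]addr0 -[a n ^+ 2]add0r.
  exact: (has_slopeD e0 (@fraction_normal_expansion n)).
exact: (normal_expansion_stage (fraction_nevanlinna n.+1 cH)
  (fraction_not_degenerate cH) e (aP n)).
Qed.

Lemma fraction_step n (c : M) z : c ^t* = c -> z \isn't Num.real ->
  z^-1%:M - a n * (c + fraction n.+1 z - c)^-1 * a n = b n + fraction n z.
Proof.
move=> cH zr; have ua := pdmx_unit (aP n); have uD := den_unit n zr.
rewrite addrAC subrr add0r /= -/(den n z).
have -> : a n * (a n * (den n z)^-1 * a n)^-1 * a n = den n z.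
  exact: continued_fraction_inv.
by rewrite /den -addrA -opprD subKr.
Qed.

Variable n : nat.
Let b' k : M := if k is j.+1 then b (n - j.+1)%N else 0.
Let a' k : M := a (n - k.+1)%N.

Let b'H k : (b' k) ^t* = b' k.
Proof. by case: k => [|k] /=; [exact: adjmx0|rewrite -bH]. Qed.

Let iterate_fraction f k : {in off_real, f =1 fraction n} -> (k <= n)%N ->
  {in off_real, schur_iterate k f =1 fun z => b' k + fraction (n - k) z}.
Proof.
move=> fg; elim: k => [|k IH] kn z zr.
  by rewrite /schur_iterate/= add0r subn0 fg.
have nk : (n - k)%N = (n - k.+1).+1 by rewrite subnSK.
have st : schur_stage (schur_iterate k f) (b' k) (a' k).
  apply: schur_stage_eq (fraction_stage (n - k.+1) (b'H k)) => x xr.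
  by rewrite IH ?(ltnW kn)// nk.
rewrite /schur_iterate iterS -/(schur_iterate k f) (schur_stage_step (b'H k) st zr).
by rewrite IH ?(ltnW kn)// nk fraction_step.
Qed.

Lemma fraction_schur_parameters f : {in off_real, f =1 fraction n} ->
  terminating_schur_parameters n b' a' f.
Proof.
move=> fg; have gf : {in off_real, fraction n =1 f} by move=> z zr; rewrite fg.
split.
- apply: nevanlinna_eq (fraction_nevanlinna n (adjmx0 _ _ _)) => z zr.
  by rewrite add0r gf.
- apply: smooth_upto_normally_smooth => k; exact: smooth_upto_eq gf (fraction_smooth k n).
- move=> k kn; apply: schur_stage_eq (fraction_stage (n - k.+1) (b'H k)) => z zr.
  by rewrite (iterate_fraction fg (ltnW kn))// subnSK.
- apply: nevanlinna_eq (fraction_nevanlinna 0 (b'H n)) => z zr.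
  by rewrite (iterate_fraction fg (leqnn n))// subnn.
- by move=> z zr; rewrite (iterate_fraction fg (leqnn n))// subnn /= addr0.
Qed.

End FiniteFractions.

Section StepInjective.
Variables (R : realType) (d : nat).
Local Notation C := R[i].
Local Notation M := 'M[R[i]]_d.+1.
Implicit Types (f g : C -> M) (a b : M) (z : C).

Lemma schur_step_inj f g b a z : b ^t* = b ->
  schur_stage f b a -> schur_stage g b a -> z \isn't Num.real ->
  schur_step f z = schur_step g z -> f z = g z.
Proof.
move=> bH sf sg zr; rewrite (schur_stage_step bH sf zr) (schur_stage_step bH sg zr).
have [_ _ _ _ pa] := sf; have ua := pdmx_unit pa.
move=> /addrI/oppr_inj/(mulIr ua)/(mulrI ua)/invr_inj.
by move=> /addIr.
Qed.

(** The last iterates agree and every step can be undone. *)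
Lemma terminating_schur_unique N (b a : nat -> M) f g z : (forall k, (b k) ^t* = b k) ->
  terminating_schur_parameters N b a f -> terminating_schur_parameters N b a g ->
  z \isn't Num.real -> f z = g z.
Proof.
move=> bH [_ _ sf _ fN] [_ _ sg _ gN] zr.
suff : forall k, (k <= N)%N -> schur_iterate (N - k) f z = schur_iterate (N - k) g z.
  by move=> /(_ N (leqnn N)); rewrite subnn.
elim=> [|k IH] kN; first by rewrite subn0 fN// gN.
have lt : (N - k.+1 < N)%N by rewrite ltn_subrL (leq_ltn_trans _ kN).
apply: (schur_step_inj (bH _) (sf _ lt) (sg _ lt) zr).
have := IH (ltnW kN); rewrite -(subnSK kN) /schur_iterate !iterS.
by [].
Qed.

End StepInjective.

(** * Square summable sequences *)

Section SquareSummable.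
Variables (R : realType) (d : nat).
Local Notation C := R[i].
Local Notation cseq := (nat -> 'cV[R[i]]_d.+1).
Implicit Types (u v w : cseq) (x y : 'cV[C]_d.+1).

Definition sqn x : R := complex.Re ((x ^t* *m x) 0 0).

Lemma sqnE x : (x ^t* *m x) 0 0 = (sqn x)%:C%C.
Proof. by rewrite /sqn RRe_real// ger0_real// sqnorm_ge0. Qed.

Lemma sqn_ge0 x : 0 <= sqn x.
Proof. by rewrite -ler0c -sqnE sqnorm_ge0. Qed.

Lemma sqn_eq0 x : sqn x = 0 -> x = 0.
Proof. by move=> x0; apply: sqnorm_eq0; rewrite sqnE x0. Qed.

Lemma sqn0 : sqn 0 = 0.
Proof. by rewrite /sqn mulmx0 mxE. Qed.

Lemma sqnZ (c : C) x : sqn (c *: x) = cmod c ^+ 2 * sqn x.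
Proof.
apply: complexI; rewrite -sqnE adjmxZ -scalemxAl -scalemxAr scalerA mxE sqnE.
by rewrite (rmorphM (real_complex R)) rmorphXn/= cmodE normCKC.
Qed.

Lemma sqnN x : sqn (- x) = sqn x.
Proof. by rewrite /sqn adjmxN mulNmx mulmxN opprK. Qed.

Lemma sqnD_le x y : sqn (x + y) <= 2 * (sqn x + sqn y).
Proof.
have : 0 <= sqn (x - y) by exact: sqn_ge0.
suff -> : 2 * (sqn x + sqn y) = sqn (x + y) + sqn (x - y) by rewrite lerDl.
rewrite /sqn !adjmxD adjmxN !mulmxDl !mulmxDr !mulNmx !mulmxN opprK.
rewrite !mxE !raddfD !raddfN/=; ring.
Qed.

Definition sqn_series v : nat -> R := series (fun k => sqn (v k)).

Lemma series_sqn v N : series (fun k => ((v k) ^t* *m v k) 0 0) N = (sqn_series v N)%:C%C.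
Proof.
rewrite /sqn_series !seriesEnat/= (rmorph_sum (real_complex R)).
by apply: eq_bigr => k _; rewrite sqnE.
Qed.

Lemma sqn_series_nondecreasing v : nondecreasing_seq (sqn_series v).
Proof.
apply/nondecreasing_seqP => n; rewrite /sqn_series seriesSr.
by rewrite lerDl sqn_ge0.
Qed.

Lemma cvg_real_complex (x : nat -> R) (l : R) : x @ \oo --> l ->
  (x n)%:C%C @[n --> \oo] --> (l%:C%C : C).
Proof.
move=> xl; apply/cvgrPdist_lt => e e0.
have [e' ee'] : exists e', e = e'%:C%C by apply/complex_realP/gtr0_real.
subst e; move: e0; rewrite ltcR => e0.
move/cvgrPdist_lt: xl => /(_ _ e0); apply: filterS => n.
by rewrite -rmorphB norm_realC ltcR.
Qed.

Lemma bounded_l2 v (B : R) : (forall N, sqn_series v N <= B) -> l2 v.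
Proof.
move=> vB; rewrite /l2/=.
have cv : cvgn (sqn_series v).
  apply: nondecreasing_is_cvgn; first exact: sqn_series_nondecreasing.
  by exists B => _ [N _ <-].
apply/cvg_ex; exists (limn (sqn_series v))%:C%C.
rewrite (_ : series _ = fun N => (sqn_series v N)%:C%C); last first.
  by apply/funext => N; exact: series_sqn.
exact: cvg_real_complex.
Qed.

Lemma l2_cvg v : l2 v -> cvgn (sqn_series v).
Proof.
move=> /cvg_ex[l vl]; apply/cvg_ex; exists (complex.Re l).
rewrite (_ : sqn_series v = fun N => complex.Re (series (fun k => ((v k) ^t* *m v k) 0 0) N)).
  exact: cvg_Re vl.
by apply/funext => N; rewrite series_sqn.
Qed.

Lemma sqn_series0 v : cvgn (sqn_series v) -> limn (sqn_series v) = 0 -> forall k, v k = 0.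
Proof.
move=> cv lv k; apply: sqn_eq0; apply/eqP; rewrite eq_le sqn_ge0 andbT.
have := nondecreasing_cvgn_le (@sqn_series_nondecreasing v) cv k.+1.
rewrite lv /sqn_series seriesSr; apply: le_trans; rewrite lerDr.
by rewrite seriesEnat/=; apply: sumr_ge0 => i _; exact: sqn_ge0.
Qed.

Lemma l2dot_scaled u v (c : C) : cvgn (sqn_series v) ->
  (forall k, ((u k) ^t* *m v k) 0 0 = c * (sqn (v k))%:C%C) ->
  l2dot u v = c * (limn (sqn_series v))%:C%C.
Proof.
move=> cv uv; rewrite /l2dot; apply: cvg_lim; first exact: norm_hausdorff.
rewrite (_ : series _ = fun N => c * (sqn_series v N)%:C%C); last first.
  apply/funext => N; rewrite /sqn_series !seriesEnat/= (rmorph_sum (real_complex R)).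
  by rewrite big_distrr/=; apply: eq_bigr => k _; rewrite uv.
by apply: cvgM; [exact: cvg_cst|exact: cvg_real_complex].
Qed.

End SquareSummable.

(** * Uniqueness for self-adjoint Jacobi matrices *)

Section JacobiUniqueness.
Variables (R : realType) (d : nat) (a b : nat -> 'M[R[i]]_d.+1).
Local Notation C := R[i].
Local Notation M := 'M[R[i]]_d.+1.
Hypothesis bH : forall n, b n = b n ^t*.
Hypothesis aP : forall n, pdmx (a n).
Implicit Types (z : C) (x : 'cV[C]_d.+1).

Let aH n : (a n) ^t* = a n. Proof. exact: pdmx_herm. Qed.
Let au n : a n \is a GRing.unit. Proof. exact: pdmx_unit. Qed.

(** The relations, at a fixed point z, between the values of the iterates of a function
    with the parameters b_n, a_n, b_(n+1), a_(n+1), ... *)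
Definition schur_values z n (F : nat -> M) : Prop := forall k,
  [/\ F k - b (n + k)%N \is a GRing.unit, psdmx (('Im z)^-1 *: mxIm (F k)) &
      F k.+1 = z^-1%:M - a (n + k)%N * (F k - b (n + k)%N)^-1 * a (n + k)%N].

(** Linearization of the Riccati relation in schur_values: the F k - b (n + k) are ratios
    of consecutive terms of a solution of the three-term recurrence. *)
Fixpoint weyl_solution n (F : nat -> M) k : M :=
  if k is j.+1 then weyl_solution n F j * (F j - b (n + j)%N) * (a (n + j)%N)^-1 else 1.

Section Solution.
Variables (z : C) (n : nat) (F : nat -> M).
Hypothesis zr : z \isn't Num.real.
Hypothesis HF : schur_values z n F.
Local Notation U := (weyl_solution n F).

Lemma weyl_solutionS_a k : U k.+1 * a (n + k)%N = U k * (F k - b (n + k)%N).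
Proof. by rewrite /= -mulrA mulVr// mulr1. Qed.

Lemma weyl_solution_transfer k :
  U k.+1 * a (n + k)%N * (F k - b (n + k)%N)^-1 = U k.
Proof. by have [uF _ _] := HF k; rewrite weyl_solutionS_a -mulrA mulrV// mulr1. Qed.

Lemma weyl_solution_recurrence k : z^-1 *: U k.+1 =
  U k.+2 * a (n + k.+1)%N + U k.+1 * b (n + k.+1)%N + U k * a (n + k)%N.
Proof.
rewrite weyl_solutionS_a mulrBr subrK; have [_ _ ->] := HF k.
by rewrite mulrBr mulr_scalar_mx !mulrA weyl_solution_transfer subrK.
Qed.

Let c : C := (z * z^*)^-1.

(** Green's identity: the squares are the decrements of a sequence of positive
    matrices. *)
Lemma weyl_solution_telescope k : c *: (U k.+1 * (U k.+1) ^t*) =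
  U k * (('Im z)^-1 *: mxIm (F k)) * (U k) ^t* -
  U k.+1 * (('Im z)^-1 *: mxIm (F k.+1)) * (U k.+1) ^t*.
Proof.
have [uF _ ->] := HF k; set X := F k - _.
have FX : mxIm (F k) = mxIm X by rewrite mxImD mxImN (mxIm_herm (esym (bH _))) subr0.
have -> : ('Im z)^-1 *: mxIm (z^-1%:M - a (n + k)%N * X^-1 * a (n + k)%N) =
    - c *: 1 + (a (n + k)%N * X^-1) * (('Im z)^-1 *: mxIm X) * (a (n + k)%N * X^-1) ^t*.
  rewrite mxImD mxImN -{2}(aH (n + k)) mxIm_congr mxIm_inv// mxIm_scalar.
  rewrite adjrM aH mulN_sandwich scalerBr scale_scalar_mx Im_inv// -scalemx1.
  congr (_ + _); move: (mxIm X) ('Im z)^-1 (a (n + k)%N * X^-1) (X^-1 ^t* * a (n + k)%N).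
  by move=> m c' x y; rewrite mulrN mulNr scalerN opprK -scalerAr -scalerAl.
have TU : U k.+1 * (a (n + k)%N * X^-1) = U k by rewrite mulrA weyl_solution_transfer.
rewrite FX mulrDr mulrDl opprD addrCA -scalerAr mulr1 -scalerAl scaleNr opprK.
rewrite [X in _ = _ + (X - _)](_ : _ = U k.+1 * (a (n + k)%N * X^-1) *
   (('Im z)^-1 *: mxIm X) * (U k.+1 * (a (n + k)%N * X^-1)) ^t*).
  by rewrite adjrM !mulrA subrr addr0.
by rewrite TU.
Qed.

(** Summing the decrements leaves at most the first positive matrix, so that the
    solution is square summable. *)
Lemma weyl_solution_bounded x : exists B : R, forall N,
  \sum_(0 <= k < N) sqn ((U k.+1) ^t* *m x) <= B.
Proof.
have [_ psd0 _] := HF 0%N.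
pose Nk k := U k * (('Im z)^-1 *: mxIm (F k)) * (U k) ^t*.
have Npsd k : psdmx (Nk k) by have [_ psd _] := HF k; exact: psdmx_congr.
have c0 : 0 < c by exact: nonreal_sqnorm_gt0.
have [r cr] : exists r, c = r%:C%C by apply/complex_realP/gtr0_real.
have r0 : 0 < r by rewrite -ltcR -cr.
exists (r^-1 * complex.Re (qform (Nk 0%N) x)) => N.
have tel : c * \sum_(0 <= k < N) (sqn ((U k.+1) ^t* *m x))%:C%C =
    qform (Nk 0%N) x - qform (Nk N) x.
  elim: N => [|N IH]; first by rewrite big_geq// mulr0 subrr.
  rewrite (big_nat_recr _ _ _ (leq0n N)) mulrDr IH -sqnE.
  have -> : c * (((U N.+1) ^t* *m x) ^t* *m ((U N.+1) ^t* *m x)) 0 0 =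
      qform (Nk N) x - qform (Nk N.+1) x.
    rewrite !qform_sesqui -sesquiNm -sesquiDm /Nk -weyl_solution_telescope sesquiZm.
    congr (_ * _); rewrite -qform_sesqui -qform1; move: (U N.+1) => W.
    by rewrite -(qform_congr 1 W x) mulr1.
  by move: (qform (Nk 0%N) x) (qform (Nk N) x) (qform (Nk N.+1) x) => p q s; rewrite addrA subrK.
have [qN q0] : 0 <= qform (Nk N) x /\ 0 <= qform (Nk 0%N) x by split; exact: Npsd.
move: tel qN q0; move: (qform (Nk N) x) (qform (Nk 0%N) x) => p q tel p0 q0.
rewrite -(ler_pM2l r0) mulrA mulfV ?gt_eqF// mul1r -lecR.
rewrite (rmorphM (real_complex R)) -[X in X * _]cr (rmorph_sum (real_complex R)) tel RRe_real; last exact: ger0_real.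
by rewrite gerBl.
Qed.

End Solution.

Hypothesis Jsa : self_adjoint (jacobi_domain b a) (jacobi b a).

Lemma jacobi_symmetric v : jacobi_domain b a v ->
  l2dot v (jacobi b a v) = l2dot (jacobi b a v) v.
Proof.
move=> Dv; have : adjoint_graph (jacobi_domain b a) (jacobi b a) (v, jacobi b a v).
  by rewrite Jsa.
by move=> [_ _ /(_ v Dv)].
Qed.

Lemma adjmx_recurrence (w : C) (X0 X1 X2 a0 a1 b1 : M) x :
  a0 ^t* = a0 -> b1 ^t* = b1 -> a1 ^t* = a1 ->
  w *: X1 = X2 * a1 + X1 * b1 + X0 * a0 ->
  w^* *: (X1 ^t* *m x) =
    a0 *m (X0 ^t* *m x) + b1 *m (X1 ^t* *m x) + a1 *m (X2 ^t* *m x).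
Proof.
move=> a0H b1H a1H rec; rewrite scalemxAl -adjmxZ rec !adjmxD !adjrM a0H b1H a1H.
have mulE (A B : M) : A * B = A *m B by [].
rewrite !mulE 2!mulmxDl -!mulmxA; move: (a0 *m _) (b1 *m _) (a1 *m _) => x0 x1 x2.
by rewrite addrC [X in _ + X]addrC addrA.
Qed.

(** The two solutions are square summable and so is their difference, which starts with
    0. Its adjoint applied to a vector x, and completed by zeros, is a sequence v that
    satisfies (J v)_j = conj(1/z) v_j for all j but n, where v_n = 0. Thus the scalar product of v
    with J v is a non-real multiple of the squared norm of v, while J is symmetric.
    Hence v = 0, and the two solutions have the same second term. *)
Lemma schur_values_unique z n F G : z \isn't Num.real ->
  schur_values z n F -> schur_values z n G -> F 0%N = G 0%N.
Proof.
move=> zr HF HG; have zJ0 : z^-1 != 0 by rewrite invr_eq0 nonreal_neq0.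
pose U := weyl_solution n F; pose V := weyl_solution n G.
pose D k := U k - V k.
have D0 : D 0%N = 0 by rewrite /D subrr.
have Drec k : z^-1 *: D k.+1 = D k.+2 * a (n + k.+1)%N + D k.+1 * b (n + k.+1)%N +
    D k * a (n + k)%N.
  rewrite /D scalerBr (weyl_solution_recurrence HF) (weyl_solution_recurrence HG) -/U -/V.
  move: (U k) (U k.+1) (U k.+2) (V k) (V k.+1) (V k.+2) => u0 u1 u2 w0 w1 w2.
  rewrite !mulrBl (addrACA (u2 * a _)) (addrACA (u2 * a _ + u1 * b _)).
  by rewrite !opprD.
suff D1 : D 1%N = 0.
  have hF := weyl_solutionS_a n F 0; have hG := weyl_solutionS_a n G 0.
  rewrite !mul1r in hF hG; apply: (addIr (- b (n + 0)%N)); rewrite -hF -hG.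
  by rewrite -/U -/V (subr0_eq D1).
suff D1x x : (D 1%N) ^t* *m x = 0.
  rewrite -[D 1%N]trmxCK -[RHS]adjmx0; congr (_ ^t*); apply/matrixP => i j.
  by have /colP/(_ i) := D1x (delta_mx j 0); rewrite -colE !mxE.
pose v j : 'cV[C]_d.+1 := if (j < n)%N then 0 else (D (j - n)%N) ^t* *m x.
have vn k : v (n + k)%N = (D k) ^t* *m x by rewrite /v ltnNge leq_addr addKn.
have v0 : v n = 0 by rewrite -(addn0 n) vn D0 adjmx0 mul0mx.
pose y := a n *m v n.+1.
have Jv j : jacobi b a v j = (z^-1)^* *: v j + (j == n)%:R *: y.
  rewrite /jacobi; have [jn|jn|->] := ltngtP j n.
  - have vj : v j = 0 by rewrite /v jn.
    have vjS : v j.+1 = 0 by move: jn; rewrite leq_eqVlt => /orP[/eqP->//|jn]; rewrite /v jn.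
    have -> : preceding v j = 0.
      by case: j jn {vj vjS} => //= j jn; rewrite /v ltnW.
    by rewrite vj vjS !mulmx0 !scaler0 scale0r !addr0.
  - have [k ->] : exists k, j = (n + k.+1)%N.
      by exists (j - n.+1)%N; rewrite addnS -addSn subnKC.
    rewrite scale0r addr0 -addnS !vn addnS /= vn.
    by rewrite (adjmx_recurrence x (aH _) (esym (bH _)) (aH _) (Drec k)) !addnS.
  - rewrite scale1r v0 scaler0 mulmx0 addr0 add0r.
    have pv m : m = n -> preceding v m = 0 by case: m => [//|m] mn /=; rewrite /v -mn ltnSn.
    rewrite (pv _ erefl).
    by rewrite mulmx0 !add0r.
have [BU hU] := weyl_solution_bounded zr HF x.
have [BV hV] := weyl_solution_bounded zr HG x.
pose B := 2 * (BU + BV).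
have vB N : sqn_series v N <= B.
  apply: (le_trans (sqn_series_nondecreasing v (leq_addl n.+1 N))).
  rewrite /sqn_series seriesEnat/= (big_cat_nat (leq0n n.+1) (leq_addr N n.+1))/=.
  rewrite big_nat_cond big1 ?add0r; last first.
    move=> j /andP[/andP[_ jn] _]; rewrite ltnS leq_eqVlt in jn.
    by case/orP: jn => [/eqP->|jn]; rewrite ?v0 ?sqn0// /v jn sqn0.
  rewrite -{1}(add0n n.+1) big_addn addKn.
  apply: (@le_trans _ _ (\sum_(0 <= k < N) 2 * (sqn ((U k.+1) ^t* *m x) + sqn ((V k.+1) ^t* *m x)))).
    apply: ler_sum => k _; rewrite addnC addSnnS vn /D adjmxB mulmxBl.
    by apply: (le_trans (sqnD_le _ _)); rewrite sqnN.
  rewrite -big_distrr/= ler_wpM2l// big_split/=.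
  by apply: lerD; [exact: hU|exact: hV].
have JB N : sqn_series (jacobi b a v) N <= 2 * (cmod (z^-1)^* ^+ 2 * B + sqn y).
  rewrite /sqn_series seriesEnat/=.
  apply: (@le_trans _ _ (\sum_(0 <= j < N) 2 * (cmod (z^-1)^* ^+ 2 * sqn (v j) +
      (if j == n then sqn y else 0)))).
    apply: ler_sum => j _; rewrite Jv -sqnZ; apply: (le_trans (sqnD_le _ _)).
    by case: eqP => _; rewrite ?scale1r// scale0r sqn0.
  rewrite -big_distrr/= ler_wpM2l// big_split/= -big_distrr/= lerD//.
    by rewrite ler_wpM2l ?sqr_ge0//; have := vB N; rewrite /sqn_series seriesEnat.
  rewrite -big_mkcond/= big_nat1_eq; case: ifP => // _; exact: sqn_ge0.
have Dv : jacobi_domain b a v.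
  by split; [exact: bounded_l2 vB|exact: bounded_l2 JB].
have cv : cvgn (sqn_series v) by apply: l2_cvg; case: Dv.
have := jacobi_symmetric Dv.
have vJ k : ((v k) ^t* *m jacobi b a v k) 0 0 = (z^-1)^* * (sqn (v k))%:C%C.
  rewrite Jv; have [->|_] := eqVneq k n.
    by rewrite v0 adjmx0 mul0mx sqn0 mulr0 mxE.
  by rewrite scale0r addr0 -scalemxAr mxE sqnE.
have Jv' k : ((jacobi b a v k) ^t* *m v k) 0 0 = z^-1 * (sqn (v k))%:C%C.
  rewrite Jv; have [->|_] := eqVneq k n.
    by rewrite v0 mulmx0 sqn0 mulr0 mxE.
  by rewrite scale0r addr0 adjmxZ conjCK -scalemxAl mxE sqnE.
rewrite (l2dot_scaled cv Jv').
have -> : l2dot v (jacobi b a v) = (z^-1)^* * (limn (sqn_series v))%:C%C.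
  rewrite /l2dot -(l2dot_scaled cv (u := fun k => z^-1 *: v k)); last first.
    by move=> k; rewrite adjmxZ -scalemxAl mxE sqnE.
  congr (limn (series _)); apply/funext => k.
  by rewrite vJ adjmxZ -scalemxAl mxE sqnE.
move=> /eqP; rewrite -subr_eq0 -mulrBl mulf_eq0 subr_eq0 -CrealE.
have wr : (z^-1 \is Num.real) = false by apply/negbTE; rewrite nonreal_inv.
rewrite wr /= => /eqP/complexI lim0.
by have := sqn_series0 cv lim0 (n + 1); rewrite vn.
Qed.

Lemma schur_parameters_unique n f g z : z \isn't Num.real ->
  schur_parameters (fun k => b (n + k)%N) (fun k => a (n + k)%N) f ->
  schur_parameters (fun k => b (n + k)%N) (fun k => a (n + k)%N) g -> f z = g z.
Proof.
move=> zr [_ _ sf] [_ _ sg].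
have values h : (forall k, schur_stage (schur_iterate k h) (b (n + k)%N) (a (n + k)%N)) ->
    schur_values z n (fun k => schur_iterate k h z).
  move=> sh k; have [nh dh _ _ _] := sh k; have bkH := esym (bH (n + k)).
  split; first exact: nevanlinna_sub_unit bkH nh dh zr.
    by have [_ _ psd] := nh; exact: psd.
  by rewrite /schur_iterate iterS -/(schur_iterate k h) (schur_stage_step bkH (sh k) zr).
exact: (schur_values_unique zr (values f sf) (values g sg)).
Qed.

End JacobiUniqueness.

(** * The measure p_n^dagger dmu p_n *)

Section PolynomialMeasures.
Variables (R : realType) (d : nat) (mu : set R -> 'M[R[i]]_d.+1).
Variables (p : nat -> {poly 'M[R[i]]_d.+1}) (a b : nat -> 'M[R[i]]_d.+1).
Local Notation C := R[i].
Local Notation M := 'M[R[i]]_d.+1.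
Hypothesis Hmu : matrix_measure mu.
Hypothesis Hp : orthonormal_polynomials mu p.
Hypothesis p0 : p 0%N = 1.
Hypothesis prec : forall n, 'X * p n =
  p n.+1 * (a n)%:P + p n * (b n)%:P + preceding p n * (preceding a n)%:P.
Hypothesis bH : forall n, b n = b n ^t*.
Hypothesis aP : forall n, pdmx (a n).

Let Hmom : has_moments mu. Proof. by case: Hp. Qed.
Local Notation ev q := (fun t : R => mxeval q t%:C%C).
Local Notation s := (second_kind mu p).
Local Notation weyl := (weyl mu p a b).
Local Notation fraction := (fraction a b).
Local Notation kappa := (fun k => lead_coef (p k)).

Lemma matrix_measure_poly q : matrix_measure (poly_measure mu q).
Proof. exact: (matrix_measure_density Hmu Hmom (mtame_mxeval q)). Qed.

Lemma poly_measure_setT n : poly_measure mu (p n) setT = 1.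
Proof. by case: Hp => _ _ _ /(_ n n); rewrite eqxx. Qed.

Lemma scalar_integral_poly q h : bounded_lipschitz h ->
  scalar_integral (poly_measure mu q) setT h =
    form mu setT (ev q) (fun t => h t *: mxeval q t%:C%C).
Proof.
move=> [K [K0 hK hL]].
exact: (scalar_integral_density Hmu Hmom (mtame_mxeval q) K0 hK hL).
Qed.

Lemma scalar_integral_resolvent q z : z \isn't Num.real ->
  scalar_integral (poly_measure mu q) setT (fun t => (1 - z * t%:C%C)^-1) = green mu z q q.
Proof. by move=> zr; exact: (scalar_integral_poly q (bounded_lipschitz_resolvent zr)). Qed.

Lemma scalar_integral_shifted_resolvent n z : z \isn't Num.real ->
  scalar_integral (poly_measure mu (p n)) setT (fun t => t%:C%C / (1 - z * t%:C%C)) =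
    z^-1 *: (green mu z (p n) (p n) - 1).
Proof.
move=> zr; rewrite (_ : (fun t : R => _) = (fun t => z^-1 * (resolvent z t - 1))); last first.
  by apply/funext => t; rewrite -mul_resolvent.
rewrite scalar_integral_poly; last exact/bounded_lipschitz_affine/bounded_lipschitz_resolvent.
have te := mtame_mxeval (p n); have tr := mtame_resolvent (p n) zr.
transitivity (form mu setT (ev (p n)) (fun t => z^-1 *: (resolvent z t *: mxeval (p n) t%:C%C -
    mxeval (p n) t%:C%C))).
  by apply: eq_form => // t; rewrite -scalerA scalerBl scale1r.
rewrite (form_scaler Hmu Hmom measurableT _ te (mtameB tr te)).
rewrite (formBr Hmu Hmom measurableT te tr te) -innerE.
by case: Hp => _ _ _ ->; rewrite eqxx.
Qed.

Lemma lead_coef_recurrence n : kappa n = kappa n.+1 * a n.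
Proof.
have [_ sz _ _] := Hp; have := congr1 (fun q : {poly M} => q`_n.+1) (prec n).
rewrite coefXM /= !coefD !coefMC !lead_coefE !sz /= => ->.
rewrite [(p n)`_n.+1]nth_default ?sz// mul0r addr0.
suff -> : (preceding p n)`_n.+1 = 0 by rewrite mul0r addr0.
by case: n => [|n] /=; rewrite ?coef0// nth_default ?sz.
Qed.

Lemma lead_coef_ratio n : (kappa n)^-1 * preceding kappa n = preceding a n.
Proof.
case: n => [|n] /=; first by rewrite mulr0.
have [_ _ u _] := Hp.
by rewrite (lead_coef_recurrence n) mulrA mulVr ?mul1r.
Qed.

Section OffReal.
Variables (z : C) (n : nat).
Hypothesis zr : z \isn't Num.real.
Let zJr : z^* \isn't Num.real. Proof. by rewrite nonreal_conj. Qed.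
Local Notation G := (green mu z).
Local Notation K := (G (p n) (p n)).

Lemma recurrence_ratio k :
  z^-1%:M - b k - (mxeval (p k) z^-1)^-1 * mxeval (preceding p k) z^-1 * preceding a k =
  (mxeval (p k) z^-1)^-1 * mxeval (p k.+1) z^-1 * a k.
Proof.
have uk := orthogonal_poly_unit Hmu Hp p0 prec bH aP k zr.
have := mulVr_recurrence (mxeval (preceding p k) z^-1) (mxeval (p k.+1) z^-1)
  (preceding a k) (a k) (b k) uk.
rewrite -(recurrence_eval prec) -scalerAr mulVr// scalemx1 => ->.
by rewrite addrAC addrK addrC addrA addNr add0r.
Qed.

(** Dividing the recurrence by p_k(1/z) gives one step of the continued fraction. *)
Lemma poly_ratioE k :
  (mxeval (p k) z^-1)^-1 * mxeval (preceding p k) z^-1 * preceding a k = fraction k z.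
Proof.
have u j := orthogonal_poly_unit Hmu Hp p0 prec bH aP j zr.
elim: k => [|k IH]; first by rewrite /= mulr0.
rewrite /= -IH recurrence_ratio.
by rewrite (continued_fraction_step (u k) (u k.+1) (jacobi_a_unit aP k)).
Qed.

(** Entries below the diagonal are adjoints of entries above it at the conjugate point. *)
Lemma green_preceding :
  G (p n) (preceding p n) = K * ((mxeval (p n) z^-1)^-1 * mxeval (preceding p n) z^-1).
Proof.
have un := orthogonal_poly_unit Hmu Hp p0 prec bH aP n zr.
have gJ m : (m <= n)%N -> G (p n) (p m) = (s z^* n) ^t* * mxeval (p m) z^-1.
  move=> mn; have := green_adj Hmu Hmom zJr (p m) (p n); rewrite conjCK => <-.
  rewrite (green_lower Hmu Hp p0 prec bH aP zJr mn) adjrM trmxCK.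
  by rewrite fmorphV/= conjCK.
rewrite gJ// -mulrA [mxeval (p n) _ * _]mulrA mulrV// mul1r.
case: n gJ => [|m] gJ; last exact: gJ.
by rewrite -[preceding p 0]/(0 : {poly M}) (green0r Hmu Hmom zr) mxeval0 mulr0.
Qed.

(** The recurrence for p_n read in the entry (n, n) of the Green matrix. *)
Lemma green_diag_inverse : K * (1 - z *: (fraction n z + weyl n z)) = 1.
Proof.
have z0 := nonreal_neq0 zr.
have rec := green_recr Hmu Hp prec zr (p n) n.
have inn : inner mu (p n) (p n) = 1 by case: Hp => _ _ _ ->; rewrite eqxx.
have un := second_kind_unit Hmu Hp p0 prec bH aP zr n.
have upper : G (p n) (p n.+1) = K * ((s z n)^-1 * s z n.+1).
  rewrite (green_lower Hmu Hp p0 prec bH aP zr (leqnSn n)) (green_diag Hmu Hp p0 prec bH aP zr).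
  by rewrite -!mulrA [s z n * _]mulrA mulrV// mul1r.
have : z^-1 *: (K - 1) = K * (fraction n z + weyl n z).
  have weylE : weyl n z = b n + (s z n)^-1 * s z n.+1 * a n by [].
  rewrite inn in rec; rewrite rec upper green_preceding -poly_ratioE weylE.
  by rewrite [in RHS]addrC !mulrDr !mulrA [K * b n + _]addrC.
move=> /(congr1 (fun X : M => z *: X)); rewrite scalerA mulfV// scale1r => h.
by rewrite mulrBr mulr1 -scalerAr -h opprB addrC subrK.
Qed.

End OffReal.

End PolynomialMeasures.

(** * Nevanlinna functions of the measures *)

Section Sums.
Variables (R : realType) (d : nat).
Implicit Types f g : R[i] -> 'M[R[i]]_d.+1.

Lemma psdmxD n (A B : 'M[R[i]]_n) : psdmx A -> psdmx B -> psdmx (A + B).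
Proof.
by move=> pA pB v; rewrite qform_sesqui sesquiDm -!qform_sesqui addr_ge0.
Qed.

Lemma nevanlinnaD f g : nevanlinna f -> nevanlinna g -> nevanlinna (fun z => f z + g z).
Proof.
move=> [fd fadj fpos] [gd gadj gpos]; split=> z zr.
- exact: derivableD (fd z zr) (gd z zr).
- by rewrite adjmxD fadj// gadj.
- by rewrite mxImD scalerDr; apply: psdmxD; [exact: fpos|exact: gpos].
Qed.

End Sums.

Section Conclusion.
Variables (R : realType) (d : nat) (mu : set R -> 'M[R[i]]_d.+1).
Variables (p : nat -> {poly 'M[R[i]]_d.+1}) (a b : nat -> 'M[R[i]]_d.+1).
Local Notation C := R[i].
Local Notation M := 'M[R[i]]_d.+1.
Hypothesis Hmu : matrix_measure mu.
Hypothesis Hp : orthonormal_polynomials mu p.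
Hypothesis p0 : p 0%N = 1.
Hypothesis prec : forall n, 'X * p n =
  p n.+1 * (a n)%:P + p n * (b n)%:P + preceding p n * (preceding a n)%:P.
Hypothesis bH : forall n, b n = b n ^t*.
Hypothesis aP : forall n, pdmx (a n).

Let Hmom : has_moments mu. Proof. by case: Hp. Qed.
Local Notation off_real := [pred z : C | z \isn't Num.real].
Local Notation weyl := (weyl mu p a b).
Local Notation fraction := (fraction a b).

(** Both sides are determined by the Stieltjes transform of mu. *)
Lemma nevanlinna_function_weyl f : nevanlinna_function_of mu f -> {in off_real, f =1 weyl 0}.
Proof.
move=> [_ fmu] z zr; have z0 := nonreal_neq0 zr; have [u int] := fmu z zr.
have s0 : second_kind mu p z 0 = (1 - z *: f z)^-1.
  rewrite second_kindE p0 -int -/(resolvent z) /green.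
  rewrite (scalar_integralE measurableT (mintegrable_tame Hmu Hmom measurableT (tame_resolvent zr))).
  by apply: eq_form => t; rewrite mxeval1.
rewrite (weyl0 Hmu Hp p0 prec bH aP zr) s0 invrK opprB addrC subrK.
by rewrite scalerA mulVf// scale1r.
Qed.

Lemma green_diag_inv z n : z \isn't Num.real ->
  [/\ green mu z (p n) (p n) \is a GRing.unit,
      1 - z *: (fraction n z + weyl n z) \is a GRing.unit &
      green mu z (p n) (p n) = (1 - z *: (fraction n z + weyl n z))^-1].
Proof.
move=> zr; have KX := green_diag_inverse Hmu Hp p0 prec bH aP n zr.
have uK := green_diag_unit Hmu Hp zr n.
move: (green mu z _ _) (1 - _) KX uK => K X KX uK.
have -> : X = K^-1 by rewrite -[X]mul1r -(mulVr uK) -mulrA KX mulr1.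
by rewrite unitrV invrK.
Qed.

End Conclusion.

Theorem theorem7p1 (R : realType) (d : nat)
    (mu : set R -> 'M[R[i]]_d.+1) (f : R[i] -> 'M[R[i]]_d.+1)
    (p : nat -> {poly 'M[R[i]]_d.+1}) (a b : nat -> 'M[R[i]]_d.+1) :
  matrix_measure mu -> mu setT = 1 ->
  nevanlinna_function_of mu f ->
  orthonormal_polynomials mu p -> p 0%N = 1 ->
  (forall n, 'X * p n =
     p n.+1 * (a n)%:P + p n * (b n)%:P + preceding p n * (preceding a n)%:P) ->
  (forall n, b n = b n ^t*) ->
  (forall n, pdmx (a n)) ->
  self_adjoint (jacobi_domain b a) (jacobi b a) ->
  schur_parameters b a f /\
  forall n : nat,
    let kappa := fun k => lead_coef (p k) in
    let mu_n := poly_measure mu (p n) in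
    let f_n := schur_iterate n f in
    let g_n := fun z : R[i] =>
      (mxeval (p n) z^-1)^-1 * mxeval (preceding p n) z^-1 *
      (kappa n)^-1 * preceding kappa n in
    [/\ [/\ matrix_measure mu_n, mu_n setT = 1 &
            forall z : R[i], z \isn't Num.real ->
              mxeval (p n) z^-1 \is a GRing.unit],
        [/\ nevanlinna f_n, nevanlinna g_n &
            nevanlinna_function_of mu_n (fun z => g_n z + f_n z)],
        forall z : R[i], z \isn't Num.real ->
          scalar_integral mu_n setT (fun t => (1 - z * t%:C%C)^-1)
            \is a GRing.unit /\
          scalar_integral mu_n setT (fun t => t%:C%C / (1 - z * t%:C%C)) *
          (scalar_integral mu_n setT (fun t => (1 - z * t%:C%C)^-1))^-1
          = g_n z + f_n z,
        is_the_function
          (schur_parameters (fun k => b (n + k)%N) (fun k => a (n + k)%N)) f_n &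
        is_the_function
          (terminating_schur_parameters n
             (fun k => if k is j.+1 then b (n - j.+1)%N else 0)
             (fun k => a (n - k.+1)%N)) g_n].
Proof.
move=> Hmu mu1 fmu Hp p0 prec bH aP Jsa.
have f0 := nevanlinna_function_weyl Hmu Hp p0 prec bH aP fmu.
split; first exact: (weyl_schur_parameters Hmu Hp p0 prec bH aP f0).
move=> n kappa mu_n f_n g_n.
have fn := schur_iterate_weyl Hmu Hp p0 prec bH aP n f0; rewrite add0n -/f_n in fn.
have gn : {in [pred z : R[i] | z \isn't Num.real], g_n =1 fraction a b n}.
  move=> z zr; rewrite /g_n -mulrA (lead_coef_ratio Hp prec).
  exact: (poly_ratioE Hmu Hp p0 prec bH aP zr).
have nevf : nevanlinna f_n.
  apply: (nevanlinna_eq _ (weyl_nevanlinna Hmu Hp p0 prec bH aP n)).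
  by move=> z zr; rewrite fn.
have nevg : nevanlinna g_n.
  apply: (nevanlinna_eq _ (fraction_nevanlinna bH aP n (adjmx0 _ _ _))).
  by move=> z zr; rewrite gn// add0r.
have intK z : z \isn't Num.real ->
    scalar_integral mu_n setT (fun t => (1 - z * t%:C%C)^-1) = green mu z (p n) (p n).
  by move=> zr; exact: (scalar_integral_resolvent Hmu Hp).
split.
- split; [exact: (matrix_measure_poly Hmu Hp)|exact: (poly_measure_setT Hp)|].
  by move=> z zr; exact: (orthogonal_poly_unit Hmu Hp p0 prec bH aP).
- split; [exact: nevf|exact: nevg|split; first exact: (nevanlinnaD nevg nevf)].
  move=> z zr; have [_ uX KX] := green_diag_inv Hmu Hp p0 prec bH aP n zr.
  by rewrite (gn z zr) (fn z zr) (intK z zr); split; [exact: uX|exact: KX].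
- move=> z zr; have z0 := nonreal_neq0 zr.
  have [uK uX KX] := green_diag_inv Hmu Hp p0 prec bH aP n zr.
  rewrite (intK z zr) (scalar_integral_shifted_resolvent Hmu Hp n zr).
  rewrite (gn z zr) (fn z zr); split; first exact: uK.
  rewrite KX in uK *; move: (fraction a b n z + _) uX => W uX.
  rewrite -scalerAl mulrBl mul1r mulrV ?unitrV// invrK subKr.
  by rewrite scalerA mulVf// scale1r.
- split; first exact: (weyl_schur_parameters Hmu Hp p0 prec bH aP fn).
  move=> h hs z zr; apply: (schur_parameters_unique bH aP Jsa zr hs).
  exact: (weyl_schur_parameters Hmu Hp p0 prec bH aP fn).
- have gs := fraction_schur_parameters bH aP gn.
  split; first exact: gs.
  move=> h hs z zr; apply: (terminating_schur_unique _ hs gs zr).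
  by case=> [|k]; rewrite ?adjmx0// -bH.
Qed.
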